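(* For $\lambda\in\mathcal P_{r,n}$ and $T\in NST(\lambda)$ put $N_T:=\mathcal D_Y F_T$. Then: (i) $N_T$ is an irreducible $\mathcal D_Y$-submodule of $\pi_+(\mathcal O_X)$; (ii) there is a direct sum decomposition $$\pi_+(\mathcal O_X)=\bigoplus_{\lambda\in\mathcal P_{r,n}}\ \bigoplus_{T\in NST(\lambda)}N_T .$$ (Here $\pi_+(\mathcal O_X)$ is regarded as a $\mathcal D_Y$-submodule of $\mathcal O_U$ as explained in the context.)
   Context: Setting. Let $n_1,\dots,n_r$ be positive integers, $n=\sum_i n_i$, $m_i=n_1+\cdots+n_{i-1}$ (so $m_1=0$), and $B_i=\{m_i+1,\dots,m_i+n_i\}$. The group $S_{n_1}\times\cdots\times S_{n_r}\subset S_n$ (the $i$-th factor permuting $B_i$) acts on $\mathcal O_X=\mathbb C[x_1,\dots,x_n]$ by $(\sigma f)(x_1,\dots,x_n)=f(x_{\sigma(1)},\dots,x_{\sigma(n)})$. Write $\mathcal O_Y=\mathcal O_X^{S_{n_1}\times\cdots\times S_{n_r}}=\mathbb C[y_1,\dots,y_n]$, where the $y_j$ with $j\in B_i$ are algebraically independent generators (e.g. the elementary symmetric polynomials) of $\mathbb C[x_j: j\in B_i]^{S_{n_i}}$, and let $\pi:X=\operatorname{Spec}\mathcal O_X\to Y=\operatorname{Spec}\mathcal O_Y$ be the finite map induced by inclusion. $\mathcal D_X$ and $\mathcal D_Y=\mathbb C\langle y_1,\dots,y_n,\partial/\partial y_1,\dots,\partial/\partial y_n\rangle$ are the Weyl algebras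 of $\mathcal O_X$ and $\mathcal O_Y$. Put $\Delta=\prod_i\prod_{k<l,\ k,l\in B_i}(x_k-x_l)$ (the Jacobian of $\pi$, up to a nonzero scalar), $\mathcal O_U=\mathbb C[x_1,\dots,x_n,\Delta^{-1}]$, $\mathcal O_V=\mathbb C[y_1,\dots,y_n,\Delta^{-2}]$. $\mathcal O_U$ is a left $\mathcal D_Y$-module: $\mathcal O_Y$ acts by multiplication and $\partial/\partial y_j$ acts by the unique extension of this derivation to $\mathcal O_U$ (which is finite étale over $\mathcal O_V$). Direct image. $\mathcal D_{X\to Y}=\mathcal O_X\otimes_{\mathcal O_Y}\mathcal D_Y$ is a $\mathcal D_X$-$\mathcal D_Y$-bimodule, and $\mathcal D_{Y\leftarrow X}$ is the $\mathcal D_Y$-$\mathcal D_X$-bimodule obtained from it by the standard transpositions $h\,\partial^\alpha\mapsto(-1)^{|\alpha|}\partial^\alpha h$ on both sides. The direct image is the left $\mathcal D_Y$-module $\pi_+(\mathcal O_X)=\mathcal D_{Y\leftarrow X}\otimes_{\mathcal D_X}\mathcal O_X$. There is an isomorphism $\mathcal T:\pi_+(\mathcal O_U)\cong\mathcal O_U$ of modules over $\mathcal D_V=\mathcal D_Y[\Delta^{-2}]$, $r(dy^{-1}\otimes dx)\mapsto r\Delta^{-1}$, where $dy^{-1}\otimes dx$ denotes the canonical generator (the class corresponding to $1\otimes1$ in $\mathcal D_{Y\leftarrow X}$). Through $\mathcal T$, $\pi_+(\mathcal O_X)\subset\pi_+(\mathcal O_U)$ is isomorphic as a $\mathcal D_Y$-module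 to the submodule $\mathcal T(\pi_+(\mathcal O_X))$ of $\mathcal O_U$, and is identified with it. Tableaux. $\mathcal P_{r,n}$ is the set of $r$-diagrams of type $(n_1,\dots,n_r)$, i.e. $r$-tuples $\lambda=(\lambda^1,\dots,\lambda^r)$ of partitions with $\lambda^i\vdash n_i$. $NST(\lambda)$ is the set of natural standard $r$-tableaux $T=(T^1,\dots,T^r)$ of shape $\lambda$: $T^i$ is a filling of $\lambda^i$ with the numbers of $B_i$, each used once, with strictly increasing rows and columns. Young symmetrizers. $e_{T^i}=\frac{f^{\lambda^i}}{n_i!}\sum_{\sigma\in R(T^i),\ \tau\in C(T^i)}\operatorname{sgn}(\tau)\,\tau\sigma$, where $R(T^i)$, $C(T^i)$ are the row and column stabilizers and $f^{\lambda^i}$ is the number of standard tableaux of shape $\lambda^i$. Higher Specht polynomials. For a standard tableau $S^i$ of shape $\lambda^i$ with entries $B_i$, the word $w(S^i)$ is obtained by reading each column from bottom to top, starting from the left. The smallest entry has index $0$; if $k$ has index $p$, then $k+1$ has index $p$ if it lies to the right of $k$ in $w(S^i)$ and $p+1$ if it lies to the left. Replacing entries by indices gives $i(S^i)$. Put $x_{T^i}^{i(S^i)}=\prod_b x_{T^i(b)}^{i(S^i)(b)}$ (product over the boxes $b$ of $\lambda^i$) and $F_{T^i}^{S^i}=e_{T^i}(x_{T^i}^{i(S^i)})$. Let $S_0^i$ be the canonical standard tableau of shape $\lambda^i$, whose cells are numbered (with the elements of $B_i$ in increasing order) from left to right in successive rows starting from the top, and $S_0=(S_0^1,\dots,S_0^r)$.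 For $T\in NST(\lambda)$ put $F_T:=F_T^{S_0}:=F_{T^1}^{S_0^1}\cdots F_{T^r}^{S_0^r}$. *)

(* Defs.v *)
From HB Require Import structures.
From mathcomp Require Import all_boot all_order all_fingroup all_algebra.
From mathcomp Require Import boolp classical_sets reals.
From mathcomp Require Import complex freeg mpoly.

Set Implicit Arguments.
Unset Strict Implicit.
Unset Printing Implicit Defensive.

Import Order.TTheory GRing.Theory Num.Theory.
Local Open Scope ring_scope.
Local Open Scope quotient_scope.

(* Factors are numbered by 'I_r and variables by 'I_n, both from 0.        *)
Section Blocks.
Variables (r : nat) (ns : 'I_r -> nat).

Definition nvars : nat := (\sum_(i < r) ns i)%N.

Definition start (i : 'I_r) : nat := (\sum_(k < r | (k < i)%N) ns k)%N.

Definition block (i : 'I_r) : {set 'I_nvars} :=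
  [set j : 'I_nvars | (start i <= j < start i + ns i)%N].

End Blocks.

(* A tableau is the list of its rows, from top to bottom.                  *)
Section Tableaux.
Variables (r : nat) (ns : 'I_r -> nat).
Local Notation n := (nvars ns).

Definition is_partition (m : nat) (lam : seq nat) : bool :=
  [&& sorted geq lam, 0%N \notin lam & sumn lam == m].

Definition tableau := seq (seq 'I_n).

Definition columns (t : tableau) : seq (seq 'I_n) :=
  [seq pmap (fun row => onth row b) t | b <- iota 0 (size (head [::] t))].

Definition increasing (s : seq 'I_n) : bool :=
  sorted (fun k l : 'I_n => (k < l)%N) s.

Definition standard (i : 'I_r) (lam : seq nat) (t : tableau) : bool :=
  [&& shape t == lam,
      perm_eq (flatten t) (enum (block ns i)),
      all increasing t & all increasing (columns t)].

(* f^lam, a standard tableau of shape lam being given by its row-reading    *)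
(* word                                                                     *)
Definition num_standard (i : 'I_r) (lam : seq nat) : nat :=
  #|[set w : (ns i).-tuple 'I_n | standard i lam (reshape lam w)]|.

(* S_0^i *)
Definition canonical (i : 'I_r) (lam : seq nat) : tableau :=
  reshape lam (enum (block ns i)).

Definition row_stab (i : 'I_r) (t : tableau) : {set 'S_n} :=
  [set s : 'S_n | perm_on (block ns i) s
     && all (fun row => all (fun k => s k \in row) row) t].

Definition col_stab (i : 'I_r) (t : tableau) : {set 'S_n} :=
  [set s : 'S_n | perm_on (block ns i) s
     && all (fun col => all (fun k => s k \in col) col) (columns t)].

(* w(S): columns from left to right, each from bottom to top *)
Definition word (t : tableau) : seq nat :=
  [seq val k | k <- flatten [seq rev c | c <- columns t]].

(* the index of the letter m + p, m being the smallest letter of w *)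
Fixpoint letter_index (w : seq nat) (m p : nat) : nat :=
  if p is p'.+1 then
    (letter_index w m p' + (index (m + p'.+1) w < index (m + p') w))%N
  else 0%N.

Definition entry_index (i : 'I_r) (t : tableau) (k : 'I_n) : nat :=
  letter_index (word t) (start ns i) (k - start ns i).

Definition rdiagram := {ffun 'I_r -> seq nat}.
Definition rtableau := {ffun 'I_r -> tableau}.

Definition is_rdiagram (lam : rdiagram) : bool :=
  [forall i, is_partition (ns i) (lam i)].

Definition NST (lam : rdiagram) (t : rtableau) : bool :=
  [forall i, standard i (lam i) (t i)].

End Tableaux.

Section Rings.
Variables (R : realType) (r : nat) (ns : 'I_r -> nat).
Local Notation C := R[i].
Local Notation n := (nvars ns).

Local Notation OX := {mpoly C[n]}.

Definition Delta : OX :=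
  \prod_(i < r) \prod_(k in block ns i) \prod_(l in block ns i | (k < l)%N)
    ('X_k - 'X_l).

Lemma Delta_neq0 : Delta != 0.
Proof.
apply/prodf_neq0 => i _; apply/prodf_neq0 => k _; apply/prodf_neq0 => l.
move=> /andP[_ ltkl]; rewrite subr_eq0; apply/eqP => /(congr1 (mcoeff U_(k))).
rewrite !mcoeffXU eqxx; case: eqP ltkl => [->|_ _]; first by rewrite ltnn.
by apply/eqP; rewrite oner_eq0.
Qed.

Local Notation K := {fraction OX}.

(* O_U = O_X[Delta^-1], inside the field of rational functions *)
Definition in_OU : {pred K} :=
  [pred f : K | `[< exists (p : OX) (k : nat), f = tofrac p / tofrac Delta ^+ k >]].

Fact in_OU_subring : subring_closed in_OU.
Proof.
have D0 k : tofrac Delta ^+ k != 0 :> K.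
  by rewrite expf_neq0 // tofrac_eq0 Delta_neq0.
split=> [|f g|f g].
- by apply/asboolP; exists 1, 0%N; rewrite expr0 divr1 rmorph1.
- move=> /asboolP[p [k ->]] /asboolP[q [l ->]]; apply/asboolP.
  exists (p * Delta ^+ l - q * Delta ^+ k), (k + l)%N.
  rewrite rmorphB !rmorphM !rmorphXn /= exprD.
  by rewrite -[- (tofrac q / _)]mulNr addf_div ?D0 // mulNr.
- move=> /asboolP[p [k ->]] /asboolP[q [l ->]]; apply/asboolP.
  by exists (p * q), (k + l)%N; rewrite rmorphM /= exprD mulf_div.
Qed.
HB.instance Definition _ := GRing.isSubringClosed.Build K in_OU in_OU_subring.

Record OU := MkOU { OU_val :> K; _ : OU_val \in in_OU }.
HB.instance Definition _ := [isSub for OU_val].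
HB.instance Definition _ := [Choice of OU by <:].
HB.instance Definition _ := [SubChoice_isSubComNzRing of OU by <:].

Fact OX_in_OU (p : OX) : tofrac p \in in_OU.
Proof. by apply/asboolP; exists p, 0%N; rewrite expr0 divr1. Qed.

Definition toOU (p : OX) : OU := MkOU (OX_in_OU p).

(* p involves only the variables x_j, j in B_i *)
Definition block_poly (i : 'I_r) (p : OX) : Prop :=
  forall m : 'X_{1..n}, m \in msupp p -> forall k, k \notin block ns i -> m k = 0%N.

(* p lies in C[x_j : j in B_i]^{S_{n_i}} *)
Definition block_invariant (i : 'I_r) (p : OX) : Prop :=
  block_poly i p /\ forall s : 'S_n, perm_on (block ns i) s -> msym s p = p.

(* for every i, the y_j with j in B_i are algebraically independent and     *)
(* generate C[x_j : j in B_i]^{S_{n_i}}                                     *)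
Definition invariant_generators (y : n.-tuple OX) : Prop :=
  forall i : 'I_r,
  [/\ forall j, j \in block ns i -> block_invariant i (tnth y j),
      forall p, block_invariant i p ->
        exists2 q : OX, block_poly i q & p = q \mPo y
    & forall q : OX, block_poly i q -> q \mPo y = 0 -> q = 0].

Definition derivation (D : OU -> OU) : Prop :=
  [/\ forall u v, D (u + v) = D u + D v,
      forall u v, D (u * v) = D u * v + u * D v
    & forall c : C, D (toOU c%:MP) = 0].

(* d j is the extension to O_U of the derivation d/dy_j of O_Y = C[y] *)
Definition dy_extensions (y : n.-tuple OX) (d : 'I_n -> OU -> OU) : Prop :=
  forall j, derivation (d j) /\
    forall k, d j (toOU (tnth y k)) = if j == k then 1 else 0.

(* The generators of a Weyl algebra in n variables over C; they stand for   *)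
(* c, x_j, d/dx_j in D_X and for c, y_j, d/dy_j in D_Y.                     *)
Variant weyl_gen := Scal (c : C) | Pos (j : 'I_n) | Der (j : 'I_n).

Definition DX_on_OX (g : weyl_gen) (f : OX) : OX :=
  match g with
  | Scal c => c *: f
  | Pos j => 'X_j * f
  | Der j => mderiv j f
  end.

Definition DY_on_OU (y : n.-tuple OX) (d : 'I_n -> OU -> OU)
    (g : weyl_gen) (u : OU) : OU :=
  match g with
  | Scal c => toOU c%:MP * u
  | Pos j => toOU (tnth y j) * u
  | Der j => d j u
  end.

(* D_{X->Y} = O_X (x)_{O_Y} D_Y is O_X-free on the monomials in the d/dy_j. *)
(* The element \sum_a h_a (x) (d/dy)^a is encoded as the polynomial         *)
(* \sum_a h_a 'X^a with coefficients in O_X, so that in what follows 'X_j   *)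
(* stands for d/dy_j.                                                       *)
Local Notation transfer := {mpoly OX[n]}.

(* left action of D_X, the derivations acting by                            *)
(*   d/dx_i (h (x) P) =                                                     *)
(*     dh/dx_i (x) P + \sum_j h (dy_j/dx_i) (x) (d/dy_j) P                  *)
Definition transfer_DX (y : n.-tuple OX) (g : weyl_gen) (P : transfer) :
    transfer :=
  match g with
  | Scal c => c%:MP *: P
  | Pos i => ('X_i : OX) *: P
  | Der i => map_mpoly (mderiv i) P
             + \sum_(j < n) mderiv i (tnth y j) *: ('X_j * P)
  end.

(* right action of D_Y: (d/dy)^a y_j = y_j (d/dy)^a + a_j (d/dy)^(a - e_j)  *)
Definition transfer_DY (y : n.-tuple OX) (g : weyl_gen) (P : transfer) :
    transfer :=
  match g with
  | Scal c => c%:MP *: P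
  | Pos j => tnth y j *: P + mderiv j P
  | Der j => P * 'X_j
  end.

(* D_{Y<-X}: the same elements, with sides exchanged by the anti-           *)
(* automorphisms of D_X and D_Y that fix the functions and change the sign  *)
(* of the derivations; h (x) (d/dy)^a becomes (-1)^|a| (d/dy)^a (x) h.      *)
Definition transpose_sign (g : weyl_gen) : OX :=
  if g is Der _ then -1 else 1.

Definition cotransfer_DY (y : n.-tuple OX) (g : weyl_gen) (P : transfer) :
    transfer :=
  transpose_sign g *: transfer_DY y g P.

Definition cotransfer_DX (y : n.-tuple OX) (g : weyl_gen) (P : transfer) :
    transfer :=
  transpose_sign g *: transfer_DX y g P.

(* pi_+(O_X) = D_{Y<-X} (x)_{D_X} O_X, as the quotient of the free abelian  *)
(* group on D_{Y<-X} * O_X by the relations of a tensor product.            *)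
(* Compatibility with the generators of D_X suffices.                       *)
Local Notation formal := {freeg (transfer * OX)%type}.

Inductive tensor_rel (y : n.-tuple OX) : formal -> Prop :=
| TensorZero : tensor_rel y 0
| TensorSub a b : tensor_rel y a -> tensor_rel y b -> tensor_rel y (a - b)
| TensorDl P P' f :
    tensor_rel y (<< (P + P', f) >> - << (P, f) >> - << (P', f) >>)
| TensorDr P f f' :
    tensor_rel y (<< (P, f + f') >> - << (P, f) >> - << (P, f') >>)
| TensorBal g P f :
    tensor_rel y (<< (cotransfer_DX y g P, f) >> - << (P, DX_on_OX g f) >>).

Definition tensor_null (y : n.-tuple OX) : {pred formal} :=
  [pred a : formal | `[< tensor_rel y a >]].

Fact tensor_null_zmod (y : n.-tuple OX) : zmod_closed (tensor_null y).
Proof.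
split=> [|a b /asboolP ra /asboolP rb]; apply/asboolP.
  exact: TensorZero.
exact: TensorSub.
Qed.
HB.instance Definition _ (y : n.-tuple OX) :=
  GRing.isZmodClosed.Build formal (tensor_null y) (tensor_null_zmod y).

Definition pi_plus (y : n.-tuple OX) := {ideal_quot tensor_null y}.
HB.instance Definition _ (y : n.-tuple OX) := GRing.Zmodule.on (pi_plus y).

Definition tensor (y : n.-tuple OX) (P : transfer) (f : OX) : pi_plus y :=
  \pi_{ideal_quot tensor_null y} << (P, f) >>.

(* T restricted to pi_+(O_X): the D_Y-linear embedding into O_U that maps   *)
(* r (dy^-1 (x) dx) = (1 (x) 1) (x) r to r Delta^-1; D_Y acts on pi_+(O_X)  *)
(* through the left factor of the tensor product.                           *)
Definition direct_image_embedding (y : n.-tuple OX) (d : 'I_n -> OU -> OU)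
    (T : {additive pi_plus y -> OU}) : Prop :=
  [/\ injective T,
      forall g P f,
        T (tensor y (cotransfer_DY y g P) f) = DY_on_OU y d g (T (tensor y P f))
    & forall f : OX, OU_val (T (tensor y 1 f)) = tofrac f / tofrac Delta].

(* D_Y, as an algebra of operators on its faithful module O_U               *)
Inductive DY (y : n.-tuple OX) (d : 'I_n -> OU -> OU) : (OU -> OU) -> Prop :=
| DY_gen g : DY y d (DY_on_OU y d g)
| DY_add A B : DY y d A -> DY y d B -> DY y d (fun u => A u + B u)
| DY_mul A B : DY y d A -> DY y d B -> DY y d (fun u => A (B u)).

Definition DY_submodule (y : n.-tuple OX) (d : 'I_n -> OU -> OU)
    (N : set OU) : Prop :=
  [/\ N 0, forall u v, N u -> N v -> N (u + v)
    & forall A u, DY y d A -> N u -> N (A u)].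

Definition DY_irreducible (y : n.-tuple OX) (d : 'I_n -> OU -> OU)
    (N : set OU) : Prop :=
  [/\ DY_submodule y d N, N <> [set 0]%classic
    & forall N' : set OU, DY_submodule y d N' -> (N' `<=` N)%classic ->
        N' = [set 0]%classic \/ N' = N].

(* D_Y u *)
Definition DY_cyclic (y : n.-tuple OX) (d : 'I_n -> OU -> OU) (u : OU) :
    set OU :=
  [set v | exists2 A, DY y d A & v = A u]%classic.

(* A permutation sigma acts on O_X by msym sigma : 'X_k |-> 'X_(sigma k).   *)
(* The nested msym below is the product tau sigma of the group algebra      *)
(* (apply sigma first), whereas the product of 'S_n is in the other order.  *)
Definition young_symmetrizer (i : 'I_r) (lam : seq nat)
    (t : tableau ns) (f : OX) : OX :=
  ((num_standard ns i lam)%:R / ((ns i)`!)%:R : C) *: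
    \sum_(s in row_stab i t) \sum_(u in col_stab i t)
      (-1) ^+ odd_perm u *: msym u (msym s f).

(* x_t^{i(s)}, for t and s of the same shape *)
Definition index_monomial (i : 'I_r) (t s : tableau ns) : OX :=
  \prod_(b <- zip (flatten t) (flatten s)) 'X_(b.1) ^+ entry_index i s b.2.

Definition higher_specht (i : 'I_r) (lam : seq nat) (t s : tableau ns) : OX :=
  young_symmetrizer i lam t (index_monomial i t s).

(* F_T = F_T^{S_0} *)
Definition F_ (lam : rdiagram r) (t : rtableau ns) : OX :=
  \prod_(i < r) higher_specht i (lam i) (t i) (canonical ns i (lam i)).

(* N_T *)
Definition N_ (y : n.-tuple OX) (d : 'I_n -> OU -> OU)
    (lam : rdiagram r) (t : rtableau ns) : set OU :=
  DY_cyclic y d (toOU (F_ lam t)).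

Definition direct_sum (I : eqType) (P : pred I) (N : I -> set OU)
    (M : set OU) : Prop :=
  (forall v, M v <->
     exists s : seq I, exists2 u : I -> OU,
       [/\ uniq s, all P s & forall a, a \in s -> N a (u a)]
       & v = \sum_(a <- s) u a)
  /\ (forall (s : seq I) (u : I -> OU),
       uniq s -> all P s -> (forall a, a \in s -> N a (u a)) ->
       \sum_(a <- s) u a = 0 -> forall a, a \in s -> u a = 0).

End Rings.

(* Main.v *)
(** Let G be the Young group S_{n_1} x ... x S_{n_r}.  Up to a nonzero scalar,
    F_T is the Specht polynomial of T, the antisymmetrization over the column
    group of the monomial whose exponents are the row numbers.  It has minimal
    degree among the polynomials antisymmetric under the columns, so it generates
    a simple C[G]-module, and a triangularity argument yields for every T in a
    finite family an element of C[G] that fixes F_T and kills the other members.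
    Up to an invariant denominator, an operator of D_Y maps O_X to O_X and
    commutes with G, so these elements separate the terms of a sum of elements of
    the N_T: the sum of the N_T is direct.

    For fullness, finitely many F_T form a faithful family for C[G], because the
    numbers of pairs of tableaux of the same shape add up to the order of G (the
    relation DU - UD = 1 of Young's lattice).  If the polynomials contained in a
    D_Y-submodule N of O_U are faithful for C[G], then Artin's argument for the
    independence of automorphisms, with Wronskians in place of values, shows that
    N contains q O_X for some nonzero q.  The p such that p O_X Delta^-1 is
    contained in N form an ideal stable under all d/dx_i, hence containing 1, and
    N contains O_X Delta^-1, which generates pi_+(O_X).

    Finally, if N' is a nonzero submodule of N_T, then N' plus the other N_S is
    again faithful, hence contains F_T, and by directness F_T lies in N'. *)

(* Faithfulness of a family is a dimension count. To each pair (T, T') of tableaux of the same shape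
   belongs an element of C[G] that acts on the family as a matrix unit, sending F_T to F_T' and
   killing the other members. These elements are linearly independent, so |G| of them span C[G], and
   a combination that kills the family is zero. Only a lower bound for the number of pairs enters;
   an injection from pairs of lattice words into pairs of tableaux supplies it. The scalars that
   Schur's lemma would give are read off with column antisymmetrizers: by minimality of degree, each
   of them maps the module of its Specht polynomial onto a line. On the side of differential
   operators the obstacle is that elements of O_U are not polynomials and that Delta is not
   G-invariant. Denominators are therefore powers of the norm of Delta over G, and equivariance is
   stated on O_X. An r-tableau is treated as one tableau whose columns are labelled by block and
   column number, so that the algebra of Specht polynomials is that of a single tableau. *)
Require Import Defs.
From HB Require Import structures.
From mathcomp Require Import all_boot all_order all_fingroup all_algebra.
From mathcomp Require Import zify ring.
From mathcomp Require Import boolp classical_sets reals.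
From mathcomp Require Import complex freeg mpoly.
Import Order.TTheory GRing.Theory Num.Theory.

Set Implicit Arguments.
Unset Strict Implicit.
Unset Printing Implicit Defensive.

(** * Counting pairs of lattice words *)

(* Lattice words are stored backwards: the head of the list is the last
   letter. The letter at position [p] is the row of the entry [p]. *)
Section LatticeWords.
Variable N : nat.
Implicit Types (l : nat -> nat) (w : seq nat).

Definition addable l i := (i == 0) || (l i < l i.-1).
Definition removable l j := l j.+1 < l j.
Definition inc i l := fun k => l k + (k == i).
Definition dec i l := fun k => l k - (k == i).
Definition part l := forall k, l k.+1 <= l k.

Definition content w := fun k => count_mem k w.

Fixpoint lattice_words m : seq (seq nat) :=
  if m is m'.+1 then
    [seq i :: w | w <- lattice_words m',
                  i <- [seq i <- iota 0 N.+1 | addable (content w) i]]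
  else [:: [::]].

Lemma lattice_words_eqS m : lattice_words m.+1 = [seq i :: w |
  w <- lattice_words m, i <- [seq i <- iota 0 N.+1 | addable (content w) i]].
Proof. by []. Qed.

(** Counts the ways to strip the shape l of m boxes one at a time. It is f^l when l is a partition
    of m; the base case returns 1 whatever is left. *)
Fixpoint num_words m l : nat :=
  if m is m'.+1 then \sum_(j < N.+1 | removable l j) num_words m' (dec j l)
  else 1.

Lemma content_cons i w : content (i :: w) = inc i (content w).
Proof. by apply/funext => k; rewrite /content /inc /= addnC eq_sym. Qed.

Lemma part_dec l j : part l -> removable l j -> part (dec j l).
Proof.
move=> pl rj k; have := pl k; rewrite /dec; case: (k.+1 =P j) => [<-|_].
  by lia.
by case: (k =P j) => [->|_]; move: rj; rewrite /removable; lia.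
Qed.

Lemma part_inc l i : part l -> addable l i -> part (inc i l).
Proof.
move=> pl ai k; have := pl k; rewrite /inc; case: (k =P i) => [->|_]; first lia.
case: (k.+1 =P i) ai => [<-|_ _]; last by lia.
by rewrite /addable /=; lia.
Qed.

Lemma inc_dec l j : removable l j -> inc j (dec j l) = l.
Proof.
move=> rj; apply/funext => k; rewrite /inc /dec.
by case: (k =P j) => [->|_]; move: rj; rewrite /removable; lia.
Qed.

Lemma dec_inc l j : dec j (inc j l) = l.
Proof. by apply/funext => k; rewrite /inc /dec; lia. Qed.

Lemma addable_dec l j : part l -> removable l j -> addable (dec j l) j.
Proof.
move=> pl; rewrite /addable /removable /dec eqxx; case: j => //= j rj.
by have := pl j; case: eqP; lia.
Qed.

Lemma removable_inc l i : part l -> removable (inc i l) i.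
Proof. by move=> pl; have := pl i; rewrite /removable /inc; lia. Qed.

(** The two moves interact only if i = j + 1; then both sides say that row j is longer than row i by
    at least two. *)
Lemma add_rem_swap l i j : part l -> i != j ->
  addable l i && removable (inc i l) j = removable l j && addable (dec j l) i.
Proof.
move=> pl ij; rewrite /addable /removable /inc /dec.
rewrite (eq_sym j) (negPf ij) addn0 subn0; case: i ij => [|i] /= ij.
  by rewrite addn0 andbT.
rewrite eqSS (eq_sym i); case: eqP => [<-|]; last by rewrite addn0 subn0 andbC.
by have := pl j; lia.
Qed.

Lemma dec_inc_swap l i j : i != j -> dec j (inc i l) = inc i (dec j l).
Proof. by move=> ij; apply/funext => k; rewrite /dec /inc; lia. Qed.

(** Row k + 1 is addable exactly when row k is removable, and row 0 is always addable. Row N is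
    empty, so nothing is lost at the end of the range. *)
Lemma card_addable l : l N = 0 -> 
  \sum_(i < N.+1 | addable l i) 1 = (\sum_(j < N.+1 | removable l j) 1).+1.
Proof.
move=> lN; rewrite big_mkcond big_ord_recl /= add1n [in RHS]big_mkcond.
by rewrite big_ord_recr /= {2}/removable lN ltn0 addn0; congr _.+1.
Qed.

(* The commutation relation DU - UD = 1 of Young's lattice, summed up. *)
Lemma up_down m l : part l -> \sum_(k < N.+1) l k = m ->
  (forall k, N <= k -> l k = 0) ->
  \sum_(i < N.+1 | addable l i) num_words m.+1 (inc i l)
  = m.+1 * num_words m l.
Proof.
elim: m l => [|m IH] l pl sl l0.
  have l_eq0 k : l k = 0.
    have [lt_k|] := ltnP k N; last exact: l0.
    have := sl; rewrite (bigD1 (Ordinal (leqW lt_k))) //=; lia.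
  rewrite (bigD1 ord0) // big1 ?addn0; last first.
    by move=> i; rewrite /addable !l_eq0 orbF => /andP[/eqP i0 /eqP[]];
       apply: val_inj.
  rewrite /= (bigD1 ord0) /=; last by rewrite /removable /inc !l_eq0.
  by rewrite big1 // => j; rewrite /removable /inc !l_eq0 -val_eqE; case: j => -[].
(* After a box is added to row i, the next removal either takes it back (first sum) or concerns
   another row j, and then it may be done before the addition (second sum). *)
have -> : \sum_(i < N.+1 | addable l i) num_words m.+2 (inc i l)
    = \sum_(i < N.+1 | addable l i) num_words m.+1 l
    + \sum_(j < N.+1 | removable l j)
        \sum_(i < N.+1 | addable (dec j l) i && (i != j))
           num_words m.+1 (inc i (dec j l)).
  rewrite [X in _ = _ + X](exchange_big_dep xpredT) //=.
  rewrite [X in X + _]big_mkcond -big_split /= big_mkcond /=.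
  apply: eq_bigr => i _; case: ifP => [ai|nai].
    rewrite (bigD1 i) ?removable_inc //= dec_inc; congr (_ + _).
    apply: eq_big => [j|j /andP[_ ji]]; last by rewrite dec_inc_swap // eq_sym.
    case: (eqVneq j i) => [->|ji]; first by rewrite ?eqxx !andbF.
    by rewrite !andbT -add_rem_swap ?ai // eq_sym.
  rewrite add0n big1 // => j /and3P[rj aj ij].
  have := add_rem_swap pl ij; rewrite rj aj.
  by move: nai => /negbT/negPf->.
have decE (j : 'I_N.+1) : removable l j ->
    num_words m.+1 l + \sum_(i < N.+1 | addable (dec j l) i && (i != j))
        num_words m.+1 (inc i (dec j l)) = m.+1 * num_words m (dec j l).
  move=> rj; rewrite -IH.
  - by rewrite [RHS](bigD1 j) ?addable_dec //= (inc_dec rj).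
  - exact: part_dec.
  - apply: succn_inj; rewrite -sl (bigD1 j) //=.
    rewrite [in RHS](bigD1 j) //= {1}/dec eqxx.
    rewrite (eq_bigr (fun k : 'I_N.+1 => l k)).
      by move: rj; rewrite /removable; lia.
    by move=> k; rewrite /dec -val_eqE /= => /negPf->; rewrite subn0.
  - by move=> k lek; rewrite /dec l0.
have sum_add c : \sum_(i < N.+1 | addable l i) c
    = c + \sum_(j < N.+1 | removable l j) c.
  have sum_c (P : pred 'I_N.+1) : \sum_(i | P i) c = c * \sum_(i | P i) 1.
    by rewrite big_distrr; apply: eq_bigr => i _; rewrite /= muln1.
  by rewrite !sum_c card_addable ?l0 // mulnS.
(* The surplus addable row raises the factor of the induction hypothesis by one. *)
rewrite sum_add -addnA -big_split.
rewrite (eq_bigr (fun j : 'I_N.+1 => m.+1 * num_words m (dec j l))); last first.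
  by move=> j; apply: decE.
by rewrite -big_distrr /= mulSn.
Qed.

Lemma lattice_wordsS m i w : (i :: w \in lattice_words m.+1)
  = [&& i < N.+1, addable (content w) i & w \in lattice_words m].
Proof.
apply/allpairsPdep/idP => [[w' [i' [w'Y + [-> ->]]]]|/and3P[lt_i ai wY]].
  by rewrite mem_filter mem_iota /= add0n w'Y => /andP[-> ->].
by exists w, i; rewrite mem_filter ai mem_iota /= lt_i.
Qed.

Lemma size_lattice_word m w : w \in lattice_words m -> size w = m.
Proof.
elim: m w => [|m IH] [|i w] //; first by move=> /allpairsPdep[? [? []]].
by rewrite lattice_wordsS => /and3P[_ _ /IH/= ->].
Qed.

Lemma part_lattice_word m w : w \in lattice_words m -> part (content w).
Proof.
elim: m w => [|m IH] [|i w] //.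
rewrite lattice_wordsS content_cons => /and3P[_ ai /IH pw].
exact: part_inc.
Qed.

Lemma lattice_word_ge m w k : w \in lattice_words m -> m <= k ->
  content w k = 0.
Proof.
elim: m w k => [|m IH] [|i w] k //.
rewrite lattice_wordsS content_cons => /and3P[_ ai wY] lt_k.
case: k lt_k => // k lt_k; rewrite /inc (IH _ _ wY (ltnW lt_k)).
case: eqP => // ki; move: ai; rewrite -ki /addable /=.
by rewrite (IH _ _ wY (ltnW lt_k)) (IH _ _ wY lt_k).
Qed.

Lemma sum_content w : (forall i, i \in w -> i < N.+1) ->
  \sum_(k < N.+1) content w k = size w.
Proof.
elim: w => [|i w IH] h; first by rewrite big1.
have lt_i : i < N.+1 by rewrite h ?mem_head.
rewrite content_cons /inc big_split /= IH => [|j jw]; last first.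
  by rewrite h // inE jw orbT.
rewrite (bigD1 (Ordinal lt_i)) //= eqxx big1 ?addn0 ?addn1 // => k.
by rewrite -val_eqE /= => /negPf->.
Qed.

Lemma lattice_word_lt m w i : w \in lattice_words m -> i \in w -> i < N.+1.
Proof.
elim: m w => [|m IH] [|j w] //.
rewrite lattice_wordsS inE => /and3P[lt_j _ wY] /predU1P[->//|].
exact: IH.
Qed.

Lemma lattice_words_uniq m : uniq (lattice_words m).
Proof.
elim: m => // m IH.
apply: (@allpairs_uniq_dep _ (fun=> nat) _ (fun w i => i :: w)) => //.
  by move=> w _; rewrite filter_uniq // iota_uniq.
by move=> [w i] [w' i'] _ _ [-> ->].
Qed.

(** By [up_down], the extensions of a word w by one letter contribute m + 1 times the term of w. The
    bound on m keeps row N of w empty. *)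
Lemma sum_num_words m : m <= N ->
  \sum_(w <- lattice_words m) num_words m (content w) = m`!.
Proof.
elim: m => [|m IH] le_m; first by rewrite big_seq1.
rewrite factS -(IH (ltnW le_m)) lattice_words_eqS big_allpairs_dep.
rewrite big_distrr big_seq [RHS]big_seq; apply: eq_bigr => w wY.
rewrite -[RHS]/(m.+1 * num_words m (content w)) -up_down; first last.
- by move=> k le_k; apply: (lattice_word_ge wY (leq_trans (ltnW le_m) le_k)).
- rewrite sum_content ?(size_lattice_word wY) // => i.
  exact: lattice_word_lt wY.
- exact: part_lattice_word wY.
rewrite big_filter -[iota 0 N.+1]/(index_iota 0 N.+1) big_mkord.
by apply: eq_bigr => i _; rewrite content_cons.
Qed.

Lemma count_lattice_words m l : part l -> \sum_(k < N.+1) l k = m ->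
  (forall k, N < k -> l k = 0) ->
  count (fun w => content w == l :> (nat -> nat)) (lattice_words m)
  = num_words m l.
Proof.
elim: m l => [|m IH] l pl sl l0.
  rewrite /= addn0 (_ : content [::] = l) ?eqxx //; apply/funext => k.
  have [lt_k|] := ltnP k N.+1; last by move/l0->.
  by have := sl; rewrite (bigD1 (Ordinal lt_k)) //= /content /=; lia.
rewrite -sum1_count lattice_words_eqS big_mkcond big_allpairs_dep.
under eq_bigr => w _ do
  rewrite big_filter -[iota 0 N.+1]/(index_iota 0 N.+1) big_mkord big_mkcond.
rewrite exchange_big -[RHS]/(\sum_(j < N.+1 | removable l j) num_words m (dec j l)).
rewrite [RHS]big_mkcond; apply: eq_bigr => i _.
transitivity (\sum_(w <- lattice_words m |
    addable (content w) i && (content (nat_of_ord i :: w) == l)) 1).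
  by rewrite [RHS]big_mkcond; apply: eq_bigr => w _; case: (addable _ _).
case: ifP => [ri|nri].
  rewrite -IH; first last.
  - by move=> k lek; rewrite /dec l0.
  - apply: succn_inj; rewrite -sl (bigD1 i) //= [in RHS](bigD1 i) //=.
    rewrite {1}/dec eqxx (eq_bigr (fun k : 'I_N.+1 => l k)).
      by move: ri; rewrite /removable; lia.
    by move=> k; rewrite /dec -val_eqE /= => /negPf->; rewrite subn0.
  - exact: part_dec.
  rewrite -[RHS]sum1_count; apply: eq_bigl => w; rewrite content_cons.
  apply/andP/eqP => [[_ /eqP<-]|->]; first by rewrite dec_inc.
  by rewrite addable_dec // inc_dec.
rewrite big_seq_cond big_pred0 // => w; apply/negbTE/negP.
case/and3P => /part_lattice_word pw _ /eqP; rewrite content_cons => e.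
by move: nri; rewrite -e removable_inc.
Qed.

Definition shape_pairs m : seq (seq nat * seq nat) :=
  [seq (w, w') | w <- lattice_words m,
     w' <- [seq w' <- lattice_words m | content w' == content w :> (nat -> nat)]].

Lemma mem_shape_pairs m w w' : ((w, w') \in shape_pairs m)
  = [&& w \in lattice_words m, w' \in lattice_words m &
        content w' == content w :> (nat -> nat)].
Proof.
apply/allpairsPdep/and3P => [[v [v' [vY + [-> ->]]]]|[wY w'Y e]].
  by rewrite mem_filter => /andP[].
by exists w, w'; rewrite mem_filter e.
Qed.

Lemma shape_pairs_uniq m : uniq (shape_pairs m).
Proof.
apply: (@allpairs_uniq_dep _ (fun=> seq nat) _ (fun w w' => (w, w'))).
  exact: lattice_words_uniq.
  by move=> w _; rewrite filter_uniq // lattice_words_uniq.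
by move=> [w i] [w' i'] _ _ [-> ->].
Qed.

(** The classical identity that the squares of the f^lambda add up to m!, with pairs of words in
    place of squares. *)
Lemma size_shape_pairs m : m <= N -> size (shape_pairs m) = m`!.
Proof.
move=> le_m; rewrite size_allpairs_dep sumnE big_map -sum_num_words //.
rewrite big_seq [RHS]big_seq; apply: eq_bigr => w wY; rewrite size_filter.
apply: count_lattice_words; first exact: part_lattice_word wY.
  by rewrite sum_content ?(size_lattice_word wY) // => i; apply: lattice_word_lt wY.
move=> k lt_k; apply: (lattice_word_ge wY); exact: leq_trans le_m (ltnW lt_k).
Qed.

End LatticeWords.

(** * Rows, columns and reading words of fillings *)

Section Boxes.
Variable T : eqType.
Implicit Types (t : seq (seq T)) (k : T).

Definition rowt t k := find (fun row : seq T => k \in row) t.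
Definition colt t k := index k (nth [::] t (rowt t k)).
Definition colseq t b := pmap (fun row => onth row b) t.

(** Row and column of the box with number p when the boxes of the shape are numbered row by row, as
    in a canonical tableau. *)
Fixpoint pos (sh : seq nat) p : nat * nat :=
  if sh is a :: sh' then
    if p < a then (0, p) else ((pos sh' (p - a)).1.+1, (pos sh' (p - a)).2)
  else (0, p).

Lemma nth_mem_rowt t k : k \in flatten t -> k \in nth [::] t (rowt t k).
Proof.
case/flattenP => r rt kr; apply: (@nth_find _ [::] (fun row : seq T => k \in row)).
by apply/hasP; exists r.
Qed.

Lemma rowt_uniq t k j : uniq (flatten t) -> k \in nth [::] t j -> rowt t k = j.
Proof.
elim: t j => [|r t IH] [|j] //=; rewrite /rowt /= cat_uniq => /and3P[_ rt ut].
  by move->.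
move=> kj; have kt : k \in flatten t.
  apply/flattenP; exists (nth [::] t j) => //; apply: mem_nth.
  by rewrite ltnNge; apply: contraL kj => /(nth_default [::])->.
by rewrite (negPf (hasPn rt _ kt)) -/(rowt t k) (IH j).
Qed.

Lemma uniq_row t j : uniq (flatten t) -> uniq (nth [::] t j).
Proof.
elim: t j => [|r t IH] [|j] //=; rewrite cat_uniq => /and3P[ur _ ut] //.
exact: IH.
Qed.

Lemma rowt_nth x0 t j b : uniq (flatten t) -> b < size (nth [::] t j) ->
  rowt t (nth x0 (nth [::] t j) b) = j.
Proof. by move=> ut lt_b; apply: rowt_uniq ut (mem_nth _ lt_b). Qed.

Lemma colt_nth x0 t j b : uniq (flatten t) -> b < size (nth [::] t j) ->
  colt t (nth x0 (nth [::] t j) b) = b.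
Proof. by move=> ut lt_b; rewrite /colt rowt_nth // index_uniq ?uniq_row. Qed.

Lemma nth_rowt x0 t k : k \in flatten t ->
  nth x0 (nth [::] t (rowt t k)) (colt t k) = k.
Proof. by move=> kt; rewrite nth_index ?nth_mem_rowt. Qed.

Lemma colt_lt t k : k \in flatten t -> colt t k < size (nth [::] t (rowt t k)).
Proof. by move=> kt; rewrite index_mem nth_mem_rowt. Qed.

Lemma box_inj t k l : k \in flatten t -> l \in flatten t ->
  rowt t k = rowt t l -> colt t k = colt t l -> k = l.
Proof.
by move=> kt lt r c; rewrite -(nth_rowt k kt) -[RHS](nth_rowt k lt) r c.
Qed.

Lemma nth_mem_flatten t j k : k \in nth [::] t j -> k \in flatten t.
Proof.
move=> kj; apply/flattenP; exists (nth [::] t j) => //; apply: mem_nth.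
by rewrite ltnNge; apply: contraL kj => /(nth_default [::])->.
Qed.

Lemma mem_colseq t b k : uniq (flatten t) ->
  (k \in colseq t b) = (k \in flatten t) && (colt t k == b).
Proof.
move=> ut; rewrite mem_pmap; apply/mapP/andP => [[row rt e]|[kt /eqP<-]].
  have lt_b : b < size row by rewrite -onthTE -e.
  have rb : nth k row b = k by apply: onth_nth (esym e).
  have [j lt_j rj] := nthP [::] rt.
  move: lt_b; rewrite -rj => lt_b; have ck := colt_nth k ut lt_b.
  have kE : nth k (nth [::] t j) b = k by rewrite rj.
  rewrite kE in ck; split; last exact/eqP.
  by rewrite -kE; apply: (@nth_mem_flatten _ j); rewrite mem_nth.
exists (nth [::] t (rowt t k)).
  apply: mem_nth; rewrite -has_find; case/flattenP: kt => r rt kr.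
  by apply/hasP; exists r.
have := colt_lt kt; rewrite -onthTE.
case e: (onth _ _) => [a|] // _; congr Some.
have <- : nth k (nth [::] t (rowt t k)) (colt t k) = a by apply: onth_nth.
by rewrite nth_rowt.
Qed.

Lemma pos_flatten x0 t p : uniq (flatten t) -> p < size (flatten t) ->
  rowt t (nth x0 (flatten t) p) = (pos (shape t) p).1 /\
  colt t (nth x0 (flatten t) p) = (pos (shape t) p).2.
Proof.
elim: t p => [|r t IH] p //=; rewrite cat_uniq size_cat nth_cat.
case/and3P => ur rt ut lt_p; case: ltnP => [lt_pr|le_rp].
  by rewrite /colt /rowt /= mem_nth //= index_uniq.
have lt_p' : p - size r < size (flatten t) by rewrite ltn_subLR.
have [e1 e2] := IH _ ut lt_p'; rewrite -e1 -e2 /colt /rowt /=.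
have /negPf-> : nth x0 (flatten t) (p - size r) \notin r.
  by have /hasPn := rt; apply; apply: mem_nth.
by [].
Qed.

Lemma pos0 sh : 0 \notin sh -> 0 < sumn sh -> pos sh 0 = (0, 0).
Proof.
case: sh => // a sh; rewrite inE negb_or => /andP[a0 _] _ /=.
by rewrite lt0n eq_sym a0.
Qed.

Lemma pos_succ sh p : 0 \notin sh -> p.+1 < sumn sh ->
  pos sh p.+1 = ((pos sh p).1, (pos sh p).2.+1) \/
  pos sh p.+1 = ((pos sh p).1.+1, 0).
Proof.
elim: sh p => // a sh IH p; rewrite inE negb_or => /andP[a0 sh0] /= lt_p.
have [lt_pa|le_ap] := ltnP p a; last first.
  have lt_pa : (p - a).+1 < sumn sh.
    by rewrite -subSn // -(ltn_add2l a) subnKC ?leqW.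
  by rewrite ltnNge leqW //= subSn //; case: (IH _ sh0 lt_pa) => ->; [left|right].
have [lt_pa'|le_ap'] := ltnP p.+1 a; first by left.
right; have -> : p.+1 = a by apply/eqP; rewrite eqn_leq lt_pa le_ap'.
rewrite subnn pos0 //.
by rewrite -(ltn_add2l a) addn0; apply: leq_ltn_trans lt_p.
Qed.

Lemma index_flatten (ss : seq (seq T)) c k : k \in nth [::] ss c ->
  (forall c', c' < c -> k \notin nth [::] ss c') ->
  index k (flatten ss) = sumn (take c (shape ss)) + index k (nth [::] ss c).
Proof.
elim: ss c => [|s ss IH] [|c] //= kc h; rewrite index_cat.
  by rewrite kc.
rewrite (negPf (h 0 _)) // (IH c) ?addnA // => c' lt_c.
exact: (h c'.+1).
Qed.

Definition decr t := forall j, size (nth [::] t j.+1) <= size (nth [::] t j).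

Lemma decr_shape t : sorted geq (shape t) -> decr t.
Proof.
move=> st j; have [lt_j|le_j] := ltnP j.+1 (size t); last by rewrite nth_default.
have gt_trans : transitive geq by move=> a b c h1 h2; apply: leq_trans h2 h1.
have := sorted_ltn_nth gt_trans 0 st; move=> /(_ j j.+1).
rewrite !inE size_map lt_j (ltnW lt_j) => /(_ isT isT (leqnn _)).
by rewrite !(nth_map [::]) // ltnW.
Qed.

Lemma decr_le t i j : decr t -> i <= j ->
  size (nth [::] t j) <= size (nth [::] t i).
Proof.
move=> dt; elim: j => [|j IH]; first by rewrite leqn0 => /eqP->.
rewrite leq_eqVlt => /predU1P[->//|le_ij].
exact: leq_trans (dt j) (IH le_ij).
Qed.

Variable lt : rel T.
Hypothesis lt_trans : transitive lt.
Hypothesis lt_irr : irreflexive lt.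

Lemma sorted_colseq x0 t b : decr t -> sorted lt (colseq t b) <->
  (forall j, b < size (nth [::] t j.+1) ->
     lt (nth x0 (nth [::] t j) b) (nth x0 (nth [::] t j.+1) b)).
Proof.
elim: t => [|r t IH] dt; first by split=> // _ j; rewrite nth_nil.
have dt' : decr t by move=> j; apply: (dt j.+1).
rewrite /colseq /= -/(colseq t b).
case: t => [|r' t] in IH dt dt' *.
  rewrite /colseq /=; case: (onth r b) => [a|] /=; split=> // _ [|j] //=;
  by rewrite nth_nil.
have [lt_b|le_b] := ltnP b (size r'); last first.
  have -> : colseq (r' :: t) b = [::].
    apply/nilP; rewrite /nilp size_pmap -leqn0 leqNgt -has_count.
    apply/hasP => -[row rt]; rewrite /= onthTE => lt_b.
    have [j _ rj] := nthP [::] rt; move: lt_b; rewrite -rj ltnNge.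
    by rewrite (leq_trans (decr_le dt' (leq0n j))).
  split=> [_ j|_]; last by case: (onth r b).
  by rewrite ltnNge (leq_trans (decr_le dt (leq0n j : 0 < j.+1)) le_b).
have lt_br : b < size r by apply: leq_trans lt_b (dt 0).
have onthS (s : seq T) : b < size s -> onth s b = Some (nth x0 s b).
  by rewrite -onthTE; case e: (onth s b) => [a|] // _; congr Some; apply/esym/onth_nth.
rewrite onthS //=; split.
  rewrite /colseq /= (onthS r') //= => /andP[lt_h st] [|j] //=.
  by apply: (IH dt').1; rewrite /colseq /= (onthS r').
move=> h; have := (IH dt').2 (fun j => h j.+1).
rewrite /colseq /= (onthS r') //= => ->; rewrite andbT.
exact: (h 0).
Qed.

Lemma sorted_flatten_col x0 t j b : sorted lt (flatten t) ->
  b < size (nth [::] t j) -> b < size (nth [::] t j.+1) ->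
  lt (nth x0 (nth [::] t j) b) (nth x0 (nth [::] t j.+1) b).
Proof.
elim: t j => [|r t IH] j; first by rewrite nth_nil.
rewrite /= (sorted_pairwise lt_trans) pairwise_cat => /and3P[/allrelP rt _ pt].
case: j => [|j] /= b1 b2; last by apply: IH => //; rewrite sorted_pairwise.
by apply: rt; rewrite ?mem_nth //; apply: (@nth_mem_flatten _ 0); rewrite mem_nth.
Qed.

Lemma sorted_flatten_row t j : sorted lt (flatten t) -> sorted lt (nth [::] t j).
Proof.
elim: t j => [|r t IH] [|j] //=; rewrite (sorted_pairwise lt_trans) pairwise_cat;
  case/and3P => _ pr pt; first by rewrite sorted_pairwise.
by apply: IH; rewrite sorted_pairwise.
Qed.

Section Word.
Variables (t : seq (seq T)) (x0 : T).
Hypothesis ut : uniq (flatten t).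
Hypothesis dt : decr t.
Hypothesis col_lt : forall j b, b < size (nth [::] t j.+1) ->
  lt (nth x0 (nth [::] t j) b) (nth x0 (nth [::] t j.+1) b).
Let W := size (head [::] t).
Let cols := [seq colseq t b | b <- iota 0 W].
Let word := flatten [seq rev c | c <- cols].

Let nth_col b k : (k \in nth [::] [seq rev c | c <- cols] b)
  = [&& b < W, k \in flatten t & colt t k == b].
Proof.
have [lt_b|le_b] := ltnP b W; last first.
  by rewrite nth_default // !size_map size_iota.
rewrite (nth_map [::]) ?size_map ?size_iota // mem_rev (nth_map 0) ?size_iota //.
by rewrite nth_iota // add0n mem_colseq.
Qed.

Let colt_W k : k \in flatten t -> colt t k < W.
Proof.
move=> kt; apply: leq_trans (colt_lt kt) _; rewrite /W -nth0.
exact: decr_le.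
Qed.

Let index_word k : k \in flatten t -> index k word =
  sumn (take (colt t k) (shape [seq rev c | c <- cols]))
  + index k (rev (colseq t (colt t k))).
Proof.
move=> kt; rewrite /word (index_flatten (c := colt t k)).
- congr (_ + index k _); rewrite (nth_map [::]) ?size_map ?size_iota ?colt_W //.
  by rewrite (nth_map 0) ?size_iota ?colt_W // nth_iota ?colt_W.
- by rewrite nth_col colt_W // kt eqxx.
by move=> c' lt_c; rewrite nth_col (gtn_eqF lt_c) !andbF.
Qed.

Lemma index_word_col k l : k \in flatten t -> l \in flatten t ->
  colt t k < colt t l -> index k word < index l word.
Proof.
move=> kt lt_ kl; rewrite !index_word //; apply: leq_trans (leq_addr _ _).
apply: (@leq_trans (sumn (take (colt t k).+1 (shape [seq rev c | c <- cols])))).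
  rewrite (take_nth 0) ?size_map ?size_iota ?colt_W // sumn_rcons ltn_add2l.
  rewrite (nth_map [::]) ?size_map ?size_iota ?colt_W //.
  rewrite (nth_map [::]) ?size_map ?size_iota ?colt_W //.
  rewrite (nth_map 0) ?size_iota ?colt_W // nth_iota ?colt_W // add0n.
  by rewrite size_rev -size_rev index_mem mem_rev mem_colseq // kt eqxx.
rewrite -(subnKC kl) takeD sumn_cat leq_addr.
by [].
Qed.

(** Columns are read from bottom to top, so the larger entry comes first. Together with
    [index_word_col] this tells in [entry_index_canonical] on which side of a letter its successor
    lies. *)
Lemma index_word_row k l : k \in flatten t -> l \in flatten t ->
  colt t k = colt t l -> lt k l -> index l word < index k word.
Proof.
move=> kt lt_ kl lt_kl; rewrite !index_word // kl ltn_add2l.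
set s := colseq t (colt t l).
have sk : k \in rev s by rewrite mem_rev mem_colseq // kt kl eqxx.
have sl : l \in rev s by rewrite mem_rev mem_colseq // lt_ eqxx.
case: (ltngtP (index l (rev s)) (index k (rev s))) => // [lt_i|e].
  have gt_trans : transitive (fun y z => lt z y).
    by move=> a b c h1 h2; apply: lt_trans h2 h1.
  have ss : sorted (fun y z => lt z y) (rev s).
    by rewrite rev_sorted; apply: (sorted_colseq x0 (colt t l) dt).2 => j; apply: col_lt.
  have lt_lk := sorted_ltn_index gt_trans ss _ _ sk sl lt_i.
  by have := lt_trans lt_kl lt_lk; rewrite lt_irr.
have := congr1 (nth k (rev s)) e; rewrite !nth_index // => ekl.
by move: lt_kl; rewrite ekl lt_irr.
Qed.

End Word.

End Boxes.

Local Open Scope ring_scope.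

(** * Specht polynomials and the group algebra *)

Section FixGroup.
Variables (n : nat) (T : eqType).
Implicit Types (f : 'I_n -> T) (s : 'S_n).

(** The Young group (f the block of an entry) and the column stabilizers (f its column label) are
    both of this form. *)
Definition fixg f : {set 'S_n} := [set s : 'S_n | [forall k, f (s k) == f k]].

Lemma fixgP f s : reflect (forall k, f (s k) = f k) (s \in fixg f).
Proof. by rewrite inE; apply: (iffP forallP) => h k; apply/eqP. Qed.

Fact fixg_group_set f : group_set (fixg f).
Proof.
apply/group_setP; split=> [|s t /fixgP hs /fixgP ht]; apply/fixgP => k.
  by rewrite perm1.
by rewrite permM ht hs.
Qed.

Canonical fixg_group f := Group (fixg_group_set f).

Lemma fixg_tperm f k l : f k = f l -> tperm k l \in fixg f.
Proof. by move=> e; apply/fixgP => j; case: tpermP => // ->. Qed.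

End FixGroup.

Section GroupAlgebra.
Variables (C : numFieldType) (n : nat) (G : {group 'S_n}).
Local Notation OX := {mpoly C[n]}.
Implicit Types (a b : 'S_n -> C) (p q : OX).

Definition act a p : OX := \sum_(g in G) a g *: msym g p.

Fact act_is_linear a : linear (act a).
Proof.
move=> c p q; rewrite /act scaler_sumr -big_split; apply: eq_bigr => g _ /=.
by rewrite linearP scalerDr !scalerA mulrC.
Qed.
HB.instance Definition _ a :=
  GRing.isLinear.Build C OX OX _ (act a) (act_is_linear a).

(** Elements of C[G] are built as operators through the closure lemmas below, without formulas for
    their coefficients. *)
Definition in_algebra (A : OX -> OX) : Prop := exists a, A =1 act a.

Lemma in_algebra_act a : in_algebra (act a).
Proof. by exists a. Qed.

Lemma in_algebra_msym g : g \in G -> in_algebra (msym g).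
Proof.
move=> gG; exists (fun h => (h == g)%:R) => p; rewrite /act (bigD1 g) //=.
rewrite eqxx scale1r big1 ?addr0 // => h /andP[_ /negPf->].
by rewrite scale0r.
Qed.

Lemma in_algebra_add A B :
  in_algebra A -> in_algebra B -> in_algebra (fun p => A p + B p).
Proof.
move=> [a ha] [b hb]; exists (fun g => a g + b g) => p; rewrite ha hb.
by rewrite /act -big_split; apply: eq_bigr => g _; rewrite scalerDl.
Qed.

Lemma in_algebra_scale c A : in_algebra A -> in_algebra (fun p => c *: A p).
Proof.
move=> [a ha]; exists (fun g => c * a g) => p; rewrite ha /act scaler_sumr.
by apply: eq_bigr => g _; rewrite scalerA.
Qed.

Lemma in_algebra_sum (I : Type) (s : seq I) (P : pred I) (A : I -> OX -> OX) :
  (forall i, P i -> in_algebra (A i)) ->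
  in_algebra (fun p => \sum_(i <- s | P i) A i p).
Proof.
move=> h; elim: s => [|i s [a ih]].
  exists (fun=> 0) => p; rewrite big_nil /act big1 // => g _.
  by rewrite scale0r.
case Pi: (P i); last by exists a => p; rewrite big_cons Pi ih.
have [b hb] := in_algebra_add (h i Pi) (in_algebra_act a).
by exists b => p; rewrite big_cons Pi ih -hb.
Qed.

Lemma in_algebra_comp A B :
  in_algebra A -> in_algebra B -> in_algebra (fun p => A (B p)).
Proof.
move=> [a ha] [b hb].
have [c hc]: in_algebra
    (fun p => \sum_(g in G) a g *: \sum_(h in G) b h *: msym (h * g)%g p).
  apply: in_algebra_sum => g gG; apply/in_algebra_scale/in_algebra_sum => h hG.
  exact/in_algebra_scale/in_algebra_msym/groupM.
exists c => p; rewrite -hc ha hb; apply: eq_bigr => g _; congr (_ *: _).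
rewrite linear_sum; apply: eq_bigr => h _; by rewrite /= linearZ msymMm.
Qed.

Lemma msupp_act a p m : m \in msupp (act a p) ->
  exists2 g, g \in G & [multinom m (g k) | k < n] \in msupp p.
Proof.
rewrite mcoeff_msupp => nz; apply/exists_inP; apply: contraNT nz.
rewrite negb_exists_in => /forall_inP h; rewrite /act raddf_sum big1 //= => g gG.
by rewrite mcoeffZ mcoeff_sym memN_msupp_eq0 ?mulr0 ?h.
Qed.

Definition avg p : OX := \sum_(g in G) msym g p.

Fact avg_is_linear : linear avg.
Proof.
move=> c p q; rewrite /avg scaler_sumr -big_split; apply: eq_bigr => g _ /=.
by rewrite linearP.
Qed.
HB.instance Definition _ := GRing.isLinear.Build C OX OX _ avg avg_is_linear.

Lemma msym_avg s p : s \in G -> msym s (avg p) = avg p.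
Proof.
move=> sG; rewrite /avg linear_sum /= [RHS](reindex_inj (mulIg s)) /=.
apply: eq_big => [t|t _]; first by rewrite groupMr.
by rewrite msymMm.
Qed.

Lemma avg_id p : (forall g, g \in G -> msym g p = p) -> avg p = #|G|%:R *: p.
Proof.
by move=> h; rewrite /avg (eq_bigr _ h) sumr_const scaler_nat.
Qed.

Lemma avg_mulr p q : (forall g, g \in G -> msym g q = q) ->
  avg (p * q) = avg p * q.
Proof.
move=> h; rewrite /avg mulr_suml; apply: eq_bigr => g /h e.
by rewrite msymM e.
Qed.

Lemma msupp_avg p m : m \in msupp (avg p) ->
  exists2 g, g \in G & [multinom m (g k) | k < n] \in msupp p.
Proof.
rewrite mcoeff_msupp => nz; apply/exists_inP; apply: contraNT nz.
rewrite negb_exists_in => /forall_inP h; rewrite /avg raddf_sum big1 //= => g gG.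
by rewrite mcoeff_sym memN_msupp_eq0 ?h.
Qed.

End GroupAlgebra.

Section ColumnAntisymmetrizer.
Variables (C : numFieldType) (n : nat) (T : eqType) (col : 'I_n -> T).
Local Notation OX := {mpoly C[n]}.
Implicit Types (p q : OX).

Definition colsym p : OX := \sum_(s in fixg col) (-1) ^+ odd_perm s *: msym s p.

Lemma colsymE p : colsym p = act (fixg_group col) (fun s => (-1) ^+ odd_perm s) p.
Proof. by []. Qed.

Fact colsym_is_linear : linear colsym.
Proof. by move=> c p q; rewrite !colsymE linearP. Qed.
HB.instance Definition _ := GRing.isLinear.Build C OX OX _ colsym colsym_is_linear.

Lemma colsym_msym s p : s \in fixg col ->
  colsym (msym s p) = (-1) ^+ odd_perm s *: colsym p.
Proof.
move=> sG; rewrite /colsym scaler_sumr (reindex_inj (mulgI s^-1%g)) /=.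
apply: eq_big => [t|t tG]; first by rewrite groupMl ?groupV.
rewrite -msymMm mulKVg odd_permM odd_permV signr_addb scalerA.
by [].
Qed.

Lemma msym_colsym s p : s \in fixg col ->
  msym s (colsym p) = (-1) ^+ odd_perm s *: colsym p.
Proof.
move=> sG; rewrite /colsym scaler_sumr linear_sum.
rewrite [RHS](reindex_inj (mulIg s)) /=.
apply: eq_big => [t|t tG]; first by rewrite groupMr.
rewrite linearZ /= msymMm odd_permM signr_addb scalerA mulrCA -signr_addb.
by rewrite addbb mulr1.
Qed.

Lemma colsym_anti p :
  (forall s, s \in fixg col -> msym s p = (-1) ^+ odd_perm s *: p) ->
  colsym p = #|fixg col|%:R *: p.
Proof.
move=> h; rewrite /colsym (eq_bigr (fun=> p)) => [|s /h->].
  by rewrite sumr_const scaler_nat.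
by rewrite scalerA -signr_addb addbb scale1r.
Qed.

Lemma colsym_colsym p : colsym (colsym p) = #|fixg col|%:R *: colsym p.
Proof. by apply: colsym_anti => s; apply: msym_colsym. Qed.

(* The transpositions exchanging two entries of a column generate the column
   stabilizer: composing with one of them fixes one more point. *)
Lemma anti_tperm p :
  (forall k l, k != l -> col k = col l -> msym (tperm k l) p = - p) ->
  forall s, s \in fixg col -> msym s p = (-1) ^+ odd_perm s *: p.
Proof.
move=> h s; have [N] := ubnP #|[set k | s k != k]|.
elim: N s => // N IH s lt_N sG; have [/eqP|] := eqVneq s 1%g.
  by move=> /eqP->; rewrite msym1m odd_perm1 expr0 scale1r.
move=> s1; have [k sk] : exists k, s k != k.
  apply/existsP; apply: contraNT s1; rewrite negb_exists => /forallP hk.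
  by apply/eqP/permP => k; rewrite perm1; apply/eqP; rewrite -[_ == _]negbK.
have colk : col (s k) = col k by move/fixgP: sG => ->.
set t := tperm k (s k); have tG : t \in fixg col by apply: fixg_tperm.
have es : s = (s * t * t)%g by rewrite -mulgA tperm2 mulg1.
rewrite [in LHS]es msymMm IH ?groupM //; last first.
  rewrite -ltnS (leq_trans _ lt_N) // ltnS; apply: proper_card.
  apply/properP; split; last first.
    by exists k; rewrite !inE ?permM ?tpermR ?eqxx.
  apply/fintype.subsetP => l; rewrite !inE permM; apply: contraNneq => sl.
  rewrite sl /t tpermD //.
    by apply: contraNneq sk => ->; rewrite sl.
  by apply: contraNneq sk => e; apply/eqP; apply: (@perm_inj _ s); rewrite e sl.
rewrite linearZ /= h ?colk 1?eq_sym //.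
by rewrite odd_permM odd_tperm (eq_sym k) sk addbT signrN scaleNr scalerN opprK.
Qed.

(** The transposition of k and l fixes the monomial and reverses the sign of its
    antisymmetrization. *)
Lemma colsym_X_eq0 (m : 'X_{1..n}) k l :
  k != l -> col k = col l -> m k = m l -> colsym 'X_[m] = 0.
Proof.
move=> kl ckl mkl; have tG : tperm k l \in fixg col by apply: fixg_tperm.
have /eqP := colsym_msym 'X_[m] tG; rewrite msymX tpermV odd_tperm kl scaleN1r.
have -> : [multinom m (tperm k l i) | i < n] = m.
  by apply/mnmP => i; rewrite mnmE; case: tpermP => // ->.
rewrite -addr_eq0 -mulr2n -scaler_nat scaler_eq0 pnatr_eq0 /=.
by move/eqP.
Qed.

End ColumnAntisymmetrizer.

(* A tableau filled with 'I_n is given by the row and the column in which each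
   entry lies; columns of different components carry different numbers. *)
Record is_tab n (T : eqType) (G : {group 'S_n}) (row : 'I_n -> nat)
    (col : 'I_n -> T) : Prop := IsTab {
  tab_inj : forall k l, row k = row l -> col k = col l -> k = l;
  tab_down : forall k, (0 < row k)%N ->
    exists2 l, col l = col k & (row l).+1 = row k;
  tab_sub : fixg col \subset G }.

Definition row_mnm n (row : 'I_n -> nat) : 'X_{1..n} := [multinom row k | k < n].

Definition specht (C : numFieldType) n (T : eqType) (row : 'I_n -> nat)
    (col : 'I_n -> T) : {mpoly C[n]} :=
  colsym col 'X_[row_mnm row].

Section Tableau.
Variables (n : nat) (T : eqType) (G : {group 'S_n}).
Variables (row : 'I_n -> nat) (col : 'I_n -> T).
Hypothesis tab : is_tab G row col.

Lemma tab_down_le k j : (j <= row k)%N ->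
  exists2 l, col l = col k & row l = j.
Proof.
move e: (row k) => i; elim: i k e => [|i IH] k e.
  by rewrite leqn0 => /eqP->; exists k.
rewrite leq_eqVlt => /predU1P[->|]; first by exists k.
rewrite ltnS => le_ji; have [|l cl rl] := tab_down tab (k := k); first by rewrite e.
have [|l' cl' rl'] := IH l _ le_ji; first by apply: succn_inj; rewrite rl.
by exists l' => //; rewrite cl'.
Qed.

Lemma tab_surj k j : (j < #|[set l | col l == col k]|)%N ->
  exists2 l, col l = col k & row l = j.
Proof.
move=> lt_j; case: (pickP (fun l => (col l == col k) && (j <= row l)%N)).
  by move=> l /andP[/eqP<- /tab_down_le].
move=> h; move: lt_j; rewrite ltnNge cardE -(size_map row); case/negP.
rewrite -[leqRHS](size_iota 0 j); apply: uniq_leq_size.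
  rewrite map_inj_in_uniq ?enum_uniq // => l l'.
  by rewrite !mem_enum !inE => /eqP cl /eqP cl' /(tab_inj tab)->; rewrite ?cl.
move=> _ /mapP[l + ->]; rewrite mem_enum inE mem_iota /= => cl.
by have := h l; rewrite cl /= leqNgt => /negbFE.
Qed.

(* Distinct exponents in each column dominate the row numbers after sorting,
   so a monomial of minimal degree is a column permutation of [row_mnm row]. *)
Lemma column_distinct (m : 'I_n -> nat) :
  (forall k l, col k = col l -> m k = m l -> k = l) ->
  (\sum_k m k <= \sum_k row k)%N ->
  (\sum_k m k)%N = (\sum_k row k)%N /\
  exists2 s, s \in fixg col & forall k, m k = row (s k).
Proof.
move=> m_inj le_m.
(* #|A k| is the rank of m k among the exponents of its column. Distinct exponents are at least
   their ranks, and the ranks rearrange the row numbers, by f below; equality of the sums then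
   forces each m k to be its rank. *)
pose A k := [set l | (col l == col k) && (m l < m k)%N].
have leA k : (#|A k| <= m k)%N.
  rewrite cardE -(size_map m) -[leqRHS](size_iota 0 (m k)); apply: uniq_leq_size.
    rewrite map_inj_in_uniq ?enum_uniq // => l l'.
    rewrite !mem_enum !inE => /andP[/eqP cl _] /andP[/eqP cl' _].
    by apply: m_inj; rewrite cl cl'.
  by move=> _ /mapP[l + ->]; rewrite mem_enum inE mem_iota => /andP[].
have /fin_all_exists[f fP] k : exists l, col l = col k /\ row l = #|A k|.
  case: (@tab_surj k #|A k|); last by move=> l; exists l.
  apply/proper_card/properP; split.
    by apply/fintype.subsetP => l; rewrite !inE => /andP[].
  by exists k; rewrite !inE ?eqxx // ltnn andbF.
have A_lt k l : col k = col l -> (m k < m l)%N -> (#|A k| < #|A l|)%N.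
  move=> ckl lt_m; apply/proper_card/properP; split.
    apply/fintype.subsetP => j; rewrite !inE => /andP[/eqP-> lt_j].
    by rewrite ckl eqxx (ltn_trans lt_j).
  by exists k; rewrite !inE ckl ?eqxx // ltnn andbF.
have f_inj : injective f.
  move=> k l e; have [ck rk] := fP k; have [cl rl] := fP l.
  have ckl : col k = col l by rewrite -ck -cl e.
  have eA : #|A k| = #|A l| by rewrite -rk -rl e.
  apply: m_inj => //; case: (ltngtP (m k) (m l)) => // /A_lt; rewrite eA ltnn.
    by move/(_ ckl).
  by move/(_ (esym ckl)).
have sum_f : (\sum_k row k = \sum_k #|A k|)%N.
  rewrite (reindex_inj f_inj); apply: eq_bigr => k _.
  by case: (fP k).
have le_sum : (\sum_k #|A k| <= \sum_k m k)%N by apply: leq_sum.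
have eq_sum : (\sum_k #|A k| == \sum_k m k)%N.
  by rewrite eqn_leq le_sum -sum_f.
split; first by rewrite sum_f; apply/esym/eqP.
exists (perm f_inj).
  by apply/fixgP => k; rewrite permE; case: (fP k).
move=> k; rewrite permE (fP k).2.
have [_] := leqif_sum (fun i (_ : xpredT i) => leqif_eq (leA i)).
by rewrite eq_sum => /esym/forallP/(_ k)/eqP.
Qed.

Variable C : numFieldType.
Local Notation OX := {mpoly C[n]}.
Local Notation sp := (specht C row col).
Local Notation d := (\sum_k row k)%N.

Lemma colsym_X m : (mdeg m <= d)%N -> exists c : C,
  colsym col 'X_[m] = c *: sp /\ ((mdeg m < d)%N -> c = 0).
Proof.
rewrite mdegE => le_m.
have [/existsP[k /existsP[l /and3P[kl /eqP ckl /eqP mkl]]]|] :=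
  boolP [exists k, exists l, [&& k != l, col k == col l & m k == m l]].
  by exists 0; rewrite scale0r (colsym_X_eq0 _ kl).
rewrite negb_exists => /forallP h.
have [|e [s sG ms]] := @column_distinct m _ le_m.
  move=> k l ckl mkl; move: (h k); rewrite negb_exists => /forallP/(_ l).
  by rewrite ckl mkl !eqxx !andbT negbK => /eqP.
exists ((-1) ^+ odd_perm s); rewrite e ltnn; split=> //.
have -> : 'X_[m] = msym (s^-1)%g 'X_[row_mnm row] :> OX.
  rewrite msymX invgK; congr 'X_[_]; apply/mnmP => k.
  by rewrite !mnmE ms.
by rewrite colsym_msym ?groupV // odd_permV.
Qed.

Lemma colsym_deg (p : OX) : (forall m, m \in msupp p -> (mdeg m <= d)%N) ->
  exists c, colsym col p = c *: sp.
Proof.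
move=> h; rewrite (mpolyE p) linear_sum /= big_seq.
elim/big_rec: _ => [|m q /h/colsym_X[c [e _]] [c' ->]].
  by exists 0; rewrite scale0r.
by rewrite linearZ /= e; exists (p@_m * c + c'); rewrite scalerDl scalerA.
Qed.

Lemma colsym_deg_lt (p : OX) :
  (forall m, m \in msupp p -> (mdeg m < d)%N) -> colsym col p = 0.
Proof.
move=> h; rewrite (mpolyE p) linear_sum /= big_seq big1 // => m /h lt_m.
have [c [e /(_ lt_m) c0]] := colsym_X (ltnW lt_m).
by rewrite linearZ /= e c0 scale0r scaler0.
Qed.

Lemma msupp_specht m : m \in msupp sp ->
  exists2 s, s \in fixg col & forall k, m k = row (s k).
Proof.
rewrite /specht colsymE => /msupp_act[s sG]; rewrite msuppX inE => /eqP/mnmP h.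
exists (s^-1)%g => [|k]; first by rewrite groupV.
by have := h (s^-1 k)%g; rewrite !mnmE permKV.
Qed.

(** A column permutation that preserves all row numbers is the identity, so only one term
    contributes. *)
Lemma mcoeff_specht : sp@_(row_mnm row) = 1.
Proof.
rewrite /specht /colsym raddf_sum (bigD1 1%g) ?group1 //= big1 ?addr0.
  by rewrite odd_perm1 expr0 scale1r msym1m mcoeffX eqxx.
move=> s /andP[/fixgP sG s1]; rewrite mcoeffZ mcoeff_sym mcoeffX.
case: eqP => [/mnmP e|_]; last by rewrite mulr0.
case/negP: s1; apply/eqP/permP => k; rewrite perm1.
by apply: (tab_inj tab) => //; have := e k; rewrite !mnmE.
Qed.

Lemma specht_neq0 : sp != 0.
Proof.
apply/eqP => sp0; have /eqP := mcoeff_specht.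
by rewrite sp0 mcoeff0 eq_sym oner_eq0.
Qed.

Lemma colsym_specht : colsym col sp = #|fixg col|%:R *: sp.
Proof. exact: colsym_colsym. Qed.

Lemma card_fixg_neq0 : #|fixg col|%:R != 0 :> C.
Proof. by rewrite pnatr_eq0 -lt0n cardG_gt0. Qed.

Lemma msupp_act_specht a m : m \in msupp (act G a sp) ->
  exists2 g, g \in G & forall k, m k = row (g k).
Proof.
case/msupp_act => g gG /msupp_specht[s sG h]; exists (g^-1 * s)%g.
  by rewrite groupM ?groupV // (fintype.subsetP (tab_sub tab)).
by move=> k; have := h (g^-1 k)%g; rewrite mnmE permKV permM.
Qed.

Lemma mdeg_act_specht a m : m \in msupp (act G a sp) -> mdeg m = d.
Proof.
case/msupp_act_specht => g gG h; rewrite mdegE [RHS](reindex_inj (@perm_inj _ g)).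
by apply: eq_bigr => k _; rewrite h.
Qed.

Lemma in_algebra_colsym : in_algebra G (colsym (C := C) col).
Proof.
apply: in_algebra_sum => s sG; apply/in_algebra_scale/in_algebra_msym.
exact: fintype.subsetP (tab_sub tab) _ sG.
Qed.

End Tableau.

(** * Simplicity of Specht modules through an invariant Hermitian form *)

Section HermitianForm.
Variables (C : numClosedFieldType) (n : nat).
Local Notation OX := {mpoly C[n]}.
Implicit Types p q : OX.

(** The form for which the monomials are orthonormal: permutations are isometries, so column
    antisymmetrizers are self-adjoint ([ip_colsym]). *)
Definition ip p q : C := \sum_(m <- msupp p) p@_m * (q@_m)^*.

Lemma ip_supp (s : seq 'X_{1..n}) p q :
  uniq s -> {subset msupp p <= s} -> ip p q = \sum_(m <- s) p@_m * (q@_m)^*.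
Proof.
move=> us sub; rewrite /ip [RHS](bigID (mem (msupp p))) /=.
rewrite [X in _ + X]big1 ?addr0; last first.
  by move=> m /memN_msupp_eq0->; rewrite mul0r.
rewrite -[RHS]big_filter; apply: perm_big.
apply: uniq_perm; rewrite ?filter_uniq ?msupp_uniq // => m.
by rewrite mem_filter; case: (boolP (m \in _)) => //= /sub->.
Qed.

Lemma ip_suml (I : Type) (r : seq I) P (F : I -> OX) q :
  ip (\sum_(i <- r | P i) F i) q = \sum_(i <- r | P i) ip (F i) q.
Proof.
have additive_ip p p' : ip (p + p') q = ip p q + ip p' q.
  pose s := undup (msupp p ++ msupp p').
  have us : uniq s by apply: undup_uniq.
  rewrite !(@ip_supp s) // => [|m|m|m]; last 1 first.
  - by rewrite mem_undup; apply: msuppD_le.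
  - rewrite -big_split; apply: eq_bigr => m _.
    by rewrite mcoeffD mulrDl.
  - by rewrite mem_undup mem_cat => ->; rewrite orbT.
  - by rewrite mem_undup mem_cat => ->.
by apply: (big_morph (fun p => ip p q)) => //; rewrite /ip msupp0 big_nil.
Qed.

Lemma ip_conj p q : (ip p q)^* = ip q p.
Proof.
pose s := undup (msupp p ++ msupp q).
rewrite !(@ip_supp s) ?undup_uniq // => [|m|m]; last first.
- by rewrite mem_undup mem_cat => ->.
- by rewrite mem_undup mem_cat => ->; rewrite orbT.
by rewrite rmorph_sum; apply: eq_bigr => m _; rewrite rmorphM /= conjCK mulrC.
Qed.

Lemma ipZl c p q : ip (c *: p) q = c * ip p q.
Proof.
rewrite (@ip_supp (msupp p)) ?msupp_uniq //; last exact: msuppZ_le.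
by rewrite mulr_sumr; apply: eq_bigr => m _; rewrite mcoeffZ mulrA.
Qed.

Lemma ip_msym s p q : ip (msym s p) q = ip p (msym s^-1%g q).
Proof.
pose f (m : 'X_{1..n}) := [multinom m ((s^-1)%g k) | k < n].
rewrite (@ip_supp (map f (msupp p))).
- rewrite big_map; apply: eq_bigr => m _; rewrite !mcoeff_sym.
  by congr (p@_ _ * _); apply/mnmP => k; rewrite !mnmE permK.
- rewrite map_inj_uniq ?msupp_uniq // => m m' /mnmP e; apply/mnmP => k.
  by have := e (s k); rewrite !mnmE permK.
move=> m; rewrite mcoeff_msupp mcoeff_sym -mcoeff_msupp => h.
by apply/mapP; exists [multinom m (s k) | k < n] => //; apply/mnmP => k;
   rewrite !mnmE permKV.
Qed.

Lemma ip_eq0 p : ip p p = 0 -> p = 0.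
Proof.
move=> h; apply/mpolyP => m; rewrite mcoeff0; apply/eqP.
have [pm|/memN_msupp_eq0->//] := boolP (m \in msupp p).
move/eqP: h; rewrite /ip psumr_eq0 => [|i _]; last exact: mul_conjC_ge0.
by move=> /allP/(_ _ pm); rewrite mul_conjC_eq0.
Qed.

Lemma ip_colsym (T : eqType) (col : 'I_n -> T) p q :
  ip (colsym col p) q = ip p (colsym col q).
Proof.
rewrite {1}/colsym ip_suml -[RHS]ip_conj /colsym ip_suml rmorph_sum.
rewrite (reindex_inj invg_inj) /=; apply: eq_big => s; first by rewrite groupV.
move=> _; rewrite !ipZl odd_permV rmorphM /= ip_conj ip_msym invgK.
by rewrite rmorph_sign.
Qed.

End HermitianForm.

(** James's submodule argument. If some translate of u has a nonzero column antisymmetrization, this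
    is a multiple of the Specht polynomial by minimality of degree. Otherwise u is orthogonal to all
    translates of the Specht polynomial, hence to itself. *)
Lemma specht_simple (C : numClosedFieldType) n (T : eqType) (G : {group 'S_n})
    row (col : 'I_n -> T) a :
  is_tab G row col -> act G a (specht C row col) != 0 ->
  exists b, act G b (act G a (specht C row col)) = specht C row col.
Proof.
move=> tab; set u := act G a _ => u0.
have [g /andP[gG kg]|kill] :=
  pickP (fun g => (g \in G) && (colsym col (msym g u) != 0)).
  have [c hc] := in_algebra_comp (in_algebra_msym C gG) (in_algebra_act G a).
  have [|e ke] := colsym_deg tab (p := msym g u).
    by move=> m; rewrite hc => /(mdeg_act_specht tab)->.
  have e0 : e != 0 by apply: contraNneq kg => e0; rewrite ke e0 scale0r.
  have [b hb] := in_algebra_scale e^-1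
    (in_algebra_comp (in_algebra_colsym tab C) (in_algebra_msym C gG)).
  by exists b; rewrite -hb ke scalerA mulVf ?scale1r.
case/negP: u0; apply/eqP/ip_eq0; rewrite {1}/u /act ip_suml.
apply: big1 => g gG; rewrite ipZl ip_msym.
have /eqP kg0 : colsym col (msym g^-1%g u) == 0.
  by have := kill g^-1%g; rewrite groupV gG /= => /negbFE.
have ip0 : ip (specht C row col) 0 = 0.
  by rewrite -ip_conj /ip msupp0 big_nil conjC0.
have /eqP := ip_colsym col (specht C row col) (msym g^-1%g u).
rewrite kg0 ip0 colsym_specht ipZl mulf_eq0 (negPf (card_fixg_neq0 _ _)) /=.
by move=> /eqP->; rewrite mulr0.
Qed.

(** Suppose m is smaller, and let i be the first variable where it differs. There s moves i up its
    column, hence to a smaller entry by standardness; but on smaller entries s is the identity,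
    which contradicts injectivity. *)
Lemma specht_low (C : numFieldType) n (T : eqType) (G : {group 'S_n})
    row (col : 'I_n -> T) m :
  is_tab G row col ->
  (forall k l : 'I_n, col k = col l -> (row k < row l)%N -> (k < l)%N) ->
  m \in msupp (specht C row col) -> (row_mnm row <= m)%O.
Proof.
move=> tab std /msupp_specht[s /fixgP sG ms]; rewrite leNgt; apply/negP.
have e : mdeg m = mdeg (row_mnm row).
  rewrite !mdegE [RHS](reindex_inj (@perm_inj _ s)).
  by apply: eq_bigr => k _; rewrite ms mnmE.
case/(ltmcP e) => i lo; rewrite ms mnmE => lt_i.
have lt_s : (s i < i)%N by apply: std.
have := lo _ lt_s; rewrite ms mnmE => /(tab_inj tab)/(_ (sG _))/perm_inj si.
by move: lt_s; rewrite si ltnn.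
Qed.

Lemma scale_cancel (F : fieldType) (V W : lmodType F) (L : {linear V -> W}) c x :
  c != 0 -> L x + (- c^-1) *: L (c *: x) = 0.
Proof.
by move=> c0; rewrite linearZ scalerA mulNr mulVf // scaleN1r subrr.
Qed.

(** * Independence, dual elements and faithfulness for families of Specht polynomials *)

Section Family.
Variables (C : numFieldType) (n : nat) (G : {group 'S_n}) (I T : eqType).
Variables (row : I -> 'I_n -> nat) (col : I -> 'I_n -> T).
Hypothesis tabs : forall i, is_tab G (row i) (col i).
Hypothesis std : forall i (k l : 'I_n),
  col i k = col i l -> (row i k < row i l)%N -> (k < l)%N.
Hypothesis row_inj : forall i j, row i =1 row j -> i = j.
Hypothesis same_shape : forall i j g, g \in G ->
  (forall k, row j (g k) = row i k) ->
  exists2 h, h \in G &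
    forall k, row j (h k) = row i k /\ col j (h k) = col i k.

Local Notation OX := {mpoly C[n]}.
Hypothesis specht_simple : forall i a,
  act G a (specht C (row i) (col i)) != 0 ->
  exists b, act G b (act G a (specht C (row i) (col i))) = specht C (row i) (col i).
Let S i : OX := specht C (row i) (col i).
Let d i := (\sum_k row i k)%N.

(** For the Young group this is equality of shapes, block by block: g matches the rows of the two
    tableaux without regard to columns. *)
Definition similar i j : bool :=
  [exists g in G, [forall k, row j (g k) == row i k]].

Lemma similarP i j :
  reflect (exists2 g, g \in G & forall k, row j (g k) = row i k) (similar i j).
Proof.
apply: (iffP exists_inP) => -[g gG h]; exists g => //.
  by move=> k; apply/eqP; move/forallP: h.
by apply/forallP => k; rewrite h.
Qed.

Lemma similar_sym i j : similar i j -> similar j i.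
Proof.
case/similarP=> g gG h; apply/similarP; exists g^-1%g; rewrite ?groupV // => k.
by rewrite -h permKV.
Qed.

Lemma similar_deg i j : similar i j -> d i = d j.
Proof.
case/similarP=> g gG h; rewrite /d [RHS](reindex_inj (@perm_inj _ g)).
by apply: eq_bigr.
Qed.

Lemma similar_msym i j : similar i j -> exists2 h, h \in G & msym h (S i) = S j.
Proof.
case/similarP=> g gG /(same_shape gG)[h hG hP]; exists h => //.
have -> : S j = colsym (col j) (msym h 'X_[row_mnm (row i)]).
  rewrite msymX; congr (colsym _ 'X_[_]); apply/mnmP => k; rewrite !mnmE.
  by rewrite -(hP _).1 permKV.
rewrite /S /specht /colsym linear_sum (reindex_inj (@conjg_inj _ h^-1%g)) /=.
apply: eq_big => [s|s _].
  apply/fixgP/fixgP => hs k.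
    have := hs (h^-1 k)%g.
    by rewrite conjgE invgK !permM permKV -!(hP _).2 !permKV.
  by rewrite -!(hP _).2 conjgE invgK !permM permKV hs.
rewrite linearZ /= -!msymMm conjgE invgK; congr (_ *: msym _ _).
  by rewrite !odd_permM odd_permV addbC -addbA addbb addbF.
by rewrite -!mulgA mulVg mulg1.
Qed.

(** By minimality of degree the result is a multiple of S i. A nonzero multiple contains the row
    monomial of i, whereas the monomials in the C[G]-module of S j are translates of the row
    monomial of j; so i and j would be similar. *)
Lemma colsym_other i j a : ~~ similar i j -> (d j <= d i)%N ->
  colsym (col i) (act G a (S j)) = 0.
Proof.
move=> nsim le_d; have [|c hc] := colsym_deg (tabs i) (p := act G a (S j)).
  by move=> m /(mdeg_act_specht (tabs j))->.
have [b hb] := in_algebra_comp (in_algebra_colsym (tabs i) C) (in_algebra_act G a).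
suff c0 : c = 0 by rewrite hc c0 scale0r.
apply: contraNeq nsim => c0.
have: row_mnm (row i) \in msupp (act G b (S j)).
  rewrite -hb hc mcoeff_msupp mcoeffZ (mcoeff_specht (tabs i) C) mulr1.
  exact: c0.
case/(msupp_act_specht (tabs j)) => g gG h.
by apply/similarP; exists g => // k; rewrite -h mnmE.
Qed.

(** Unitriangularity: the lowest monomial of S j is its row monomial, with coefficient 1, and
    [row_inj] makes these monomials distinct. *)
Lemma specht_free X (c : I -> C) : uniq X ->
  \sum_(j <- X) c j *: S j = 0 -> forall j, j \in X -> c j = 0.
Proof.
move=> uX sum0 j; move e: (row_mnm (row j)) => m.
elim/(@ltmwf n): m j e => m IH j e jX; rewrite -{m}e in IH.
have := congr1 (mcoeff (row_mnm (row j))) sum0.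
rewrite mcoeff0 (big_rem j jX) mcoeffD mcoeffZ (mcoeff_specht (tabs j) C).
rewrite mulr1 raddf_sum big_seq big1 ?addr0 // => i; rewrite mem_rem_uniq // inE.
case/andP => ij iX; rewrite [LHS]mcoeffZ.
case: (ltgtP (row_mnm (row i)) (row_mnm (row j))) => [lt_ij|lt_ji|/mnmP e].
- by rewrite (IH _ lt_ij i) ?mul0r.
- rewrite memN_msupp_eq0 ?mulr0 //; apply/negP => /(specht_low (tabs i)).
  by rewrite leNgt lt_ji => /(_ (@std i)).
case/eqP: ij; apply: row_inj => k.
by have := e k; rewrite !mnmE.
Qed.

Definition kills (X : seq I) b := forall j, j \in X -> act G b (S j) = 0.

(** Induction on X in the style of Jacobson's density theorem: a multiple of S i is subtracted from
    u so that the elements killing X kill what remains. The scalar is read off with the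
    antisymmetrizer of i, whose values in degrees up to d i are multiples of S i. *)
Lemma density X t a : uniq X ->
  (forall b, kills X b -> act G b (act G a (S t)) = 0) ->
  exists c, act G a (S t) = \sum_(j <- X) c j *: S j.
Proof.
elim: X a => [|i X IH] a.
  move=> _ h; exists (fun=> 0); rewrite big_nil.
  have [b hb] := in_algebra_msym C (group1 G).
  by rewrite -[LHS]msym1m hb h.
move=> /= /andP[iX uX] h; set u := act G a (S t) in h *.
suff [e [a' ea'] ue] : exists2 e, (exists a', u - e *: S i = act G a' (S t)) &
    forall b, kills X b -> act G b (u - e *: S i) = 0.
  have [|c hc] := IH a' uX; first by rewrite -ea'.
  exists (fun j => if j == i then e else c j); rewrite big_cons eqxx.
  rewrite -[LHS](subrK (e *: S i)) addrC ea' hc; congr (_ + _).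
  apply: eq_big_seq => j jX; case: eqP => // ji.
  by rewrite -ji jX in iX.
have [kill_i|nkill] :=
    pselect (forall b, kills X b -> act G b (S i) = 0).
  exists 0; first by exists a; rewrite scale0r subr0.
  move=> b kb; rewrite scale0r subr0; apply: h => j.
  by rewrite inE => /predU1P[->|]; [apply: kill_i|apply: kb].
have [a0 ka0 a0i] : exists2 a0, kills X a0 & act G a0 (S i) = S i.
  move/existsNP: nkill => [b0 /not_implyP[kb0 /eqP/specht_simple[b1 h1]]].
  have [a0 h0] := in_algebra_comp (in_algebra_act G b1) (in_algebra_act G b0).
  by exists a0 => [j /kb0 e|]; rewrite -h0 ?e ?linear0.
pose N : C := #|fixg (col i)|%:R.
have N0 : N != 0 := card_fixg_neq0 _ _.
have core e : colsym (col i) (act G a0 u) = e *: S i ->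
    forall b, kills X b -> act G b (u - (e / N) *: S i) = 0.
  move=> he b kb.
  (* b' = b - N^-1 b colsym_i a0. It kills X as b and a0 do, and it kills S i because a0 fixes S i
     and colsym multiplies it by N; hence it kills u. *)
  have [b' hb'] := in_algebra_add (in_algebra_act G b) (in_algebra_scale (- N^-1)
    (in_algebra_comp (in_algebra_act G b)
      (in_algebra_comp (in_algebra_colsym (tabs i) C) (in_algebra_act G a0)))).
  have /h : kills (i :: X) b'.
    move=> j; rewrite inE -hb' => /predU1P[->|jX]; last first.
      by rewrite (kb _ jX) (ka0 _ jX) !linear0 ?scaler0 addr0.
    by rewrite a0i (colsym_specht (row i) (col i) C); apply: scale_cancel.
  rewrite -hb' he => hu; rewrite -[RHS]hu.
  move: (S i) => x; rewrite linearB !linearZ /= scalerA.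
  by rewrite scalerN mulrN scaleNr.
have [sim|nsim] := boolP (similar t i).
  have [c hc] := in_algebra_comp (in_algebra_act G a0) (in_algebra_act G a).
  have [|e he] := colsym_deg (tabs i) (p := act G a0 u).
    move=> m; rewrite /u hc => /(mdeg_act_specht (tabs t))->.
    by rewrite [X in (X <= _)%N](similar_deg sim).
  exists (e / N); last exact: core.
  have [g gG hg] := similar_msym sim.
  have [a' ha'] := in_algebra_add (in_algebra_act G a)
    (in_algebra_scale (- (e / N)) (in_algebra_msym C gG)).
  by exists a'; rewrite -ha' hg scaleNr.
exists 0; first by exists a; rewrite scale0r subr0.
have [le_d|lt_d] := leqP (d t) (d i).
  have [c hc] := in_algebra_comp (in_algebra_act G a0) (in_algebra_act G a).
  have := core 0; rewrite mul0r; apply; rewrite scale0r /u hc.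
  by apply: colsym_other => //; apply: contra nsim => /similar_sym.
(* If b u were nonzero, simplicity would carry it back to S t. Antisymmetrizing over the columns of
   t then kills what comes from S i, whose degree is too small, but not S t. *)
move=> b kb; rewrite scale0r subr0; apply/eqP; apply: contraT => bu.
have [c hc] := in_algebra_comp (in_algebra_act G b) (in_algebra_act G a).
have [|b1 hb1] := @specht_simple t c; first by rewrite -hc.
have [b2 hb2] := in_algebra_comp (in_algebra_colsym (tabs t) C)
  (in_algebra_comp (in_algebra_act G b1) (in_algebra_act G b)).
have /h : kills (i :: X) b2.
  move=> j; rewrite inE -hb2 => /predU1P[->|/kb->]; last by rewrite !linear0.
  have [c' hc'] := in_algebra_comp (in_algebra_act G b1) (in_algebra_act G b).
  rewrite hc'; apply: (colsym_deg_lt (tabs t)) => m /(mdeg_act_specht (tabs i))->.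
  exact: lt_d.
rewrite -hb2 {1}/u hc hb1 colsym_specht => /eqP.
by rewrite scaler_eq0 (negPf (card_fixg_neq0 _ C)) (negPf (specht_neq0 (tabs t) C)).
Qed.

(** If every element that kills the other members killed S t as well, [density] would put S t in
    their span, against [specht_free]. Otherwise simplicity carries a nonzero value back to S t. *)
Lemma specht_dual X t : uniq X ->
  exists2 a, act G a (S t) = S t &
    forall j, j \in X -> j != t -> act G a (S j) = 0.
Proof.
move=> uX; pose X' := [seq j <- X | j != t].
have uX' : uniq X' by rewrite filter_uniq.
have [kill_t|nkill] := pselect (forall b, kills X' b -> act G b (S t) = 0).
  have [e he] := in_algebra_msym C (group1 G).
  have et : act G e (S t) = S t by rewrite -he msym1m.
  have [|c] := density (t := t) (a := e) uX'.
    by move=> b; rewrite et; apply: kill_t.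
  rewrite et => hc.
  have utX : uniq (t :: X') by rewrite /= uX' mem_filter eqxx.
  pose c' j := if j == t then -1 else c j.
  have sum0 : \sum_(j <- t :: X') c' j *: S j = 0.
    rewrite big_cons /c' eqxx scaleN1r [in X in - X]hc addrC; apply/eqP.
    rewrite subr_eq0; apply/eqP; apply: eq_big_seq => j.
    by rewrite mem_filter => /andP[/negPf->].
  have := specht_free utX sum0 (mem_head t X'); rewrite /c' eqxx => /eqP.
  by rewrite oppr_eq0 oner_eq0.
move/existsNP: nkill => [b0 /not_implyP[kb0 /eqP/specht_simple[b1 h1]]].
have [a ha] := in_algebra_comp (in_algebra_act G b1) (in_algebra_act G b0).
exists a; first by rewrite -ha.
by move=> j jX jt; rewrite -ha kb0 ?linear0 // mem_filter jt.
Qed.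

Lemma specht_faithful (X : seq I) (Q : seq (I * I)) : uniq X -> uniq Q ->
  (forall p, p \in Q -> [/\ p.1 \in X, p.2 \in X & similar p.1 p.2]) ->
  (#|G| <= size Q)%N ->
  forall a, (forall j, j \in X -> act G a (S j) = 0) ->
  forall g, g \in G -> a g = 0.
Proof.
move=> uX uQ hQ leG a ha.
pose q (p : 'I_(size Q)) := tnth (in_tuple Q) p.
have qQ p : q p \in Q by apply: mem_tnth.
have q_inj : injective q by apply/tuple_uniqP.
(* On the family, e p is the matrix unit of the pair q p. *)
have /fin_all_exists[e he] (p : 'I_(size Q)) : exists e : 'S_n -> C,
    forall t, t \in X -> act G e (S t) = (t == (q p).1)%:R *: S (q p).2.
  have [_ _ /similar_msym[h hG eh]] := hQ _ (qQ p).
  have [b bt bX] := specht_dual (q p).1 uX.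
  have [b' hb'] := in_algebra_comp (in_algebra_msym C hG) (in_algebra_act G b).
  exists b' => t tX; rewrite -hb'; case: eqP => [->|/eqP tq].
    by rewrite bt eh scale1r.
  by rewrite bX // linear0 scale0r.
have key (v : 'I_(size Q) -> C) :
    (forall t, t \in X -> \sum_p v p *: act G (e p) (S t) = 0) ->
    forall p, v p = 0.
  move=> hv p; have [p1X p2X _] := hQ _ (qQ p).
  pose c j := \sum_(p' | q p' == ((q p).1, j)) v p'.
  have c0 : \sum_(j <- X) c j *: S j = 0.
    rewrite -[RHS](hv _ p1X).
    under [RHS]eq_bigr => p' _ do rewrite he // scalerA.
    have cE j : c j *: S j = \sum_(p' | q p' == ((q p).1, j)) v p' *: S j.
      exact: scaler_suml.
    rewrite (eq_bigr _ (fun j _ => cE j)).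
    rewrite (exchange_big_dep xpredT) //=; apply: eq_bigr => p' _.
    have [_ p'X _] := hQ _ (qQ p').
    rewrite (eq_bigl (fun j => ((q p).1 == (q p').1) && (j == (q p').2)));
      last by move=> j; case: (q p') => a1 a2; rewrite xpair_eqE /=
                (eq_sym a1) (eq_sym a2).
    case: eqP => [_|_]; last by rewrite mulr0 scale0r big_pred0.
    by rewrite /= -big_filter filter_pred1_uniq // big_seq1 mulr1.
  have := specht_free uX c0 p2X; rewrite /c -surjective_pairing.
  by rewrite (big_pred1 p) // => p'; rewrite /= (inj_eq q_inj).
(* The rows of M are the coordinates of the e p in C[G]. They are independent and at least |G| in
   number, so [a] is a combination of them, and [key] applies to its coefficients. *)
pose M : 'M[C]_(size Q, #|G|) := \matrix_(p, g) e p (enum_val g).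
have act_row (v : 'rV_(size Q)) (b : 'S_n -> C) :
    (forall g : 'I_#|G|, b (enum_val g) = (v *m M) 0 g) ->
    forall t, act G b (S t) = \sum_p v 0 p *: act G (e p) (S t).
  move=> hb t; rewrite /act; under [RHS]eq_bigr => p _ do rewrite scaler_sumr.
  rewrite exchange_big /=; apply: eq_bigr => g gG.
  have -> : b g = \sum_p v 0 p * e p g.
    rewrite -(enum_rankK_in gG gG) hb mxE; apply: eq_bigr => p _.
    by rewrite mxE.
  transitivity (\sum_p (v 0 p * e p g) *: msym g (S t)); first exact: scaler_suml.
  by apply: eq_bigr => p _; rewrite scalerA.
have free_M : row_free M.
  apply: inj_row_free => v vM; apply/rowP => p; rewrite mxE.
  apply: (key (v 0) _ p) => t tX; rewrite -(act_row v (fun=> 0)).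
    by rewrite /act big1 // => g _; rewrite scale0r.
  by move=> g; rewrite vM mxE.
have full_M : row_full M.
  rewrite -col_leq_rank; apply: leq_trans leG _.
  by move: free_M; rewrite /row_free => /eqP->.
have /submxP[v hv] : (\row_g a (enum_val g) <= M)%MS by rewrite submx_full.
have v0 p : v 0 p = 0.
  apply: (key (v 0) _ p) => t tX; rewrite -(act_row v a); first exact: ha.
  by move=> g; rewrite -hv mxE.
move=> g gG; have /rowP/(_ (enum_rank_in gG g)) := hv.
rewrite !mxE enum_rankK_in // => ->; apply: big1 => p _.
by rewrite v0 mul0r.
Qed.

End Family.

(** * Descent along a finite group *)

Section Spanning.
Variables (F : fieldType) (N : nat) (S : 'rV[F]_N -> Prop).

(** S is an arbitrary set of rows. Independent rows are taken from S as long as one lies outside the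
    span of the previous ones; if this stops before N rows, a nonzero column of a cokernel matrix
    annihilates S. *)
Lemma span_or_annihilator :
  (exists2 c : 'cV[F]_N, c != 0 & forall s, S s -> s *m c = 0) \/
  (exists2 A : 'M[F]_N, (forall i, S (row i A)) & A \in unitmx).
Proof.
have [|noc] := pselect (exists2 c : 'cV[F]_N, c != 0 & forall s, S s -> s *m c = 0).
  by left.
right; suff h k : (k <= N)%N ->
    exists2 A : 'M[F]_(k, N), (forall i, S (row i A)) & row_free A.
  by have [A hA fA] := h N (leqnn N); exists A; rewrite -?row_free_unit.
elim: k => [_|k IH lt_k].
  exists 0; first by case.
  by rewrite -row_leq_rank.
have [A hA /eqP fA] := IH (ltnW lt_k).
have [s hs sA] : exists2 s, S s & ~~ (s <= A)%MS.
  have [//|h] := pselect (exists2 s, S s & ~~ (s <= A)%MS).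
  have sub s : S s -> (s <= A)%MS.
    by move=> hs; apply: contraT => sA; case: h; exists s.
  have : cokermx A != 0.
    by rewrite -mxrank_eq0 mxrank_coker fA -lt0n subn_gt0.
  case/matrix0Pn => i [j cij]; case: noc; exists (col j (cokermx A)).
    by apply/matrix0Pn; exists i, 0; rewrite mxE.
  by move=> s /sub; rewrite submxE colE mulmxA => /eqP->; rewrite mul0mx.
have rowB (i : 'I_(1 + k)) : S (row i (col_mx s A)).
  have [j ->|j ->] := split_ordP i; last by rewrite rowKd.
  by rewrite rowKu ord1 row_id.
exists (col_mx s A : 'M_(1 + k, N)); first exact: rowB.
have: (A < col_mx s A)%MS.
  by rewrite ltmxE -addsmxE addsmxSr /= col_mx_sub submx_refl andbT.
by move/rank_ltmx; rewrite fA -row_leq_rank.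
Qed.

End Spanning.

Section CommonDenominator.
Variables (R : idomainType).

Lemma frac_denom (x : {fraction R}) :
  exists a b, b != 0 /\ FracField.tofrac b * x = FracField.tofrac a.
Proof.
elim/quotW: x => x; exists (frac x).1, (frac x).2; split; first exact: denom_ratioP.
rewrite -[LHS]/(FracField.mul _ _) !piE; apply/eqmodP.
rewrite /= FracField.equivfE /FracField.mulf.
by rewrite !numden_Ratio ?(oner_eq0, mulf_neq0, mul1r, mulr1, denom_ratioP).
Qed.

Lemma common_denom (I : finType) (x : I -> {fraction R}) :
  exists2 b, b != 0 &
    exists a, forall i, FracField.tofrac b * x i = FracField.tofrac (a i).
Proof.
have /fin_all_exists[a] i := frac_denom (x i).
case/fin_all_exists => b hb; exists (\prod_i b i).
  by apply/prodf_neq0 => i _; case: (hb i).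
exists (fun i => (\prod_(j | j != i) b j) * a i) => i.
rewrite [RHS]tofracM -(hb i).2 mulrA -tofracM.
by rewrite (bigD1 i) //= [b i * _]mulrC.
Qed.

End CommonDenominator.

(** * Wronskian criterion for proportional polynomials *)

Section Wronskian.
Variables (C : numFieldType) (n : nat).
Local Notation OX := {mpoly C[n]}.
Implicit Types p q : OX.

Lemma mcoeff_euler i p m : ('X_i * p^`M(i))@_m = p@_m *+ m i.
Proof.
have [m0|m_gt0] := posnP (m i).
  rewrite m0 mulr0n; apply: memN_msupp_eq0; rewrite mulrC (perm_mem (msuppMX _ _)).
  apply/mapP => -[m' _ e]; move: m0; rewrite e mnmDE mnm1E eqxx.
  by [].
have le_m : (U_(i) <= m)%MM by rewrite lep1mP -lt0n.
rewrite -{1}(submK le_m) mulrC addmC mcoeffMX mcoeff_deriv submK //.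
by rewrite mnmBE mnm1E eqxx subn1 prednK.
Qed.

(** Multiplied by the variables, partial derivatives become Euler operators, which multiply each
    coefficient by an exponent. Let p' be p minus the multiple of q that cancels the coefficient at
    the leading monomial m of q. Comparing leading terms in the relations, a nonzero p' would have
    leading monomial m too, where its coefficient vanishes. *)
Lemma wronskian_eq p q : q != 0 ->
  (forall i, q * p^`M(i) = p * q^`M(i)) -> exists a, p = a *: q.
Proof.
move=> q0 W; pose m := mlead q; pose a := p@_m / q@_m.
have qm : q@_m != 0 by rewrite mleadc_eq0.
exists a; apply/eqP; rewrite -subr_eq0; set p' := p - a *: q.
have W' i : q * ('X_i * p'^`M(i)) = p' * ('X_i * q^`M(i)).
  rewrite mulrCA [RHS]mulrCA; congr (_ * _).
  rewrite mderivB mderivZ mulrBr W mulrBl; congr (_ - _).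
  by rewrite -scalerAr scalerAl.
have p'm : p'@_m = 0 by rewrite mcoeffB mcoeffZ divfK ?subrr.
apply: contraT => p'0; pose m' := mlead p'.
have le_euler i (f : OX) : (mlead ('X_i * f^`M(i)) <= mlead f)%O.
  have [->|e0] := eqVneq ('X_i * f^`M(i)) 0; first by rewrite mlead0 le0m.
  apply: msupp_le_mlead; rewrite mcoeff_msupp.
  move: (mlead_supp e0); rewrite mcoeff_msupp mcoeff_euler.
  by apply: contraNneq => ->; rewrite mul0rn.
suff e : m' = m by move: p'0; rewrite -mleadc_eq0 -/m' e p'm eqxx.
have p'm' : p'@_m' != 0 by rewrite mleadc_eq0.
apply/mnmP => i; have eL := mleadcMW (lexx m) (le_euler i p').
have := mleadcMW (lexx m') (le_euler i q).
rewrite -W' addmC eL !mcoeff_euler -mulr_natr -[q@_m *+ _]mulr_natr !mulrA.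
rewrite [p'@_m' * _]mulrC => /(mulfI (mulf_neq0 qm p'm'))/eqP.
by rewrite eqr_nat => /eqP.
Qed.

Lemma msize_mderiv i p : p^`M(i) != 0 -> (msize p^`M(i) < msize p)%N.
Proof.
move=> /[dup] h0 /mlead_supp h; rewrite -(mlead_deg h0).
have : (mlead p^`M(i) + U_(i))%MM \in msupp p.
  rewrite mcoeff_msupp; move: h; rewrite mcoeff_msupp mcoeff_deriv.
  by apply: contraNneq => ->; rewrite mul0rn.
by move/msize_mdeg_lt; rewrite mdegD mdeg1 addn1.
Qed.

Lemma mderiv_eq0 p : (forall i, p^`M(i) = 0) -> exists a, p = a%:MP.
Proof.
move=> h; have [|i|a ->] := @wronskian_eq p 1; first exact: oner_neq0.
  by rewrite h -mpolyC1 mderivC !mulr0.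
by exists a; rewrite -mul_mpolyC mulr1.
Qed.

End Wronskian.

Section GroupNorm.
Variables (C : idomainType) (n : nat) (G : {group 'S_n}).
Local Notation OX := {mpoly C[n]}.
Implicit Types p : OX.

Definition gnorm p : OX := \prod_(g in G) msym g p.

Lemma msym_gnorm g p : g \in G -> msym g (gnorm p) = gnorm p.
Proof.
move=> gG; rewrite /gnorm rmorph_prod [RHS](reindex_inj (mulIg g)) /=.
by apply: eq_big => [h|h _]; rewrite ?groupMr // msymMm.
Qed.

Lemma gnorm_neq0 p : p != 0 -> gnorm p != 0.
Proof.
move=> p0; apply/prodf_neq0 => g _; apply: contraNneq p0 => h.
by apply/eqP/(@inj_msym _ _ g); rewrite h raddf0.
Qed.

Lemma gnorm_dvd p : exists q, gnorm p = q * p.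
Proof.
exists (\prod_(g in G | g != 1%g) msym g p).
by rewrite /gnorm (bigD1 1%g) //= msym1m mulrC.
Qed.

End GroupNorm.

Section Derivation.
Variables (C : comNzRingType) (n : nat) (U : comNzRingType).
Local Notation OX := {mpoly C[n]}.
Variable io : {rmorphism OX -> U}.
Variable E : OX -> U.
Hypothesis EA : forall p q, E (p + q) = E p + E q.
Hypothesis EM : forall p q, E (p * q) = E p * io q + io p * E q.
Hypothesis EC : forall c, E c%:MP = 0.

(** The difference of the two sides is a derivation that vanishes on constants and variables. *)
Lemma derivation_mderiv f : E f = \sum_l io f^`M(l) * E 'X_l.
Proof.
pose Z f := E f - \sum_l io f^`M(l) * E 'X_l.
have ZA p q : Z (p + q) = Z p + Z q.
  rewrite /Z EA (eq_bigr (fun l => io p^`M(l) * E 'X_l + io q^`M(l) * E 'X_l)).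
    by rewrite big_split /= opprD addrACA.
  by move=> l _; rewrite mderivD rmorphD mulrDl.
have ZM p q : Z (p * q) = Z p * io q + io p * Z q.
  rewrite /Z EM (eq_bigr (fun l => io p^`M(l) * E 'X_l * io q
                    + io p * (io q^`M(l) * E 'X_l))).
    rewrite big_split /= -mulr_suml -mulr_sumr mulrBl mulrBr.
    by rewrite opprD addrACA.
  move=> l _; rewrite mderivM rmorphD !rmorphM mulrDl; congr (_ + _).
    by rewrite mulrAC.
  by rewrite mulrA.
have ZC c : Z c%:MP = 0.
  by rewrite /Z EC big1 ?subr0 // => l _; rewrite mderivC rmorph0 mul0r.
have ZX k : Z 'X_k = 0.
  rewrite /Z (bigD1 k) //= big1 => [|l lk].
    rewrite mderivX mnm1E eqxx scale1r -[X in (X - _)%MM]add0m addmK mpolyX0.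
    by rewrite rmorph1 mul1r addr0 subrr.
  by rewrite mderivX mnm1E eq_sym (negPf lk) scale0r rmorph0 mul0r.
have Z0 : Z f = 0.
  elim/mpolyind: f => [|c m p _ _ IH].
    by have := ZC 0; rewrite mpolyC0.
  rewrite ZA {}IH addr0 -mul_mpolyC ZM ZC mul0r add0r.
  suff -> : Z 'X_[m] = 0 by rewrite mulr0.
  rewrite mpolyXE_id; elim: (index_enum _) => [|k s IHs].
    by rewrite big_nil -mpolyC1 ZC.
  rewrite big_cons ZM IHs mulr0 addr0.
  suff -> : Z ('X_k ^+ m k) = 0 by rewrite mul0r.
  elim: (m k) => [|e IHe]; first by rewrite expr0 -mpolyC1 ZC.
  by rewrite exprS ZM IHe ZX mulr0 mul0r addr0.
by apply/eqP; rewrite -subr_eq0; apply/eqP/Z0.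
Qed.

End Derivation.

Section Descent.
Variables (C : numFieldType) (n : nat) (G : {group 'S_n}).
Local Notation OX := {mpoly C[n]}.
Variables (W : OX -> Prop) (e : OX) (jac : 'I_n -> 'I_n -> OX).
Variable delta : 'I_n -> OX -> OX.
Hypothesis e_neq0 : e != 0.
Hypothesis mderivE : forall i p, e * p^`M(i) = \sum_j jac i j * delta j p.
Hypothesis delta_msym : forall g j p, g \in G ->
  msym g (delta j p) = delta j (msym g p).
Hypothesis W0 : W 0.
Hypothesis WD : forall p q, W p -> W q -> W (p + q).
Hypothesis WM : forall q p, (forall g, g \in G -> msym g q = q) -> W p -> W (q * p).
Hypothesis W_delta : forall j p, W p -> W (delta j p).
Hypothesis W_full : forall a : 'S_n -> C, (forall w, W w -> act G a w = 0) ->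
  forall g, g \in G -> a g = 0.

Lemma W_sum (I : Type) (s : seq I) (F : I -> OX) :
  (forall i, W (F i)) -> W (\sum_(i <- s) F i).
Proof.
by move=> h; elim: s => [|i s IH]; rewrite (big_nil, big_cons) //; apply: WD.
Qed.

Definition annihilates (c : 'S_n -> OX) :=
  forall w, W w -> \sum_(g in G) c g * msym g w = 0.

(** Differentiating the relation at w gives the relation with differentiated coefficients, plus
    terms in the derivatives of the translates of w. Multiplied by e, these terms combine the
    relations at the delta_j w, because the delta_j commute with G. *)
Lemma annihilates_mderiv c i : annihilates c ->
  annihilates (fun g => (c g)^`M(i)).
Proof.
move=> hc w Ww; have := congr1 (mderiv i) (hc w Ww).
rewrite raddf0 raddf_sum /= (eq_bigr _ (fun g _ => mderivM i _ _)) big_split /=.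
rewrite [X in _ + X](_ : _ = 0) ?addr0 //; apply: (mulfI e_neq0).
rewrite mulr0 mulr_sumr.
transitivity (\sum_j jac i j * \sum_(g in G) c g * msym g (delta j w)).
  under [RHS]eq_bigr => j _ do rewrite mulr_sumr.
  rewrite exchange_big /=; apply: eq_bigr => g gG.
  rewrite mulrCA mderivE mulr_sumr; apply: eq_bigr => j _.
  by rewrite -delta_msym // mulrCA.
by apply: big1 => j _; rewrite hc ?mulr0 //; apply: W_delta.
Qed.

(* The Wronskians of an annihilating vector of minimal support vanish, so it
   is proportional to a constant vector, as in Artin's lemma. *)
Lemma annihilates_eq0 c : annihilates c -> forall g, g \in G -> c g = 0.
Proof.
have [N] := ubnP #|[set g in G | c g != 0]|.
elim: N c => // N IH c lt_N hc g0 g0G; apply/eqP; apply: contraT => cg0.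
pose c' i g := c g0 * (c g)^`M(i) - c g * (c g0)^`M(i).
have ann_c' i : annihilates (c' i).
  move=> w Ww; rewrite /c'.
  rewrite (eq_bigr (fun g => c g0 * ((c g)^`M(i) * msym g w)
     - (c g0)^`M(i) * (c g * msym g w))); last first.
    by move=> g _; rewrite mulrBl mulrA [c g * _]mulrC mulrA.
  rewrite sumrB -!mulr_sumr hc // (annihilates_mderiv i hc) //.
  by rewrite !mulr0 subrr.
have c'0 i g : g \in G -> c' i g = 0.
  move: g; apply: IH; last exact: ann_c'.
  rewrite -ltnS (leq_trans _ lt_N) // ltnS; apply: proper_card.
  apply/properP; split.
    apply/fintype.subsetP => g; rewrite !inE => /andP[-> /=]; apply: contraNneq => cg.
    by rewrite /c' cg mderiv0 mulr0 mul0r subrr.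
  by exists g0; rewrite !inE g0G //= /c' subrr eqxx.
have /choice[a ha] g : exists a, g \in G -> c g = a *: c g0.
  have [gG|_] := boolP (g \in G); last by exists 0.
  have [i|a ha] := wronskian_eq cg0 (p := c g); last by exists a.
  by apply/eqP; rewrite -subr_eq0; apply/eqP/c'0.
have a0 := W_full (a := a) _ g0G.
have : a g0 = 0.
  apply: a0 => w Ww; apply: (mulfI cg0); rewrite mulr0 -(hc w Ww) mulr_sumr.
  by apply: eq_bigr => g gG; rewrite (ha g gG) -scalerAr -scalerAl.
by move=> ag0; rewrite (ha _ g0G) ag0 scale0r eqxx in cg0.
Qed.

(** A nonzero vector over the fraction field orthogonal to all rows of translates of elements of W
    would contradict [annihilates_eq0]. So some w_1, ..., w_|G| in W have a nonsingular matrix of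
    translates, and Cramer's rule expresses multiples of f through them; q is the norm of the
    determinant. *)
Lemma full_ideal : exists2 q, q != 0 & forall f, W (q * f).
Proof.
pose F := {fraction OX}; pose N := #|G|.
pose vec (w : OX) : 'rV[OX]_N := \row_k msym (enum_val k) w.
pose S (s : 'rV[F]_N) := exists2 w, W w & s = map_mx (@FracField.tofrac OX) (vec w).
case: (span_or_annihilator S) => [[c /matrix0Pn[k0 [j0 ck0]] hc]|[A hA uA]].
  have [b b0 [a ha]] := common_denom (fun k => c k 0).
  pose c' g := a (enum_rank_in (group1 G) g).
  have ann : annihilates c'.
    move=> w Ww; have := hc _ (ex_intro2 _ _ w Ww erefl).
    move/matrixP/(_ 0 0)/(congr1 (fun x => FracField.tofrac b * x)).
    rewrite !mxE mulr0 mulr_sumr => h; rewrite big_enum_val.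
    apply/eqP; rewrite -tofrac_eq0 -h rmorph_sum; apply/eqP; apply: eq_bigr => k _.
    rewrite /c' enum_valK_in !mxE mulrCA ha -rmorphM mulrC.
    by [].
  case/negP: ck0; apply/eqP; apply: (mulfI (_ : FracField.tofrac b != 0)).
    by rewrite tofrac_eq0.
  have := annihilates_eq0 ann (enum_valP k0); rewrite /c' enum_valK_in.
  by rewrite (ord1 j0) ha mulr0 => ->; rewrite tofrac0.
have /fin_all_exists2[w Ww Aw] i :
    exists2 w, W w & row i A = map_mx (@FracField.tofrac OX) (vec w).
  exact: hA.
pose M : 'M[OX]_N := \matrix_(i, k) msym (enum_val k) (w i).
have AM : A = map_mx (@FracField.tofrac OX) M.
  by apply/matrixP => i k; have /rowP/(_ k) := Aw i; rewrite !mxE.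
have q0 : \det M != 0.
  by move: uA; rewrite unitmxE unitfE AM det_map_mx tofrac_eq0.
pose q := \prod_(g in G) msym g (\det M).
pose q1 := \prod_(g in G | g != 1%g) msym g (\det M).
have qE : q = \det M * q1 by rewrite /q (bigD1 1%g) //= msym1m.
have q_inv g : g \in G -> msym g q = q.
  move=> gG; rewrite /q rmorph_prod [RHS](reindex_inj (mulIg g)) /=.
  by apply: eq_big => [h|h _]; rewrite ?groupMr // msymMm.
exists q.
  apply/prodf_neq0 => g _; apply: contraNneq q0 => h.
  by apply/eqP/(@inj_msym _ _ g); rewrite h raddf0.
move=> f; pose v i := (vec f *m \adj M) 0 i.
have cramer g : g \in G -> \det M * msym g f = \sum_i v i * msym g (w i).
  move=> gG; have : vec f *m \adj M *m M = \det M *: vec f.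
    by rewrite -mulmxA mul_adj_mx mul_mx_scalar.
  move/rowP/(_ (enum_rank_in gG g)); rewrite !mxE enum_rankK_in // => <-.
  by apply: eq_bigr => i _; rewrite [M _ _]mxE enum_rankK_in.
(* Cramer's rule at g^-1, followed by the action of g, leaves the w_i in place; summing over g
   averages the coefficients, which become invariant. *)
have key : #|G|%:R *: (q * f) = \sum_i avg G (q1 * v i) * w i.
  transitivity (\sum_(g in G) msym g (q * msym g^-1%g f)).
    rewrite (eq_bigr (fun=> q * f)) => [|g gG]; first by rewrite sumr_const scaler_nat.
    by rewrite msymM q_inv // -msymMm mulVg msym1m.
  under [RHS]eq_bigr => i _ do rewrite /avg mulr_suml.
  rewrite exchange_big /=; apply: eq_bigr => g gG.
  rewrite qE [_ * q1]mulrC -mulrA cramer ?groupV // mulr_sumr rmorph_sum /=.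
  by apply: eq_bigr => i _; rewrite mulrA msymM -msymMm mulVg msym1m.
have -> : q * f = (#|G|%:R^-1)%:MP * (#|G|%:R *: (q * f)).
  rewrite mul_mpolyC scalerA mulVf ?scale1r // pnatr_eq0 -lt0n.
  exact: cardG_gt0.
apply: WM => [g _|]; first by rewrite -alg_mpolyC linearZ /= msym1.
rewrite key; apply: W_sum => i; apply: WM => // g gG.
exact: msym_avg.
Qed.

End Descent.

(** * Equivariant differential operators *)

Section Operators.
Variables (C : numFieldType) (n : nat) (G : {group 'S_n}).
Local Notation OX := {mpoly C[n]}.
Variables (U : comNzRingType) (io : {rmorphism OX -> U}).
Hypothesis io_reg : forall p u, p != 0 -> io p * u = 0 -> u = 0.
Variables (y : n.-tuple OX) (d : 'I_n -> U -> U) (D : OX).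
Hypothesis y_inv : forall j g, g \in G -> msym g (tnth y j) = tnth y j.
Hypothesis dA : forall j u v, d j (u + v) = d j u + d j v.
Hypothesis dM : forall j u v, d j (u * v) = d j u * v + u * d j v.
Hypothesis dC : forall j c, d j (io c%:MP) = 0.
Hypothesis dy : forall j k, d j (io (tnth y k)) = if j == k then 1 else 0.
Hypothesis chain : forall i f,
  io f^`M(i) = \sum_(j < n) io (tnth y j)^`M(i) * d j (io f).
Hypothesis D_neq0 : D != 0.
Hypothesis D_inv : forall g, g \in G -> msym g D = D.
Hypothesis D_denom : forall u, exists p k, io (D ^+ k) * u = io p.
Implicit Types (p q f : OX) (u v : U).

Lemma io_inj : injective io.
Proof.
move=> p q e; apply/eqP; rewrite -subr_eq0; apply: contraT => pq.
have := @io_reg _ 1 pq; rewrite mulr1 rmorphB /= e subrr => /(_ erefl)/eqP.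
by rewrite oner_eq0.
Qed.

Lemma D_denom_fin (I : finType) (u : I -> U) :
  exists k (p : I -> OX), forall i, io (D ^+ k) * u i = io (p i).
Proof.
have /fin_all_exists[p] i := D_denom (u i).
case/fin_all_exists => k hk; exists (\sum_i k i)%N.
exists (fun i => D ^+ (\sum_(j | j != i) k j) * p i) => i.
by rewrite (bigD1 i) //= addnC exprD !rmorphM -mulrA hk.
Qed.

(** Conjugation by g changes delta_j by a derivation E that vanishes on the y_k, since the y_k and D
    are invariant. By the chain rule the Jacobian matrix H has the inverse Q, so E vanishes on the
    x_l, hence everywhere. *)
Lemma d_msym (e : nat) (delta : 'I_n -> OX -> OX) :
  (forall j f, io (D ^+ e) * d j (io f) = io (delta j f)) ->
  forall j g f, g \in G -> msym g (delta j f) = delta j (msym g f).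
Proof.
move=> hd j g f gG.
have deltaA p q : delta j (p + q) = delta j p + delta j q.
  by apply: io_inj; rewrite [RHS]rmorphD -!hd rmorphD dA mulrDr.
have deltaM p q : delta j (p * q) = delta j p * q + p * delta j q.
  apply: io_inj; rewrite [RHS]rmorphD [in RHS]rmorphM [X in _ + X]rmorphM -!hd.
  by rewrite rmorphM dM mulrDr mulrA mulrCA.
have deltaC c : delta j c%:MP = 0.
  by apply: io_inj; rewrite -hd dC mulr0 rmorph0.
have deltay k : delta j (tnth y k) = if j == k then D ^+ e else 0.
  by apply: io_inj; rewrite -hd dy; case: eqP; rewrite ?mulr1 ?mulr0 ?rmorph0.
pose E f := io (msym g (delta j (msym g^-1%g f)) - delta j f).
have gK p : msym g (msym g^-1%g p) = p by rewrite -msymMm mulVg msym1m.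
have E_sum f' : E f' = \sum_l io f'^`M(l) * E 'X_l.
  apply: derivation_mderiv => [p q|p q|c]; rewrite /E.
  - by rewrite !(msymD, deltaA) -(rmorphD io) opprD addrACA.
  - rewrite !(msymM, deltaM, msymD) !gK -!(rmorphM io) -(rmorphD io); congr (io _).
    by ring.
  - have -> h : msym h c%:MP = c%:MP by rewrite -alg_mpolyC linearZ /= msym1.
    by rewrite deltaC msym0 subrr rmorph0.
pose H : 'M[U]_n := \matrix_(i, k) io (tnth y k)^`M(i).
pose Q : 'M[U]_n := \matrix_(k, l) d k (io 'X_l).
have HQ : H *m Q = 1%:M.
  apply/matrixP => i l; rewrite !mxE; have := chain i 'X_l.
  rewrite mderivX mnm1E => e0.
  transitivity (io ((l == i)%:R *: 'X_[U_(l) - U_(i)])).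
    by rewrite e0; apply: eq_bigr => k _; rewrite !mxE.
  case: eqP => [->|li]; last by rewrite scale0r rmorph0 (introF eqP (nesym li)).
  rewrite scale1r -[X in (X - _)%MM]add0m addmK mpolyX0 rmorph1.
  by rewrite eqxx.
have EH : (\row_l E 'X_l) *m H = 0.
  apply/rowP => k; rewrite !mxE; transitivity (E (tnth y k)).
    by rewrite E_sum; apply: eq_bigr => l _; rewrite !mxE mulrC.
  rewrite /E y_inv ?groupV // deltay; case: eqP => _.
    by rewrite rmorphXn /= D_inv // subrr rmorph0.
  by rewrite msym0 subrr rmorph0.
have E0 l : E 'X_l = 0.
  have := congr1 (fun M => (M *m Q) 0 l) EH.
  by rewrite -mulmxA HQ mulmx1 mul0mx !mxE.
have := E_sum (msym g f); rewrite big1 => [|l _]; last by rewrite E0 mulr0.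
rewrite /E -msymMm mulgV msym1m -[RHS](rmorph0 io) => /io_inj/eqP.
by rewrite subr_eq0 => /eqP.
Qed.

(** One power of D clears the denominators of all d_j x_l, hence those of d_j on O_X. *)
Lemma poly_derivations : exists (e : nat) (delta : 'I_n -> OX -> OX),
  [/\ forall j f, io (D ^+ e) * d j (io f) = io (delta j f),
      forall j g f, g \in G -> msym g (delta j f) = delta j (msym g f)
    & forall i f, D ^+ e * f^`M(i) = \sum_j (tnth y j)^`M(i) * delta j f].
Proof.
have [e [q hq]] := D_denom_fin (fun jl => d jl.1 (io 'X_jl.2)).
pose delta j f := \sum_l f^`M(l) * q (j, l).
have hd j f : io (D ^+ e) * d j (io f) = io (delta j f).
  rewrite (@derivation_mderiv _ _ _ io (fun f => d j (io f))).
  - rewrite mulr_sumr rmorph_sum; apply: eq_bigr => l _.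
    by rewrite /= rmorphM -hq mulrCA.
  - by move=> p q'; rewrite rmorphD dA.
  - by move=> p q'; rewrite rmorphM dM.
  - by move=> c; rewrite dC.
exists e, delta; split => //; first exact: d_msym.
move=> i f; apply: io_inj; rewrite rmorphM /= chain mulr_sumr rmorph_sum.
by apply: eq_bigr => j _; rewrite [RHS]rmorphM -hd mulrCA.
Qed.

(** The operators of [DY] over an abstract ring U; [diffop_DY] and [DY_diffop] identify the two when
    U is O_U. *)
Inductive diffop : (U -> U) -> Prop :=
| DiffScal c : diffop (fun u => io c%:MP * u)
| DiffPos j : diffop (fun u => io (tnth y j) * u)
| DiffDer j : diffop (d j)
| DiffAdd A B : diffop A -> diffop B -> diffop (fun u => A u + B u)
| DiffMul A B : diffop A -> diffop B -> diffop (fun u => A (B u)).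

(* An operator of D_Y is, up to denominators, an equivariant operator on O_X;
   this replaces an action of G on O_U. *)
Lemma diffop_poly A l : diffop A -> exists k (B : OX -> OX),
  [/\ forall c p q, B (c *: p + q) = c *: B p + B q,
      forall g p, g \in G -> msym g (B p) = B (msym g p)
    & forall u p, io (D ^+ l) * u = io p -> io (D ^+ k) * A u = io (B p)].
Proof.
have [e [delta [hd delta_msym _]]] := poly_derivations.
have deltaL j c p q : delta j (c *: p + q) = c *: delta j p + delta j q.
  apply: io_inj; rewrite -!mul_mpolyC [RHS]rmorphD [in RHS]rmorphM -!hd.
  by rewrite rmorphD rmorphM dA dM dC mul0r add0r mulrDr mulrCA.
have DX_inv g k : g \in G -> msym g (D ^+ k) = D ^+ k.
  by move=> gG; rewrite rmorphXn /= D_inv.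
move=> hA; elim: hA l => [c|j|j|A1 A2 _ IH1 _ IH2|A1 A2 _ IH1 _ IH2] l.
- exists l, (fun p => c *: p); split=> [a p q|g p _|u p e1].
  + by rewrite scalerDr !scalerA mulrC.
  + by rewrite msymZ.
  + by rewrite mulrCA e1 -rmorphM mul_mpolyC.
- exists l, (fun p => tnth y j * p); split=> [a p q|g p gG|u p e1].
  + by rewrite mulrDr -scalerAr.
  + by rewrite msymM y_inv.
  + by rewrite mulrCA e1 -rmorphM.
(* Quotient rule: D^l u = p gives D^(2l) d_j u = D^l d_j p - d_j (D^l) p, and D^e turns d_j into
   delta_j. *)
- exists (e + (l + l))%N, (fun p => D ^+ l * delta j p - delta j (D ^+ l) * p).
  split=> [a p q|g p gG|u p e1].
  + rewrite deltaL !mulrDr -!scalerAr scalerBr opprD addrACA.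
    by [].
  + by rewrite msymB !msymM !delta_msym // DX_inv.
  + have := congr1 (d j) e1; rewrite dM => e2.
    rewrite rmorphB !rmorphM -!hd -e2 -e1 mulrDr mulrDr exprD [D ^+ (l + l)]exprD.
    rewrite !rmorphM /=; move: (io (D ^+ e)) (io (D ^+ l)) (d j u) => x z w.
    by ring.
- have [k1 [B1 [L1 S1 h1]]] := IH1 l; have [k2 [B2 [L2 S2 h2]]] := IH2 l.
  exists (k1 + k2)%N, (fun p => D ^+ k2 * B1 p + D ^+ k1 * B2 p).
  split=> [a p q|g p gG|u p e1].
  + by rewrite L1 L2 !mulrDr -!scalerAr scalerDr addrACA.
  + by rewrite msymD !msymM S1 // S2 // !DX_inv.
  + rewrite rmorphD !rmorphM -(h1 _ _ e1) -(h2 _ _ e1) exprD rmorphM mulrDr /=.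
    by congr (_ + _); rewrite !mulrA // [io _ * io _]mulrC.
have [k2 [B2 [L2 S2 h2]]] := IH2 l; have [k1 [B1 [L1 S1 h1]]] := IH1 k2.
exists k1, (fun p => B1 (B2 p)); split=> [a p q|g p gG|u p e1].
- by rewrite L2 L1.
- by rewrite S1 // S2.
- exact/h1/h2.
Qed.

Lemma diffop_add A u v : diffop A -> A (u + v) = A u + A v.
Proof.
move=> hA; elim: hA u v => [c|j|j|A1 A2 _ IH1 _ IH2|A1 A2 _ IH1 _ IH2] u v.
- by rewrite mulrDr.
- by rewrite mulrDr.
- exact: dA.
- by rewrite IH1 IH2 addrACA.
- by rewrite IH2 IH1.
Qed.

Lemma diffop_0 A : diffop A -> A 0 = 0.
Proof. by move=> hA; apply: (@addrI _ (A 0)); rewrite -diffop_add // !addr0. Qed.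

Lemma diffop_id : diffop id.
Proof.
have := DiffScal 1; congr diffop; apply/funext => u /=.
by rewrite mpolyC1 rmorph1 mul1r.
Qed.

Lemma diffop_zero : diffop (fun=> 0).
Proof.
have := DiffScal 0; congr diffop; apply/funext => u /=.
by rewrite mpolyC0 rmorph0 mul0r.
Qed.

Lemma diffop_opp A : diffop A -> diffop (fun u => - A u).
Proof.
move=> hA; have := DiffMul (DiffScal (-1)) hA; congr diffop; apply/funext => u /=.
by rewrite mpolyCN mpolyC1 rmorphN rmorph1 mulN1r.
Qed.

Definition submod (N : U -> Prop) : Prop :=
  [/\ N 0, forall u v, N u -> N v -> N (u + v)
    & forall A u, diffop A -> N u -> N (A u)].

Hypothesis inv_comp : forall q, (forall g, g \in G -> msym g q = q) ->
  exists q', q = q' \mPo y.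

Lemma submod_inv N q u : submod N -> (forall g, g \in G -> msym g q = q) ->
  N u -> N (io q * u).
Proof.
move=> [N0 NA ND] /inv_comp[q' ->] Nu.
elim/mpolyind: q' => [|c m p _ _ IH]; first by rewrite comp_mpoly0 rmorph0 mul0r.
rewrite comp_mpolyD comp_mpolyZ comp_mpolyX rmorphD mulrDl; apply: (NA _ _) => {IH}//.
rewrite -mul_mpolyC rmorphM -mulrA; apply: (ND _ _ (DiffScal c)).
elim: (index_enum _) => [|j s IHs]; first by rewrite big_nil rmorph1 mul1r.
rewrite big_cons rmorphM -mulrA; move: (io _ * u) IHs => v Nv.
elim: (m j) => [|e IHe]; first by rewrite expr0 rmorph1 mul1r.
by rewrite exprS rmorphM -mulrA; apply: (ND _ _ (DiffPos j)).
Qed.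

Variables (tau : OX -> U) (Delta : OX).
Hypothesis tauD : forall f g, tau (f + g) = tau f + tau g.
Hypothesis tauM : forall p f, tau (p * f) = io p * tau f.
Hypothesis tau_Delta : forall f, io Delta * tau f = io f.
Hypothesis Delta_neq0 : Delta != 0.
Hypothesis tau_mderiv : forall i f,
  tau f^`M(i) = \sum_(j < n) d j (tau ((tnth y j)^`M(i) * f)).

(* The ideal of all p with p O_X Delta^-1 inside N is stable under partial
   derivatives, so it is everything as soon as it is nonzero. *)
Lemma submod_tau N q : submod N -> q != 0 -> (forall f, N (io (q * f))) ->
  forall f, N (tau f).
Proof.
move=> hN q0 hq; have [N0 NA ND] := hN.
have NN u : N u -> N (- u) by apply: (ND _ _ (diffop_opp diffop_id)).
pose J p := forall f, N (tau (p * f)).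
have J_mderiv p i : J p -> J p^`M(i).
  move=> Jp f; have -> : p^`M(i) * f = (p * f)^`M(i) + p * - f^`M(i).
    by rewrite mderivM mulrN addrK.
  rewrite tauD; apply: (NA _ _) => //; rewrite tau_mderiv.
  elim: (index_enum _) => [|j s IH]; first by rewrite big_nil.
  rewrite big_cons; apply: (NA _ _) => //; rewrite mulrCA.
  exact: (ND _ _ (DiffDer j)).
suff J1 p : p != 0 -> J p -> forall f, N (tau f).
  (* tau (q Delta f) = q f, so q Delta belongs to J. *)
  apply: (J1 (q * Delta)); first by rewrite mulf_neq0.
  by move=> f; rewrite mulrAC mulrC tauM tau_Delta.
have [k] := ubnP (msize p); elim: k p => // k IH p lt_k p0 Jp.
have [/existsP[i pi]|] := boolP [exists i, p^`M(i) != 0].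
  apply: (IH p^`M(i)) => //; last exact: J_mderiv.
  by rewrite -ltnS (leq_trans _ lt_k) // ltnS msize_mderiv.
rewrite negb_exists => /forallP h.
have [i|a pa f] := @mderiv_eq0 _ _ p; first by apply/eqP; rewrite -[_ == _]negbK.
have a0 : a != 0 by apply: contraNneq p0 => a0; rewrite pa a0 mpolyC0.
have := Jp (a^-1 *: f); rewrite pa mul_mpolyC scalerA divff ?scale1r //.
Qed.

Lemma submod_full N : submod N ->
  (forall a : 'S_n -> C, (forall w, N (io w) -> act G a w = 0) ->
    forall g, g \in G -> a g = 0) ->
  forall f, N (tau f).
Proof.
move=> hN full; have [N0 NA ND] := hN.
have [e [delta [hd delta_msym hj]]] := poly_derivations.
have [||||||||q q0 hq] := @full_ideal C n G (fun w => N (io w)) (D ^+ e)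
   (fun i j => (tnth y j)^`M(i)) delta; last exact: submod_tau hq.
- by rewrite expf_neq0.
- exact: hj.
- by move=> g j p; apply: delta_msym.
- by rewrite rmorph0.
- by move=> p q; rewrite rmorphD; apply: (NA _ _).
- by move=> q p; rewrite rmorphM; apply: submod_inv.
- move=> j p Np; rewrite -hd; apply: (submod_inv hN).
    by move=> g gG; rewrite rmorphXn /= D_inv.
  exact: (ND _ _ (DiffDer j)).
- exact: full.
Qed.

(** * Directness and irreducibility for cyclic submodules *)

Section Decomposition.
Variables (I : eqType) (F : I -> OX).
Hypothesis F_simple : forall t a, act G a (F t) != 0 ->
  exists b, act G b (act G a (F t)) = F t.
Hypothesis F_dual : forall (X : seq I) t, uniq X ->
  exists2 a, act G a (F t) = F t &
    forall j, j \in X -> j != t -> act G a (F j) = 0.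

Lemma act_equivariant (B : OX -> OX) a p :
  (forall c p q, B (c *: p + q) = c *: B p + B q) ->
  (forall g p, g \in G -> msym g (B p) = B (msym g p)) ->
  act G a (B p) = B (act G a p).
Proof.
move=> BL BS; have B0 : B 0 = 0.
  by have := BL (-1) 0 0; rewrite scaler0 addr0 scaleN1r addNr.
rewrite /act; elim/big_rec2: _ => [|g p1 p2 gG ->]; first by rewrite B0.
by rewrite BL BS.
Qed.

Lemma cyclic_direct (s : seq I) (A : I -> U -> U) : uniq s ->
  (forall a, a \in s -> diffop (A a)) ->
  \sum_(a <- s) A a (io (F a)) = 0 ->
  forall a, a \in s -> A a (io (F a)) = 0.
Proof.
move=> us hA sum0 t ts.
have /choice[kB hkB] a : exists kB : nat * (OX -> OX), a \in s ->
    [/\ forall c p q, kB.2 (c *: p + q) = c *: kB.2 p + kB.2 q,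
      forall g p, g \in G -> msym g (kB.2 p) = kB.2 (msym g p)
    & io (D ^+ kB.1) * A a (io (F a)) = io (kB.2 (F a))].
  have [/hA ha|_] := boolP (a \in s); last by exists (0%N, id).
  have [k [B [BL BS hB]]] := diffop_poly 0 ha; exists (k, B) => _.
  by split=> //; apply: hB; rewrite expr0 rmorph1 mul1r.
(* Multiplied by D^K, the relation becomes one between polynomials. *)
pose K := (\max_(a <- s) (kB a).1)%N.
have leK a : a \in s -> ((kB a).1 <= K)%N.
  by move=> sa; apply: (@leq_bigmax_seq _ s xpredT (fun a => (kB a).1)).
have sumB : \sum_(a <- s) D ^+ (K - (kB a).1) * (kB a).2 (F a) = 0.
  apply: io_inj; rewrite rmorph_sum rmorph0 -[RHS](mulr0 (io (D ^+ K))).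
  rewrite -[X in _ = _ * X]sum0.
  rewrite mulr_sumr; apply: eq_big_seq => a sa; have [_ _ e] := hkB a sa.
  by rewrite /= rmorphM -e mulrA -rmorphM -exprD subnK ?leK.
(* The polynomial operators commute with b, so b acts directly on the F a: the term of t is
   unchanged and the others vanish. *)
have [b bt b0] := F_dual t us.
have := congr1 (act G b) sumB; rewrite linear0 linear_sum /= (big_rem t ts) /=.
have actB a : a \in s -> act G b (D ^+ (K - (kB a).1) * (kB a).2 (F a))
    = D ^+ (K - (kB a).1) * (kB a).2 (act G b (F a)).
  move=> sa; have [BL BS _] := hkB a sa.
  apply: (act_equivariant (B := fun p => D ^+ _ * (kB a).2 p)) => [c p q|g p gG].
    by rewrite BL mulrDr -scalerAr.
  by rewrite msymM rmorphXn /= D_inv // BS.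
rewrite actB // bt big_seq big1 ?addr0 => [/eqP|a].
  rewrite mulf_eq0 expf_eq0 (negPf D_neq0) andbF /= => /eqP Bt0.
  have [_ _ e] := hkB t ts; apply: (@io_reg (D ^+ (kB t).1)).
    by rewrite expf_neq0.
  by rewrite e Bt0 rmorph0.
rewrite mem_rem_uniq // inE => /andP[at_ sa]; rewrite actB // b0 //.
have [BL _ _] := hkB a sa; have := BL (-1) 0 0.
by rewrite scaler0 addr0 scaleN1r addNr => ->; rewrite mulr0.
Qed.

Variable X : seq I.
Hypothesis X_uniq : uniq X.
Hypothesis X_faithful : forall a, (forall j, j \in X -> act G a (F j) = 0) ->
  forall g, g \in G -> a g = 0.

Definition cyclics (P : pred I) v : Prop := exists2 A : I -> U -> U,
  forall a, diffop (A a) & v = \sum_(a <- X | P a) A a (io (F a)).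

Lemma cyclics_submod P : submod (cyclics P).
Proof.
split.
- exists (fun _ _ => 0); first by move=> _; apply: diffop_zero.
  by rewrite big1.
- move=> _ _ [A hA ->] [B hB ->]; exists (fun a u => A a u + B a u).
    by move=> a; apply: DiffAdd.
  by rewrite big_split.
move=> B _ hB [A hA ->]; exists (fun a u => B (A a u)).
  by move=> a; apply: DiffMul.
by apply: (big_morph B) => [u v|]; [apply: diffop_add|apply: diffop_0].
Qed.

Lemma cyclics_mem (P : pred I) t : t \in X -> P t -> cyclics P (io (F t)).
Proof.
move=> tX Pt; exists (fun a => if a == t then id else fun=> 0).
  by move=> a; case: eqP => _; [apply: diffop_id|apply: diffop_zero].
rewrite big_mkcond (bigD1_seq t) //= Pt eqxx big1 ?addr0 // => a /negPf->.
by rewrite if_same.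
Qed.

Lemma cyclics_full f : cyclics xpredT (tau f).
Proof.
apply: submod_full f; first exact: cyclics_submod.
by move=> a ha; apply: X_faithful => j jX; apply/ha/cyclics_mem.
Qed.

Lemma cyclic_irreducible t (N : U -> Prop) : t \in X -> submod N ->
  (forall v, N v -> exists2 A, diffop A & v = A (io (F t))) ->
  (exists2 v, N v & v != 0) -> N (io (F t)).
Proof.
move=> tX hN Nt [v0 Nv0 v0_neq0]; have [N0 NA ND] := hN.
pose N' v := exists u w, [/\ N u, cyclics (predC1 t) w & v = u + w].
have [P0 PA PD] := cyclics_submod (predC1 t).
have hN' : submod N'.
  split; first by exists 0, 0; rewrite addr0.
    move=> _ _ [u1 [w1 [hu1 hw1 ->]]] [u2 [w2 [hu2 hw2 ->]]].
    exists (u1 + u2), (w1 + w2).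
    by split; [apply: (NA _ _)|apply: (PA _ _)|rewrite addrACA].
  move=> A _ hA [u [w [hu hw ->]]]; exists (A u), (A w).
  by split; [apply: (ND _ _)|apply: (PD _ _)|apply: diffop_add].
have full' : forall f, N' (tau f).
  apply: submod_full hN' _ => a ha; apply: X_faithful => j jX.
  have [->|jt] := eqVneq j t; last first.
    by apply: ha; exists 0, (io (F j)); split; rewrite ?add0r //; apply: cyclics_mem.
  (* Let B be the polynomial operator with D^k v0 = B (F t), an element of N. Since a kills it,
     equivariance gives B (F t) = B (b a F t) = b a B (F t) = 0, hence v0 = 0. *)
  apply/eqP; apply: contraT => /F_simple[b hb].
  have [A hA vA] := Nt _ Nv0; have [k [B [BL BS hB]]] := diffop_poly 0 hA.
  have e : io (D ^+ k) * v0 = io (B (F t)).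
    by rewrite vA; apply: hB; rewrite expr0 rmorph1 mul1r.
  have aB : act G a (B (F t)) = 0.
    apply: ha; exists (io (B (F t))), 0; split; rewrite ?addr0 //.
    rewrite -e; apply: (submod_inv hN) => // g gG.
    by rewrite rmorphXn /= D_inv.
  case/negP: v0_neq0; apply/eqP/(@io_reg (D ^+ k)); first by rewrite expf_neq0.
  rewrite e -hb -(act_equivariant _ _ BL BS) -(act_equivariant _ _ BL BS).
  by rewrite aB linear0 rmorph0.
have [u [w [Nu [B hB wB] e]]] : N' (io (F t)).
  by rewrite -tau_Delta -tauM; apply: full'.
have [A hA uA] := Nt _ Nu.
(* F t is A (F t) plus terms of the other members of X; directness leaves F t = A (F t), which lies
   in N. *)
pose A' a := if a == t then fun v => v + - A v else fun v => - B a v.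
have hA' a : diffop (A' a).
  rewrite /A'; case: eqP => _; last exact: diffop_opp.
  by apply: DiffAdd; [apply: diffop_id|apply: diffop_opp].
have sum0 : \sum_(a <- X) A' a (io (F a)) = 0.
  rewrite (bigD1_seq t) //= {1}/A' eqxx -uA.
  rewrite (eq_bigr (fun a => - B a (io (F a)))) => [|a /negPf at_]; last first.
    by rewrite /A' at_.
  by rewrite sumrN -wB -addrA -opprD -e subrr.
have := @cyclic_direct X A' X_uniq (fun a _ => hA' a) sum0 t tX.
rewrite /A' eqxx -uA => /eqP; rewrite subr_eq0 => /eqP->.
exact: Nu.
Qed.

End Decomposition.
End Operators.

(** * Factoring Specht polynomials over the blocks *)

Section BlockProduct.
Variables (C : numFieldType) (n r : nat) (blk : 'I_n -> 'I_r) (T : eqType).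
Variables (row : 'I_n -> nat) (col : 'I_n -> T).
Local Notation OX := {mpoly C[n]}.

Definition young_col k : 'I_r * T := (blk k, col k).
(** Entries outside block i get pairwise distinct labels, so that [fixg (block_col i)] moves entries
    of block i only. *)
Definition block_col i k : T + 'I_n := if blk k == i then inl (col k) else inr k.
Definition block_mnm i : 'X_{1..n} :=
  [multinom if blk k == i then row k else 0%N | k < n].
Definition block_specht i : OX := colsym (block_col i) 'X_[block_mnm i].

Hypothesis tab : is_tab (fixg_group blk) row young_col.

Lemma block_col_out i s k : s \in fixg (block_col i) -> blk k != i -> s k = k.
Proof.
move=> /fixgP/(_ k); rewrite /block_col => + /negPf ki; rewrite ki.
by case: ifP => // _ [].
Qed.

Lemma block_col_in i s k : s \in fixg (block_col i) -> blk k = i ->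
  blk (s k) = i /\ col (s k) = col k.
Proof.
move=> /fixgP/(_ k); rewrite /block_col => + /eqP ki; rewrite ki.
by case: ifP => // /eqP-> [].
Qed.

Lemma mcoeff_block_specht i : (block_specht i)@_(block_mnm i) = 1.
Proof.
rewrite /block_specht /colsym raddf_sum (bigD1 1%g) ?group1 //= big1 ?addr0.
  by rewrite odd_perm1 expr0 scale1r msym1m mcoeffX eqxx.
move=> s /andP[sG s1]; rewrite mcoeffZ mcoeff_sym mcoeffX.
case: eqP => [/mnmP e|_]; last by rewrite mulr0.
case/negP: s1; apply/eqP/permP => k; rewrite perm1.
have [ki|ki] := eqVneq (blk k) i; last exact: block_col_out sG ki.
have [bs cs] := block_col_in sG ki; apply: (tab_inj tab).
  by have := e k; rewrite !mnmE bs ki eqxx.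
by rewrite /young_col bs cs ki.
Qed.

Lemma block_specht_neq0 i : block_specht i != 0.
Proof.
apply/eqP => F0; have /eqP := mcoeff_block_specht i.
by rewrite F0 mcoeff0 eq_sym oner_eq0.
Qed.

Lemma mdeg_block_specht i m : m \in msupp (block_specht i) -> mdeg m = mdeg (block_mnm i).
Proof.
rewrite /block_specht colsymE => /msupp_act[s _]; rewrite msuppX inE => /eqP <-.
rewrite !mdegE (reindex_inj (@perm_inj _ s)).
by apply: eq_bigr => k _; rewrite mnmE.
Qed.

Lemma msym_block_specht i k l : k != l -> young_col k = young_col l ->
  msym (tperm k l) (block_specht i)
  = (if blk k == i then - block_specht i else block_specht i).
Proof.
move=> kl [bkl ckl]; case: ifP => [/eqP bki|bki].
  have tG : tperm k l \in fixg (block_col i).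
    by apply: fixg_tperm; rewrite /block_col -bkl bki eqxx ckl.
  by rewrite msym_colsym // odd_tperm kl scaleN1r.
rewrite /block_specht /colsym linear_sum; apply: eq_bigr => s sG /=.
rewrite linearZ /= -msymMm; congr (_ *: _).
have -> : (s * tperm k l = tperm k l * s)%g.
  rewrite -[RHS](mulKVg s) -[(s^-1 * _)%g]conjgE tpermJ.
  by rewrite !(block_col_out sG) // ?bki -?bkl ?bki.
rewrite msymMm msymX tpermV; congr (msym s 'X_[_]).
apply/mnmP => j; rewrite !mnmE; case: tpermP => [->|->|//].
  by rewrite -bkl bki.
by rewrite -bkl bki.
Qed.

(** The product is antisymmetric under all columns and its degree does not exceed the sum of the row
    numbers, so minimality of degree makes it a multiple of the Specht polynomial. *)
Lemma block_specht_prod : exists2 c, c != 0 &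
  \prod_i block_specht i = c *: specht C row young_col.
Proof.
pose P := \prod_i block_specht i.
have P0 : P != 0 by apply/prodf_neq0 => i _; apply: block_specht_neq0.
have antiP s : s \in fixg young_col -> msym s P = (-1) ^+ odd_perm s *: P.
  move: s; apply: anti_tperm => k l kl ckl; rewrite /P rmorph_prod /=.
  rewrite (bigD1 (blk k)) //= [in RHS](bigD1 (blk k)) //=.
  rewrite msym_block_specht // eqxx mulNr; congr (- (_ * _)).
  by apply: eq_bigr => i ik; rewrite msym_block_specht // eq_sym (negPf ik).
have degP m : m \in msupp P -> (mdeg m <= \sum_k row k)%N.
  move=> /msupp_le_mlead le_m.
  apply: leq_trans (lemc_mdeg (le_trans le_m (mlead_prod_le _ _ _))) _.
  rewrite mdeg_sum.
  rewrite (eq_bigr (fun i => \sum_(k | blk k == i) row k)%N) => [|i _].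
    by rewrite [leqRHS](partition_big blk xpredT).
  rewrite (mdeg_block_specht (mlead_supp (block_specht_neq0 i))) mdegE [RHS]big_mkcond.
  by apply: eq_bigr => k _; rewrite mnmE.
have [c hc] := colsym_deg tab degP.
have N0 := card_fixg_neq0 young_col C; set N := _%:R in N0.
have PE : P = (N^-1 * c) *: specht C row young_col.
  by rewrite -scalerA -hc (colsym_anti antiP) scalerA mulVf ?scale1r.
exists (N^-1 * c) => //; apply: contraNneq P0 => e.
by rewrite PE e scale0r.
Qed.

End BlockProduct.

(** * The direct image inside O_U *)

Section ToOU.
Variables (R : realType) (r : nat) (ns : 'I_r -> nat).
Local Notation C := R[i].
Local Notation n := (nvars ns).
Local Notation OX := {mpoly C[n]}.
Local Notation OU := (OU R ns).
Local Notation D0 := (Delta R ns).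

Fact toOU_is_zmod_morphism : zmod_morphism (@toOU R r ns).
Proof. by move=> p q; apply: val_inj; rewrite /= !rmorphB. Qed.
Fact toOU_is_monoid_morphism : monoid_morphism (@toOU R r ns).
Proof. by split=> [|p q]; apply: val_inj; rewrite /= (rmorph1, rmorphM). Qed.
HB.instance Definition _ :=
  GRing.isZmodMorphism.Build OX OU (@toOU R r ns) toOU_is_zmod_morphism.
HB.instance Definition _ :=
  GRing.isMonoidMorphism.Build OX OU (@toOU R r ns) toOU_is_monoid_morphism.

Lemma toOU_inj : injective (@toOU R r ns).
Proof.
move=> p q /(congr1 (@OU_val R r ns))/= /eqP.
by rewrite tofrac_eq => /eqP.
Qed.

Lemma toOU_eq0 p : (toOU (ns := ns) p == 0 :> OU) = (p == 0).
Proof. by rewrite -(inj_eq toOU_inj) rmorph0. Qed.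

Lemma OU_val_inj : injective (@OU_val R r ns).
Proof. exact: val_inj. Qed.

Lemma OU_valM (u v : OU) : OU_val (u * v) = OU_val u * OU_val v.
Proof. by []. Qed.

Lemma toOU_reg (p : OX) (u : OU) : p != 0 -> toOU p * u = 0 -> u = 0.
Proof.
move=> p0 /(congr1 (@OU_val R r ns)); rewrite OU_valM /= => /eqP.
rewrite mulf_eq0 tofrac_eq0 (negPf p0) /= => /eqP u0.
by apply: OU_val_inj; rewrite u0.
Qed.

Lemma OU_denom (u : OU) : exists p k, toOU (D0 ^+ k) * u = toOU p.
Proof.
case: u => u uU; case/asboolP: (uU) => p [k e]; exists p, k.
apply: OU_val_inj; rewrite OU_valM /= rmorphXn e mulrC divfK //.
by rewrite expf_neq0 // tofrac_eq0 Delta_neq0.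
Qed.

End ToOU.

Section DirectImage.
Local Open Scope quotient_scope.
Variables (R : realType) (r : nat) (ns : 'I_r -> nat).
Local Notation C := R[i].
Local Notation n := (nvars ns).
Local Notation OX := {mpoly C[n]}.
Local Notation OU := (OU R ns).
Local Notation D0 := (Delta R ns).
Variables (y : n.-tuple OX) (d : 'I_n -> OU -> OU).
Hypothesis d_ext : dy_extensions y d.
Variable T : {additive pi_plus y -> OU}.
Hypothesis T_emb : direct_image_embedding d T.
Implicit Types (P Q : {mpoly OX[n]}) (f g : OX).

Lemma tensor_eq (a b : {freeg ({mpoly OX[n]} * OX)%type}) :
  tensor_rel y (a - b) ->
  \pi_{ideal_quot tensor_null y} a = \pi_{ideal_quot tensor_null y} b.
Proof.
move=> h; apply/eqP; rewrite -Quotient.idealrBE.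
exact/asboolP.
Qed.

Lemma tensorDl P Q f : tensor y (P + Q) f = tensor y P f + tensor y Q f.
Proof.
rewrite /tensor -raddfD; apply: tensor_eq; rewrite opprD addrA.
exact: TensorDl.
Qed.

Lemma tensorDr P f g : tensor y P (f + g) = tensor y P f + tensor y P g.
Proof.
rewrite /tensor -raddfD; apply: tensor_eq; rewrite opprD addrA.
exact: TensorDr.
Qed.

Lemma tensorB h P f :
  tensor y (cotransfer_DX y h P) f = tensor y P (DX_on_OX h f).
Proof. by apply: tensor_eq; apply: TensorBal. Qed.

Lemma tensor0l f : tensor y 0 f = 0.
Proof. by apply: (@addrI _ (tensor y 0 f)); rewrite -tensorDl !addr0. Qed.

Lemma tensorNl P f : tensor y (- P) f = - tensor y P f.
Proof. by apply: (@addrI _ (tensor y P f)); rewrite -tensorDl !subrr tensor0l. Qed.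

Lemma tensor_suml (I : Type) (s : seq I) (F : I -> {mpoly OX[n]}) f :
  tensor y (\sum_(i <- s) F i) f = \sum_(i <- s) tensor y (F i) f.
Proof.
by apply: (big_morph (fun P => tensor y P f)) => [P Q|];
  rewrite ?tensorDl ?tensor0l.
Qed.

(** [TensorBal] moves constants and variables across the tensor sign; h is assembled from them
    monomial by monomial. *)
Lemma tensorZ h P f : tensor y (h *: P) f = tensor y P (h * f).
Proof.
elim/mpolyind: h P f => [|c m p _ _ IH] P f.
  rewrite scale0r mul0r tensor0l; apply: (@addrI _ (tensor y P 0)).
  by rewrite -tensorDr !addr0.
rewrite scalerDl mulrDl tensorDl tensorDr.
apply: (f_equal2 +%R _ (IH P f)) => {IH}.
have X k P' f' : tensor y (('X_k : OX) *: P') f' = tensor y P' ('X_k * f').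
  by rewrite -(tensorB (Pos R k)) /cotransfer_DX /= scale1r.
have -> : c *: 'X_[m] = c%:MP * 'X_[m] :> OX by rewrite mul_mpolyC.
rewrite -scalerA -mulrA.
have -> f' P' : tensor y (c%:MP *: P') f' = tensor y P' (c%:MP * f').
  by rewrite mul_mpolyC -(tensorB (Scal ns c)) /cotransfer_DX /= scale1r.
rewrite [in RHS]mulrCA.
rewrite mpolyXE_id; elim: (index_enum _) P (c%:MP * f) => [|k s IHs] P' f'.
  by rewrite !big_nil scale1r mul1r.
rewrite !big_cons -scalerA -mulrA [in RHS]mulrCA -IHs.
elim: (m k) (\prod_(_ <- _) _ *: P') f' => [|e IHe] Q f''.
  by rewrite expr0 scale1r mul1r.
by rewrite exprS -scalerA X IHe mulrA -exprSr exprS.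
Qed.

Definition tau f : OU := T (tensor y 1 f).

Lemma tauE f : tau f = toOU f * tau 1.
Proof.
have [_ _ h] := T_emb; apply: OU_val_inj; rewrite OU_valM /tau !h.
by rewrite rmorph1 mul1r.
Qed.

Lemma Delta_tau f : toOU D0 * tau f = toOU f.
Proof.
have [_ _ h] := T_emb; apply: OU_val_inj; rewrite OU_valM /tau !h.
by rewrite mulrC divfK // tofrac_eq0 Delta_neq0.
Qed.

(** Moved from f to the left factor 1, d/dx_i becomes minus the sum of the (dy_j/dx_i) (x) d/dy_j;
    this sign cancels the one in the left action of d/dy_j. *)
Lemma tau_der i f :
  tau (mderiv i f) = \sum_(j < n) d j (tau (mderiv i (tnth y j) * f)).
Proof.
have [_ hD _] := T_emb.
rewrite /tau -(tensorB (Der R i)) /cotransfer_DX /=.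
have -> : map_mpoly (mderiv i) (1 : {mpoly OX[n]}) = 0.
  by rewrite -(mpolyC1 n OX) map_mpolyC /= -(mpolyC1 n C) mderivC mpolyC0.
rewrite add0r scaleN1r tensorNl raddfN tensor_suml raddf_sum -sumrN.
apply: eq_bigr => j _; rewrite tensorZ.
have := hD (Der R j) 1 (mderiv i (tnth y j) * f).
rewrite /cotransfer_DY /= scaleN1r tensorNl raddfN => <-.
by rewrite mulr1 mul1r.
Qed.

(* Comparing [tau_der] at [f] and at [1] yields the chain rule, i.e. the
   derivations [d j] invert the Jacobian matrix. *)
Lemma chain_rule i f :
  toOU (mderiv i f) = \sum_(j < n) toOU (mderiv i (tnth y j)) * d j (toOU f).
Proof.
have dM j u v : d j (u * v) = d j u * v + u * d j v.
  by have [[_ h _] _] := d_ext j.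
have e1 := tau_der i 1; have ef := tau_der i f.
move: e1; rewrite -[X in tau (mderiv i X)]mpolyC1 mderivC tauE rmorph0 mul0r.
move/esym => e1; move: ef.
rewrite (eq_bigr (fun j => toOU (mderiv i (tnth y j)) * d j (toOU f) * tau 1
    + toOU f * d j (tau (mderiv i (tnth y j) * 1)))); last first.
  move=> j _; rewrite mulr1; set h := mderiv i _.
  have -> : tau (h * f) = toOU f * tau h.
    by rewrite tauE (tauE h) rmorphM mulrA [toOU f * _]mulrC.
  by rewrite dM; congr (_ + _); rewrite (tauE h) mulrCA mulrA.
rewrite big_split /= -mulr_sumr e1 mulr0 addr0 -mulr_suml tauE => e.
have t1 : tau 1 * toOU D0 = 1 by rewrite mulrC Delta_tau rmorph1.
by move/(congr1 (fun u => u * toOU D0)): e; rewrite -!mulrA t1 !mulr1.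
Qed.

Lemma d_add j u v : d j (u + v) = d j u + d j v.
Proof. by have [[h _ _] _] := d_ext j. Qed.

Lemma d_mul j u v : d j (u * v) = d j u * v + u * d j v.
Proof. by have [[_ h _] _] := d_ext j. Qed.

Lemma d_const j c : d j (toOU c%:MP) = 0.
Proof. by have [[_ _ h] _] := d_ext j. Qed.

Fact d_is_zmod_morphism j : zmod_morphism (d j).
Proof.
move=> u v; rewrite d_add; congr (_ + _).
have d0 : d j 0 = 0 by apply: (@addrI _ (d j 0)); rewrite -d_add !addr0.
by apply: (@addrI _ (d j v)); rewrite -d_add !subrr.
Qed.

Lemma DY_op_sub (g : weyl_gen R ns) u v :
  DY_on_OU y d g (u - v) = DY_on_OU y d g u - DY_on_OU y d g v.
Proof.
by case: g => [c|j|j] /=; rewrite ?mulrBr // d_is_zmod_morphism.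
Qed.

Lemma DY_opp A : DY y d A -> DY y d (fun u => - A u).
Proof.
move=> hA; have := DY_mul (DY_gen y d (Scal ns (-1))) hA.
congr (DY y d _); apply/funext => u /=.
by rewrite mpolyCN mpolyC1 rmorphN rmorph1 mulN1r.
Qed.

Lemma DY_id : DY y d id.
Proof.
have := DY_gen y d (Scal ns 1); congr (DY y d _); apply/funext => u /=.
by rewrite mpolyC1 rmorph1 mul1r.
Qed.

Lemma DY_zero : DY y d (fun=> 0).
Proof.
have := DY_gen y d (Scal ns 0); congr (DY y d _); apply/funext => u /=.
by rewrite mpolyC0 rmorph0 mul0r.
Qed.

Lemma DY_submodule_sub N u v : DY_submodule y d N -> N u -> N v -> N (u - v).
Proof.
by move=> [_ hD hA] hu hv; apply: hD => //; apply: hA (DY_opp DY_id) hv.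
Qed.

Lemma range_ind (N : OU -> Prop) : N 0 ->
  (forall u v, N u -> N v -> N (u - v)) ->
  (forall P f, N (T (tensor y P f))) -> forall w, N (T w).
Proof.
move=> N0 NB Nt w.
have NN u : N u -> N (- u) by move=> hu; rewrite -sub0r; apply: NB.
have ND u v : N u -> N v -> N (u + v).
  by move=> hu hv; rewrite -[v]opprK; apply: NB => //; apply: (NN).
have NX u k : N u -> N (u *+ k).
  by move=> hu; elim: k => [|k IH]; rewrite ?mulr0n // mulrS; apply: ND.
have [a ->] : exists a, w = \pi_{ideal_quot tensor_null y} a.
  by exists (generic_quotient.repr w); rewrite generic_quotient.reprK.
elim/freeg_ind_dom0: a => [|k [P f] D _ _ IH].
  by rewrite !raddf0.
rewrite !raddfD /=; apply: ND => //.
have -> : << k *g (P, f) >> = << (P, f) >> *~ k :> {freeg _ / int}.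
  by rewrite freegU_mulz intz.
rewrite !raddfMz /=; case: k => k; first exact: (NX _ _ (Nt P f)).
by rewrite NegzE mulrNz; exact: (NN _ (NX _ k.+1 (Nt P f))).
Qed.

Lemma range_submodule : DY_submodule y d (range T).
Proof.
have [_ hD _] := T_emb; split.
- by exists 0; rewrite // raddf0.
- by move=> _ _ [u _ <-] [v _ <-]; exists (u + v); rewrite // raddfD.
move=> A u hA; elim: hA u => [g|A1 A2 _ IH1 _ IH2|A1 A2 _ IH1 _ IH2] u hu.
- case: hu => w _ <-; move: w.
  apply: (@range_ind (fun u => range T (DY_on_OU y d g u))) => [|u1 u2 [w1 _ e1] [w2 _ e2]|P f].
  + by exists 0; rewrite // raddf0 -[X in DY_on_OU _ _ _ X](subrr 0) DY_op_sub subrr.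
  + by exists (w1 - w2); rewrite // raddfB e1 e2 DY_op_sub.
  + by rewrite -hD; exists (tensor y (cotransfer_DY y g P) f).
- have [w1 _ e1] := IH1 _ hu; have [w2 _ e2] := IH2 _ hu.
  by exists (w1 + w2); rewrite // raddfD e1 e2.
- exact/IH1/IH2.
Qed.

(** Multiplication by ['X_j] on the left factor is, up to sign, the action of d/dy_j, and
    coefficients pass to the right factor by [tensorZ]; so all pure tensors come from those with
    left factor 1. *)
Lemma range_generated N : DY_submodule y d N -> (forall f, N (tau f)) ->
  (range T `<=` N)%classic.
Proof.
have [_ hD _] := T_emb.
move=> hN Nt _ [w _ <-]; have [N0 ND NA] := hN.
have NB u v := @DY_submodule_sub N u v hN.
move: w; apply: (range_ind (N := N)) => // P f.
elim/mpolyind: P f => [|h m P _ _ IH] f; first by rewrite tensor0l raddf0.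
rewrite tensorDl raddfD; apply: ND => //; rewrite tensorZ {IH P}.
move: (h * f) => {h}f; rewrite mpolyXE_id.
elim: (index_enum _) => [|j s IHs]; first by rewrite big_nil; apply: Nt.
rewrite big_cons; elim: (m j) => [|e IHe]; first by rewrite expr0 mul1r.
rewrite exprSr mulrAC.
have := NA _ _ (DY_opp (DY_gen y d (Der R j))) IHe.
by rewrite -hD /cotransfer_DY /= scaleN1r tensorNl raddfN opprK.
Qed.

Lemma tau_range f : range T (tau f).
Proof. by exists (tensor y 1 f). Qed.

Lemma toOU_range f : range T (toOU f).
Proof.
by rewrite -Delta_tau tauE mulrA -rmorphM -tauE; apply: tau_range.
Qed.

End DirectImage.

(** * Young subgroups and their invariants *)

Section BlockOf.
Variables (r : nat) (ns : 'I_r -> nat).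
Local Notation n := (nvars ns).

Lemma start_le (i j : 'I_r) : (i < j)%N -> (start ns i + ns i <= start ns j)%N.
Proof.
move=> ij; rewrite /start [in X in (_ <= X)%N](bigD1 i) //= addnC leq_add2l.
rewrite big_mkcond [X in (_ <= X)%N]big_mkcond; apply: leq_sum => k _.
case: ltnP => // ki; rewrite (ltn_trans ki ij) /=; case: eqP => // e.
by move: ki; rewrite e ltnn.
Qed.

Lemma start_end (i : 'I_r) : (start ns i + ns i <= n)%N.
Proof.
rewrite /nvars (bigD1 i) //= addnC leq_add2l /start.
rewrite big_mkcond [X in (_ <= X)%N]big_mkcond; apply: leq_sum => k _.
case: ltnP => // ki /=; case: eqP => // e.
by move: ki; rewrite e ltnn.
Qed.

Lemma block_uniq (i j : 'I_r) k : k \in block ns i -> k \in block ns j -> i = j.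
Proof.
rewrite !inE => /andP[i1 i2] /andP[j1 j2]; apply: val_inj => /=.
case: (ltngtP i j) => // /start_le h.
  by have := leq_trans i2 (leq_trans h j1); rewrite ltnn.
by have := leq_trans j2 (leq_trans h i1); rewrite ltnn.
Qed.

Lemma enum_block (i : 'I_r) :
  map val (enum (block ns i)) = iota (start ns i) (ns i).
Proof.
pose P := fun j => (start ns i <= j < start ns i + ns i)%N.
have -> : map val (enum (block ns i)) = filter P (iota 0 n).
  rewrite -val_enum_ord filter_map; congr map; rewrite {1}/enum_mem -enumT.
  by apply: eq_filter => k; rewrite -[LHS]/(k \in block ns i) inE.
have [q ->] : exists q, n = (start ns i + (ns i + q))%N.
  by exists (n - (start ns i + ns i))%N; rewrite addnA subnKC ?start_end.
rewrite !iotaD !filter_cat add0n.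
rewrite (eq_in_filter (a2 := pred0)) ?filter_pred0 => [|j]; last first.
  by rewrite mem_iota /P /= add0n => lt_j; rewrite leqNgt lt_j.
rewrite (eq_in_filter (a2 := predT)) ?filter_predT => [|j]; last first.
  by rewrite mem_iota /P => ->.
rewrite (eq_in_filter (a2 := pred0)) ?filter_pred0 ?cats0 // => j.
by rewrite mem_iota /P => /andP[le_j _]; rewrite [(j < _)%N]ltnNge le_j andbF.
Qed.

Lemma card_block (i : 'I_r) : #|block ns i| = ns i.
Proof. by rewrite cardE -(size_map val) enum_block size_iota. Qed.

(** Every index lies in at most one block, and the block sizes add up to n, so the bounds F j <= 1
    are equalities. *)
Lemma block_ex (k : 'I_n) : exists i, k \in block ns i.
Proof.
pose F (k : 'I_n) := (\sum_(i < r) (k \in block ns i))%N.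
have F1 j : (F j <= 1)%N.
  have [/existsP[i ji]|] := boolP [exists i, j \in block ns i].
    rewrite /F (bigD1 i) //= ji big1 // => i' ii'; case: (boolP (_ \in _)) => //.
    by move/(block_uniq ji) => e; rewrite e eqxx in ii'.
  rewrite negb_exists => /forallP h; rewrite /F big1 // => i _.
  by rewrite (negPf (h i)).
have sF : (\sum_(j < n) F j == \sum_(j < n) 1)%N.
  rewrite sum1_card card_ord exchange_big /= /nvars; apply/eqP/eq_bigr => i _.
  rewrite -[RHS]card_block -sum1_card [RHS]big_mkcond.
  by apply: eq_bigr => j _; case: (_ \in _).
have [_] := leqif_sum (fun j (_ : xpredT j) => leqif_eq (F1 j)).
rewrite sF => /esym/forallP/(_ k) /eqP Fk.
apply/existsP; apply: contraT; rewrite negb_exists => /forallP h.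
by move: Fk; rewrite /F big1 // => i _; rewrite (negPf (h i)).
Qed.

Definition blk (k : 'I_n) : 'I_r := xchoose (block_ex k).

Lemma mem_blk k : k \in block ns (blk k).
Proof. exact: (xchooseP (block_ex k)). Qed.

Lemma mem_block i k : (k \in block ns i) = (blk k == i).
Proof.
apply/idP/eqP => [ki|<-]; last exact: mem_blk.
exact: block_uniq (mem_blk k) ki.
Qed.

Definition young : {group 'S_n} := fixg_group blk.

Lemma Sym_young i s : s \in Sym (block ns i) -> s \in young.
Proof.
rewrite inE => hs; apply/fixgP => k.
have [ki|ki] := boolP (k \in block ns i); last by rewrite (out_perm hs).
move: (ki); rewrite mem_block => /eqP->; apply/eqP.
by rewrite -mem_block (perm_closed _ hs).
Qed.

End BlockOf.

Section Invariants.
Variables (R : realType) (r : nat) (ns : 'I_r -> nat).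
Local Notation C := R[i].
Local Notation n := (nvars ns).
Local Notation OX := {mpoly C[n]}.
Local Notation Symb i := (Sym_group (block ns i)).
Implicit Types (p h : OX).

Lemma msym_block_poly i (s : 'S_n) p : block_poly i p ->
  (forall k, k \in block ns i -> s k = k) -> msym s p = p.
Proof.
move=> hp hs; apply/mpolyP => m; rewrite mcoeff_sym.
have out k : k \notin block ns i -> s k \notin block ns i.
  by apply: contra => ski; rewrite -(perm_inj (hs _ ski)).
have outV k : k \notin block ns i -> (s^-1)%g k \notin block ns i.
  by apply: contra => /[dup]/hs; rewrite permKV => <-.
have [pm|/memN_msupp_eq0 pm] := boolP (m \in msupp p).
  congr (p@_ _); apply/mnmP => k; rewrite mnmE.
  have [/hs->//|ki] := boolP (k \in block ns i).
  by rewrite !(hp _ pm) // out.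
have [pm'|/memN_msupp_eq0->//] :=
  boolP ([multinom m (s i) | i < n] \in msupp p).
congr (p@_ _); apply/mnmP => k.
have [/hs e|ki] := boolP (k \in block ns i); first by rewrite mnmE e.
by have := hp _ pm' _ (outV _ ki); rewrite (hp _ pm' _ ki) mnmE permKV => ->.
Qed.

Lemma avg_block_poly i h : block_poly i h -> block_poly i (avg (Symb i) h).
Proof.
move=> hh m /msupp_avg[s]; rewrite inE => hs pm k ki.
by have := hh _ pm k ki; rewrite mnmE (out_perm hs).
Qed.

Lemma avg_block_invariant i h :
  block_poly i h -> block_invariant i (avg (Symb i) h).
Proof.
move=> hh; split; first exact: avg_block_poly.
by move=> s hs; apply: msym_avg; rewrite inE.
Qed.

Lemma avg_prod i (h : 'I_r -> OX) : (forall j, block_poly j (h j)) ->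
  avg (Symb i) (\prod_j h j)
  = \prod_j (if j == i then avg (Symb i) (h i) else h j).
Proof.
move=> hh; rewrite (bigD1 i) //= [RHS](bigD1 i) //= eqxx.
rewrite avg_mulr => [|s]; last first.
  rewrite inE => hs; rewrite (rmorph_prod (msym s)) /=; apply: eq_bigr => j ji.
  apply: msym_block_poly (hh j) _ => k kj; apply: (out_perm hs).
  by apply: contra ji => ki; rewrite (block_uniq ki kj).
by congr (_ * _); apply: eq_bigr => j /negPf->.
Qed.

Fixpoint avgs (s : seq 'I_r) p : OX :=
  if s is i :: s' then avg (Symb i) (avgs s' p) else p.

Lemma avgs_linear s c p q : avgs s (c *: p + q) = c *: avgs s p + avgs s q.
Proof. by elim: s => //= i s ->; rewrite linearP. Qed.

Lemma avgs_prod s (h : 'I_r -> OX) : uniq s -> (forall j, block_poly j (h j)) ->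
  avgs s (\prod_j h j)
  = \prod_j (if j \in s then avg (Symb j) (h j) else h j).
Proof.
move=> + hh; elim: s => [|i s IH] /=; first by move=> _; apply: eq_bigr.
case/andP => iNs us; rewrite IH // avg_prod => [|j].
  apply: eq_bigr => j _; rewrite inE; case: eqP => [->|//].
  by rewrite (negPf iNs).
by case: (j \in s); first exact: avg_block_poly.
Qed.

Lemma avgs_id s p : (forall g, g \in young ns -> msym g p = p) ->
  exists2 N, (0 < N)%N & avgs s p = N%:R *: p.
Proof.
move=> hp; elim: s => [|i s [N N0 IH]] /=; first by exists 1%N; rewrite ?scale1r.
exists (N * #|Symb i|)%N; first by rewrite muln_gt0 N0 cardG_gt0.
rewrite IH linearZ /= avg_id ?scalerA ?natrM // => g gi.
exact/hp/(Sym_young gi).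
Qed.

Lemma monomial_blocks (m : 'X_{1..n}) : exists2 h : 'I_r -> OX,
  'X_[m] = \prod_i h i & forall i, block_poly i (h i).
Proof.
exists (fun i => \prod_(k | blk k == i) 'X_k ^+ m k).
  by rewrite mpolyXE_id (partition_big (@blk r ns) xpredT).
move=> i; pose m' := [multinom if blk k == i then m k else 0%N | k < n].
have -> : \prod_(k | blk k == i) 'X_k ^+ m k = 'X_[m'] :> OX.
  rewrite mpolyXE_id big_mkcond; apply: eq_bigr => k _; rewrite mnmE.
  by case: ifP.
by move=> m1; rewrite msuppX inE => /eqP-> k; rewrite mem_block mnmE => /negPf->.
Qed.

Variable y : n.-tuple OX.
Hypothesis y_gens : invariant_generators y.

(** The hypothesis on y concerns one block at a time. Averaging over the factors of G in turn
    multiplies the invariant p by a positive integer, while it makes every monomial a product of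
    block invariants, each a polynomial in y. *)
Lemma invariant_comp p : (forall g, g \in young ns -> msym g p = p) ->
  exists q : OX, p = q \mPo y.
Proof.
move=> hp; have [N N0 e] := avgs_id (enum 'I_r) hp.
suff [q hq] : exists q : OX, avgs (enum 'I_r) p = q \mPo y.
  exists (N%:R^-1 *: q); rewrite comp_mpolyZ -hq e scalerA mulVf ?scale1r //.
  by rewrite pnatr_eq0 -lt0n.
have avgs0 : avgs (enum 'I_r) 0 = 0.
  have := avgs_linear (enum 'I_r) (-1) 0 0.
  by rewrite scaler0 addr0 scaleN1r addNr.
elim/mpolyind: p {hp e} => [|c m p _ _ [q hq]].
  by exists 0; rewrite avgs0 comp_mpoly0.
have [h -> hh] := monomial_blocks m.
rewrite avgs_linear hq avgs_prod ?enum_uniq //.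
have /fin_all_exists[q' hq'] i : exists q' : OX, avg (Symb i) (h i) = q' \mPo y.
  have [_ /(_ _ (avg_block_invariant (hh i)))[q' _ e] _] := y_gens i.
  exact: (ex_intro _ q' e).
exists (c *: \prod_i q' i + q); rewrite linearP /= (rmorph_prod (comp_mpoly y)).
congr (_ *: _ + _); apply: eq_bigr => i _.
rewrite mem_enum inE; exact: hq'.
Qed.

Lemma young_block_invariant i p g : block_invariant i p -> g \in young ns ->
  msym g p = p.
Proof.
move=> [bp ip] /fixgP gY.
have gB k : (g k \in block ns i) = (k \in block ns i) by rewrite !mem_block gY.
pose f k := if k \in block ns i then g k else k.
have f_inj : injective f.
  move=> k l; rewrite /f; case: ifP => ki; case: ifP => li //.
  - exact: perm_inj.
  - by move=> e; rewrite -e gB ki in li.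
  - by move=> e; rewrite e gB li in ki.
pose s := perm f_inj; have sE k : s k = f k by rewrite permE.
have hs : perm_on (block ns i) s.
  apply/fintype.subsetP => k; rewrite inE sE /f.
  by case: ifP => // _; rewrite eqxx.
rewrite -(mulKVg s g) msymMm (ip _ hs).
apply: (msym_block_poly bp) => k ki; rewrite permM.
have kb : s^-1%g k \in block ns i by rewrite -(perm_closed _ hs) permKV.
by have := sE (s^-1%g k); rewrite permKV /f kb.
Qed.

Lemma gen_invariant j g : g \in young ns -> msym g (tnth y j) = tnth y j.
Proof.
have [/(_ j (mem_blk j)) inv_j _ _] := y_gens (blk j).
by move=> gY; apply: young_block_invariant inv_j gY.
Qed.

End Invariants.

(** * Standard tableaux and higher Specht polynomials *)

Section StandardTableaux.
Local Open Scope nat_scope.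
Variables (r : nat) (ns : 'I_r -> nat).
Local Notation n := (nvars ns).
Local Notation ltI := (fun k l : 'I_n => (k < l)%N).

Lemma ltI_trans : transitive ltI. Proof. by move=> a b c; apply: ltn_trans. Qed.
Lemma ltI_irr : irreflexive ltI. Proof. by move=> a; apply: ltnn. Qed.

Lemma sorted_enum_block i : sorted ltI (enum (block ns i)).
Proof.
have : sorted ltn (map val (enum (block ns i))).
  by rewrite enum_block iota_ltn_sorted.
by rewrite sorted_map.
Qed.

Lemma nth_enum_block x0 i p : (p < ns i)%N ->
  val (nth x0 (enum (block ns i)) p) = (start ns i + p)%N.
Proof.
move=> lt_p; rewrite -(nth_map x0 0%N) ?enum_block ?nth_iota //.
by rewrite -cardE card_block.
Qed.

Section Block.
Variables (i : 'I_r) (lam : seq nat) (t : tableau ns).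
Hypothesis lamP : is_partition (ns i) lam.

Lemma partition_sorted : sorted geq lam. Proof. by case/and3P: lamP. Qed.
Lemma partition_pos : 0%N \notin lam. Proof. by case/and3P: lamP. Qed.
Lemma partition_sum : sumn lam = ns i. Proof. by case/and3P: lamP => _ _ /eqP. Qed.

Lemma standardP x0 : standard i lam t <->
  [/\ shape t = lam, perm_eq (flatten t) (enum (block ns i)),
      forall j, sorted ltI (nth [::] t j)
    & forall j b, (b < size (nth [::] t j.+1))%N ->
        (nth x0 (nth [::] t j) b < nth x0 (nth [::] t j.+1) b)%N].
Proof.
have dec : shape t = lam -> decr t.
  by move=> e; apply: decr_shape; rewrite e; apply: partition_sorted.
split=> [/and4P[/eqP e pt rows cols]|[e pt rows cols]].
  split=> // [j|j b lt_b].
    have [lt_j|le_j] := ltnP j (size t); last by rewrite nth_default.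
    exact: (allP rows _ (mem_nth _ lt_j)).
  have [dt bW] : decr t /\ (b < size (head [::] t))%N.
    split; first exact: dec.
    by rewrite -nth0; apply: leq_trans lt_b (decr_le (dec e) (leq0n _)).
  have st : sorted ltI (colseq t b).
    apply: (allP cols); apply/mapP; exists b => //.
    by rewrite mem_iota.
  exact: ((sorted_colseq ltI x0 b dt).1 st).
apply/and4P; split=> //; first exact/eqP.
  by apply/allP => row /(nthP [::])[j _ <-]; apply: rows.
apply/allP => _ /mapP[b _ ->].
by apply: (sorted_colseq ltI x0 b (dec e)).2 => j; apply: cols.
Qed.

Hypothesis ht : standard i lam t.

Lemma std_shape : shape t = lam. Proof. by case/and4P: ht => /eqP. Qed.

Lemma std_perm : perm_eq (flatten t) (enum (block ns i)).
Proof. by case/and4P: ht. Qed.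

Lemma std_uniq : uniq (flatten t).
Proof. by rewrite (perm_uniq std_perm) enum_uniq. Qed.

Lemma std_mem k : (k \in flatten t) = (k \in block ns i).
Proof. by rewrite (perm_mem std_perm) mem_enum. Qed.

Lemma std_decr : decr t.
Proof. by apply: decr_shape; rewrite std_shape; apply: partition_sorted. Qed.

Lemma std_row j : sorted ltI (nth [::] t j).
Proof.
have [lt_j|le_j] := ltnP j (size t); last by rewrite nth_default.
case/and4P: ht => _ _ rows _; exact: (allP rows _ (mem_nth _ lt_j)).
Qed.

Lemma std_col x0 j j' b : (j < j')%N -> (b < size (nth [::] t j'))%N ->
  (nth x0 (nth [::] t j) b < nth x0 (nth [::] t j') b)%N.
Proof.
have [_ _ _ h] := (standardP x0).1 ht.
elim: j' => // j' IH; rewrite ltnS leq_eqVlt => /predU1P[->|lt_j] lt_b; first exact: h.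
apply: ltn_trans (h _ _ lt_b); apply: IH => //.
exact: leq_trans lt_b (std_decr j').
Qed.

End Block.

Section Canonical.
Variables (i : 'I_r) (lam : seq nat).
Hypothesis lamP : is_partition (ns i) lam.
Local Notation s := (Defs.canonical ns i lam).

Lemma flatten_canonical : flatten s = enum (block ns i).
Proof. by rewrite reshapeKr // (partition_sum lamP) -cardE card_block. Qed.

Lemma canonical_standard (x0 : 'I_n) : standard i lam s.
Proof.
have sf : sorted ltI (flatten s) by rewrite flatten_canonical sorted_enum_block.
apply/(standardP _ lamP x0); split.
- by rewrite reshapeKl // (partition_sum lamP) -cardE card_block.
- by rewrite flatten_canonical.
- by move=> j; apply: sorted_flatten_row ltI_trans _ _ sf.
move=> j b lt_b; apply: (sorted_flatten_col ltI_trans) => //.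
apply: leq_trans lt_b _; apply: decr_shape.
rewrite reshapeKl; first exact: partition_sorted lamP.
by rewrite (partition_sum lamP) -cardE card_block.
Qed.

(** The next letter of the same row lies in a later column, to the right in the word. The first
    letter of a new row lies in column 0, either in an earlier column or below its predecessor, and
    so to the left. Hence indices are row numbers, the exponents of [row_mnm]. *)
Lemma entry_index_canonical x0 p : (p < ns i)%N ->
  entry_index i s (nth x0 (enum (block ns i)) p) = (pos lam p).1.
Proof.
move=> lt_p; rewrite /entry_index nth_enum_block // addKn.
have st := canonical_standard x0.
have us := std_uniq st; have ds := std_decr lamP st.
have [sh _ _ cl] := (standardP _ lamP x0).1 st.
have sz : size (flatten s) = ns i by rewrite flatten_canonical -cardE card_block.
have word_idx q : (q < ns i)%N ->
    index (start ns i + q)%N (word s)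
    = index (nth x0 (flatten s) q) (flatten [seq rev c | c <- columns s]).
  move=> lt_q; rewrite flatten_canonical -(nth_enum_block x0) //.
  by rewrite /word index_map //; apply: val_inj.
elim: p lt_p => [lt_p|p IH lt_p] /=.
  rewrite pos0 ?(partition_pos lamP) // (partition_sum lamP).
  exact: leq_ltn_trans lt_p.
rewrite (IH (ltnW lt_p)) !word_idx ?(ltnW lt_p) //.
have lt_p1 : (p.+1 < size (flatten s))%N by rewrite sz.
have lt_p0 := ltnW lt_p1.
have [r0 c0] := pos_flatten x0 us lt_p0.
have [r1 c1] := pos_flatten x0 us lt_p1.
rewrite sh in r0 c0 r1 c1.
have m0 := mem_nth x0 lt_p0; have m1 := mem_nth x0 lt_p1.
have W_col := index_word_col us ds.
have W_row := index_word_row ltI_trans ltI_irr us ds cl.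
case: (pos_succ (partition_pos lamP) (p := p)).
- by rewrite (partition_sum lamP).
- move=> e; rewrite e in r1 c1 *; rewrite ltnNge ltnW ?addn0 //.
  by apply: W_col => //; rewrite c0 c1.
move=> e; rewrite e in r1 c1 *; rewrite /= -[RHS]addn1; congr (_ + _)%N.
suff -> : (index (nth x0 (flatten s) p.+1) (flatten [seq rev c | c <- columns s])
  < index (nth x0 (flatten s) p) (flatten [seq rev c | c <- columns s]))%N by [].
have [c00|c0_gt0] := posnP (pos lam p).2; last by apply: W_col; rewrite // c0 c1.
apply: W_row => //; first by rewrite c0 c1 c00.
rewrite flatten_canonical !nth_enum_block ?(ltnW lt_p) //.
by rewrite addnS.
Qed.

End Canonical.

End StandardTableaux.

Section RTableaux.
Variables (r : nat) (ns : 'I_r -> nat).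
Local Notation n := (nvars ns).
Local Notation blk := (@blk r ns).

Definition trow (t : rtableau ns) (k : 'I_n) := rowt (t (blk k)) k.
Definition tcol (t : rtableau ns) (k : 'I_n) := colt (t (blk k)) k.

Definition valid (lam : rdiagram r) (t : rtableau ns) :=
  forall i, is_partition (ns i) (lam i) /\ standard i (lam i) (t i).

Lemma validP lam t : is_rdiagram ns lam -> NST lam t -> valid lam t.
Proof. by move=> /forallP lamP /forallP tP i. Qed.

Section OneTableau.
Variables (lam : rdiagram r) (t : rtableau ns).
Hypothesis vt : valid lam t.

Lemma mem_own k : k \in flatten (t (blk k)).
Proof. by rewrite (std_mem (vt _).2) mem_blk. Qed.

Lemma blk_tableau i k : k \in flatten (t i) -> blk k = i.
Proof. by rewrite (std_mem (vt _).2) mem_block => /eqP. Qed.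

Lemma blk_box i j b x0 : (b < size (nth [::] (t i) j))%N ->
  [/\ blk (nth x0 (nth [::] (t i) j) b) = i,
      trow t (nth x0 (nth [::] (t i) j) b) = j
    & tcol t (nth x0 (nth [::] (t i) j) b) = b].
Proof.
move=> lt_b; have e : blk (nth x0 (nth [::] (t i) j) b) = i.
  by apply: blk_tableau; apply: (@nth_mem_flatten _ _ j); rewrite mem_nth.
have u := std_uniq (vt i).2.
by rewrite /trow /tcol e rowt_nth // colt_nth.
Qed.

Lemma rtab_inj k l : blk k = blk l -> trow t k = trow t l -> tcol t k = tcol t l ->
  k = l.
Proof.
rewrite /trow /tcol => e; rewrite e; apply: box_inj; rewrite ?mem_own //.
by rewrite -e mem_own.
Qed.

Lemma rtab_tab : is_tab (young ns) (trow t) (young_col blk (tcol t)).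
Proof.
split.
- by move=> k l rkl [bkl ckl]; apply: rtab_inj.
- move=> k rk; have kt := mem_own k.
  have lt_c : (tcol t k < size (nth [::] (t (blk k)) (trow t k).-1))%N.
    apply: leq_trans (colt_lt kt) _.
    by apply: decr_le (std_decr (vt _).1 (vt _).2) _; apply: leq_pred.
  have [b1 b2 b3] := blk_box k lt_c.
  by exists (nth k (nth [::] (t (blk k)) (trow t k).-1) (tcol t k));
     rewrite ?b2 ?prednK // /young_col b1 b3.
by apply/fintype.subsetP => s /fixgP h; apply/fixgP => k; case: (h k).
Qed.

Lemma rtab_std (k l : 'I_n) : young_col blk (tcol t) k = young_col blk (tcol t) l ->
  (trow t k < trow t l)%N -> (k < l)%N.
Proof.
case=> bkl ckl lt_r; have kt := mem_own k; have lt := mem_own l.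
rewrite /trow /tcol bkl in ckl lt_r kt.
have := std_col (vt _).1 (vt _).2 k lt_r (colt_lt lt).
by rewrite nth_rowt // -ckl nth_rowt.
Qed.

Lemma size_rowt i j :
  size (nth [::] (t i) j) = #|[set k : 'I_n | (blk k == i) && (trow t k == j)]|.
Proof.
have u := uniq_row j (std_uniq (vt i).2).
rewrite -(card_uniqP u); apply: eq_card => k; rewrite inE.
apply/idP/andP => [kj|[/eqP bk /eqP <-]].
  have bk := blk_tableau (nth_mem_flatten kj); split; first exact/eqP.
  by rewrite /trow bk (rowt_uniq (std_uniq (vt i).2) kj).
by rewrite /trow -bk nth_mem_rowt // mem_own.
Qed.

Lemma mem_rowt i j k : (k \in nth [::] (t i) j) = (blk k == i) && (trow t k == j).
Proof.
apply/idP/andP => [kj|[/eqP bk /eqP <-]].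
  have bk := blk_tableau (nth_mem_flatten kj); split; first exact/eqP.
  by rewrite /trow bk (rowt_uniq (std_uniq (vt i).2) kj).
by rewrite /trow -bk nth_mem_rowt // mem_own.
Qed.

End OneTableau.

Section TwoTableaux.
Variables (lam lam' : rdiagram r) (t t' : rtableau ns).
Hypotheses (vt : valid lam t) (vt' : valid lam' t').

(** Rows are increasing, hence determined by their sets of entries; the numbers of rows agree
    because no row is empty. *)
Lemma rtab_same_rows : trow t =1 trow t' -> (lam, t) = (lam', t').
Proof.
move=> e.
have eqt i j : nth [::] (t i) j = nth [::] (t' i) j.
  apply: (@irr_sorted_eq _ (fun k l : 'I_n => (k < l)%N)).
  - exact: ltI_trans.
  - exact: ltI_irr.
  - exact: std_row (vt i).2 j.
  - exact: std_row (vt' i).2 j.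
  by move=> k; rewrite (mem_rowt vt) (mem_rowt vt') e.
have le_size l u l' u' i : valid l u -> valid l' u' ->
    (forall j, nth [::] (u i) j = nth [::] (u' i) j) -> (size (u i) <= size (u' i))%N.
  move=> v v' eu; rewrite leqNgt; apply/negP => lt_s.
  have := eu (size (u' i)); rewrite [RHS]nth_default // => e0.
  have := partition_pos (v i).1; rewrite -(std_shape (v i).2) => /negP; apply.
  by apply/mapP; exists [::] => //; rewrite -e0 mem_nth.
have -> : t = t'.
  apply/ffunP => i; apply: (@eq_from_nth _ [::]) => [|j _]; last exact: eqt.
  apply/eqP; rewrite eqn_leq (le_size _ _ _ _ _ vt vt') ?(le_size _ _ _ _ _ vt' vt) //.
congr (_, _); apply/ffunP => i.
rewrite -(std_shape (vt i).2) -(std_shape (vt' i).2); congr shape.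
apply: (@eq_from_nth _ [::]) => [|j _]; last exact: eqt.
by apply/eqP; rewrite eqn_leq (le_size _ _ _ _ _ vt vt') ?(le_size _ _ _ _ _ vt' vt).
Qed.

Lemma rtab_same_sizes :
  (forall i j, size (nth [::] (t i) j) = size (nth [::] (t' i) j)) ->
  exists2 h, h \in young ns & forall k,
    trow t' (h k) = trow t k /\ young_col blk (tcol t') (h k) = young_col blk (tcol t) k.
Proof.
move=> sz; pose f k := nth k (nth [::] (t' (blk k)) (trow t k)) (tcol t k).
have fP k : [/\ blk (f k) = blk k, trow t' (f k) = trow t k
               & tcol t' (f k) = tcol t k].
  by apply: (blk_box vt'); rewrite -sz; apply: colt_lt (mem_own vt k).
have f_inj : injective f.
  move=> k l e; have [bk rk ck] := fP k; have [bl rl cl] := fP l.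
  by apply: (rtab_inj vt); [rewrite -bk -bl e | rewrite -rk -rl e | rewrite -ck -cl e].
exists (perm f_inj) => [|k]; last by rewrite permE /young_col; have [-> -> ->] := fP k.
by apply/fixgP => k; rewrite permE; have [] := fP k.
Qed.

Lemma rtab_same_shape g : g \in young ns ->
  (forall k, trow t' (g k) = trow t k) ->
  exists2 h, h \in young ns & forall k,
    trow t' (h k) = trow t k /\ young_col blk (tcol t') (h k) = young_col blk (tcol t) k.
Proof.
move=> /fixgP gY gr; apply: rtab_same_sizes => i j.
rewrite (size_rowt vt) (size_rowt vt') -(card_imset _ (@perm_inj _ g)).
apply: eq_card => k; rewrite !inE; apply/imsetP/andP => [[l]|[bk rk]].
  by rewrite !inE => /andP[bl rl] ->; rewrite gY gr.
by exists (g^-1%g k); rewrite ?permKV // !inE -gY -gr permKV bk.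
Qed.

End TwoTableaux.

End RTableaux.

Section SpechtOfTableau.
Variables (R : realType) (r : nat) (ns : 'I_r -> nat).
Local Notation C := R[i].
Local Notation n := (nvars ns).
Local Notation blk := (@blk r ns).
Variables (lam : rdiagram r) (t : rtableau ns).
Hypothesis vt : valid lam t.

Lemma index_monomialE i :
  index_monomial R i (t i) (Defs.canonical ns i (lam i)) = 'X_[block_mnm blk (trow t) i].
Proof.
have [lamP tP] := vt i; have ut := std_uniq tP.
have szt : size (flatten (t i)) = ns i.
  by rewrite (perm_size (std_perm tP)) -cardE card_block.
rewrite /index_monomial flatten_canonical //.
set E := enum (block ns i); set A := flatten (t i).
have szE : size E = ns i by rewrite /E -cardE card_block.
transitivity (\prod_(k <- A) ('X_k : {mpoly C[n]}) ^+ rowt (t i) k).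
  rewrite -(big_map (fun b : 'I_n * 'I_n =>
    ('X_b.1 : {mpoly C[n]}) ^+ entry_index i (Defs.canonical ns i (lam i)) b.2)
    xpredT id).
  rewrite -[RHS](big_map (fun k => 'X_k ^+ rowt (t i) k) xpredT id).
  congr (\big[_/_]_(x <- _) _); apply: (@eq_from_nth _ 0).
    by rewrite !size_map size_zip szE [size A]szt minnn.
  rewrite size_map size_zip szE [size A]szt minnn => p lt_p.
  have x0 : 'I_n by apply: (Ordinal (leq_trans lt_p _));
    apply: leq_trans (leq_addl (start ns i) _) (start_end ns i).
  rewrite (nth_map (x0, x0)) ?size_zip ?szE ?[size A]szt ?minnn //.
  rewrite (nth_map x0) ?[size A]szt // nth_zip ?szE ?[size A]szt //=.
  rewrite entry_index_canonical //.
  have lt_pA : (p < size (flatten (t i)))%N by rewrite szt.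
  by rewrite (pos_flatten x0 ut lt_pA).1 (std_shape tP).
rewrite (perm_big _ (std_perm tP)) big_enum /= mpolyXE_id big_mkcond.
apply: eq_bigr => k _; rewrite mem_block mnmE /trow.
by case: eqP => [->|].
Qed.

Lemma row_stab_fix i s : s \in row_stab i (t i) ->
  msym s ('X_[block_mnm blk (trow t) i] : {mpoly C[n]}) = 'X_[block_mnm blk (trow t) i].
Proof.
rewrite inE => /andP[on_s rows]; have [lamP tP] := vt i.
have h k : block_mnm blk (trow t) i (s k) = block_mnm blk (trow t) i k.
  rewrite !mnmE -!mem_block (perm_closed _ on_s).
  case: ifP => // ki; move: (ki); rewrite mem_block => /eqP bk.
  have kt : k \in flatten (t i) by rewrite (std_mem tP).
  have kr := nth_mem_rowt kt; set j := rowt (t i) k in kr.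
  have tj : nth [::] (t i) j \in t i.
    apply: mem_nth; rewrite ltnNge; apply: contraL kr => /(nth_default [::])->.
    by [].
  have skr := allP (allP rows _ tj) _ kr.
  rewrite (mem_rowt vt) in skr; case/andP: skr => _ /eqP->.
  by rewrite /j /trow bk.
rewrite msymX; congr 'X_[_]; apply/mnmP => k.
by rewrite mnmE -h permKV.
Qed.

Lemma col_stabE i : col_stab i (t i) = fixg (block_col blk (tcol t) i).
Proof.
have [lamP tP] := vt i; have ut := std_uniq tP.
apply/setP => s; apply/idP/idP.
  rewrite inE => /andP[on_s cols]; apply/fixgP => k; rewrite /block_col.
  have -> : (blk (s k) == i) = (blk k == i) by rewrite -!mem_block (perm_closed _ on_s).
  case: ifP => ki; last by rewrite (out_perm on_s) // mem_block ki.
  congr inl; rewrite /tcol.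
  have ski : blk (s k) == i by rewrite -mem_block (perm_closed _ on_s) mem_block.
  rewrite (eqP ki) (eqP ski).
  have kt : k \in flatten (t i) by rewrite (std_mem tP) mem_block.
  have kc : k \in colseq (t i) (colt (t i) k) by rewrite mem_colseq // kt eqxx.
  have cc : colseq (t i) (colt (t i) k) \in columns (t i).
    apply/mapP; exists (colt (t i) k) => //; rewrite mem_iota /= add0n -nth0.
    by apply: leq_trans (colt_lt kt) (decr_le (std_decr lamP tP) (leq0n _)).
  by have := allP (allP cols _ cc) _ kc; rewrite mem_colseq // => /andP[_ /eqP].
move=> sG; rewrite inE; apply/andP; split.
  apply/fintype.subsetP => k; rewrite inE mem_block; apply: contraR => ki.
  by rewrite (block_col_out sG ki).
apply/allP => c /mapP[b _ ->]; apply/allP => k.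
rewrite -/(colseq (t i) b) !mem_colseq // => /andP[kt /eqP cb].
have bk := blk_tableau vt kt; have [bsk csk] := block_col_in sG bk.
rewrite (std_mem tP) mem_block bsk eqxx /=.
by move: csk; rewrite /tcol bsk bk cb => ->.
Qed.

Lemma num_standard_neq0 i : num_standard ns i (lam i) != 0%N.
Proof.
have [lamP tP] := vt i; rewrite -lt0n card_gt0; apply/set0Pn.
have szt : size (flatten (t i)) == ns i.
  by rewrite (perm_size (std_perm tP)) -cardE card_block.
exists (Tuple szt); rewrite inE /= -(std_shape tP) flattenK.
by rewrite (std_shape tP).
Qed.

(** Row permutations fix the index monomial, so the row part of the Young symmetrizer only
    contributes the order of the row stabilizer. *)
Lemma higher_spechtE i : exists2 c, c != 0 &
  higher_specht R i (lam i) (t i) (Defs.canonical ns i (lam i))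
  = c *: block_specht C blk (trow t) (tcol t) i.
Proof.
exists ((num_standard ns i (lam i))%:R / ((ns i)`!)%:R * #|row_stab i (t i)|%:R).
  rewrite !mulf_neq0 ?invr_eq0 ?pnatr_eq0 ?num_standard_neq0 // -?lt0n ?fact_gt0 //.
  rewrite card_gt0; apply/set0Pn; exists 1%g; rewrite inE perm_on1 /=.
  by apply/allP => row _; apply/allP => k; rewrite perm1.
rewrite /higher_specht /young_symmetrizer index_monomialE -[RHS]scalerA; congr (_ *: _).
transitivity (\sum_(s in row_stab i (t i)) block_specht C blk (trow t) (tcol t) i).
  apply: eq_bigr => s sR; rewrite (row_stab_fix sR) /block_specht /colsym col_stabE.
  by [].
by rewrite sumr_const scaler_nat.
Qed.

Lemma F_specht : exists2 c, c != 0 &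
  F_ R lam t = c *: specht C (trow t) (young_col blk (tcol t)).
Proof.
have /fin_all_exists2[c c0 cE] := higher_spechtE.
have [e e0 eE] := block_specht_prod C (rtab_tab vt).
exists ((\prod_i c i) * e).
  by apply: mulf_neq0 e0; apply/prodf_neq0 => i _; apply: c0.
transitivity (\prod_i (c i *: block_specht C blk (trow t) (tcol t) i)).
  exact: (eq_bigr _ (fun i _ => cE i)).
by rewrite scaler_prod eE scalerA.
Qed.

End SpechtOfTableau.

(** * Standard tableaux from lattice words *)

Section WordRows.
Local Open Scope nat_scope.

(** The increasing list of the positions of the letter j; the head of w, its last letter, has
    position [size w']. *)
Fixpoint word_row (w : seq nat) (j : nat) : seq nat :=
  if w is i :: w' then
    if i == j then rcons (word_row w' j) (size w') else word_row w' j
  else [::].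

Lemma size_word_row w j : size (word_row w j) = content w j.
Proof.
elim: w => //= i w IH; rewrite /content /= -/(content w j) -IH.
by case: eqP; rewrite ?size_rcons.
Qed.

Lemma word_row_lt w j p : p \in word_row w j -> (p < size w)%N.
Proof.
elim: w => //= i w IH; case: eqP => _; last by move/IH/ltnW.
by rewrite mem_rcons inE => /predU1P[->|/IH/ltnW].
Qed.

Lemma word_row_sorted w j : sorted ltn (word_row w j).
Proof.
elim: w => //= i w IH; case: eqP => // _.
rewrite (sorted_pairwise ltn_trans) pairwise_rcons -(sorted_pairwise ltn_trans) IH.
by rewrite andbT; apply/allP => p /word_row_lt.
Qed.

(** When the letter j + 1 with number b is appended, the lattice condition says that more letters j
    than j + 1 have occurred, so the letter j with number b has an earlier position. *)
Lemma word_row_col N m w j b : w \in lattice_words N m ->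
  (b < size (word_row w j.+1))%N ->
  (nth 0%N (word_row w j) b < nth 0%N (word_row w j.+1) b)%N.
Proof.
elim: w m => [|i w IH] // [|m] //; rewrite lattice_wordsS => /and3P[_ add ww].
have part_w := part_lattice_word ww; rewrite /=.
case: (i =P j.+1) => [ij|_]; first subst i.
  rewrite gtn_eqF // size_rcons ltnS leq_eqVlt => /predU1P[->|lt_b].
    rewrite nth_rcons ltnn eqxx (@word_row_lt _ j) // mem_nth // !size_word_row.
    exact: add.
  by rewrite [X in (_ < X)%N]nth_rcons lt_b; apply: IH ww lt_b.
case: (i =P j) => [ij|_] lt_b; last exact: IH ww lt_b.
rewrite nth_rcons; case: (ltnP b) => [_|le_b]; first exact: IH ww lt_b.
have := leq_trans lt_b (leq_trans _ le_b).
by rewrite !size_word_row ltnn => /(_ (part_w j)).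
Qed.

Lemma word_row_inj w w' : size w = size w' -> word_row w =1 word_row w' -> w = w'.
Proof.
elim: w w' => [|i w IH] [|i' w'] //= [sz] e.
have ii : i = i'.
  have := e i; rewrite eqxx; case: eqP => // _ ei.
  have := @word_row_lt w' i (size w); rewrite -ei mem_rcons inE eqxx -sz ltnn.
  by move=> /(_ isT).
rewrite -ii in e *; congr (_ :: _); apply: IH => // j.
by have := e j; case: eqP => // _ /rcons_inj[].
Qed.

Lemma perm_word_rows w h : all (fun j => j < h)%N w ->
  perm_eq (flatten [seq word_row w j | j <- iota 0 h]) (iota 0 (size w)).
Proof.
move=> lt_w; apply/seq.permP => a; rewrite count_flatten -map_comp sumnE big_map.
elim: w lt_w => [|i w IH]; first by rewrite big1.
case/andP => lt_i /IH{}IH; rewrite [size _]/= -(addn1 (size w)).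
rewrite iotaD count_cat -IH /= addn0 add0n.
rewrite (bigD1_seq i) ?iota_uniq ?mem_iota //= eqxx.
rewrite [in RHS](bigD1_seq i) ?iota_uniq ?mem_iota //= -cats1 count_cat /= addn0.
rewrite addnAC; congr (_ + _ + _)%N; apply: eq_bigr => j ji.
by rewrite eq_sym (negPf ji).
Qed.

(** The content of a lattice word vanishes at [size w], so the searched range always contains an
    empty row. *)
Definition height (w : seq nat) : nat :=
  find (fun j => content w j == 0%N) (iota 0 (size w).+1).

Lemma height_lt N m w j : w \in lattice_words N m ->
  (j < height w)%N = (0 < content w j)%N.
Proof.
move=> ww; have sz := size_lattice_word ww.
have le_h : (height w < (size w).+1)%N.
  rewrite -[X in (_ < X)%N](size_iota 0) -has_find; apply/hasP; exists (size w).
    by rewrite mem_iota ltnS leqnn.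
  by rewrite (lattice_word_ge ww) // sz.
have pw := part_lattice_word ww.
have h0 : content w (height w) = 0%N.
  have := @nth_find _ 0%N (fun j => content w j == 0%N) (iota 0 (size w).+1).
  rewrite has_find size_iota => /(_ le_h); rewrite nth_iota // add0n.
  by move/eqP.
apply/idP/idP => [lt_j|].
  have := before_find 0%N lt_j; rewrite nth_iota ?(ltn_trans lt_j) // add0n lt0n.
  by move->.
apply: contraTT; rewrite -leqNgt -eqn0Ngt => le_j.
have : (content w j <= content w (height w))%N.
  rewrite -(subnKC le_j); elim: (j - _)%N => [|q IH]; first by rewrite addn0.
  by rewrite addnS; apply: leq_trans (pw _) IH.
by rewrite h0 leqn0.
Qed.

End WordRows.

Section WordTableaux.
Local Open Scope nat_scope.
Variables (r : nat) (ns : 'I_r -> nat).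
Hypothesis ns_gt0 : forall i, (0 < ns i)%N.
Local Notation n := (nvars ns).

Fact first_entry_subproof i : (start ns i < n)%N.
Proof. by apply: leq_trans (start_end ns i); rewrite -addn1 leq_add2l. Qed.

Definition entry i p : 'I_n :=
  nth (Ordinal (first_entry_subproof i)) (enum (block ns i)) p.

Lemma val_entry i p : (p < ns i)%N -> val (entry i p) = (start ns i + p)%N.
Proof. exact: nth_enum_block. Qed.

Lemma entry_inj i p q : (p < ns i)%N -> (q < ns i)%N -> entry i p = entry i q -> p = q.
Proof. by move=> lp lq /(congr1 val); rewrite !val_entry // => /addnI. Qed.

Definition word_tab i (w : seq nat) : tableau ns :=
  [seq [seq entry i p | p <- word_row w j] | j <- iota 0 (height w)].

Section OneWord.
Variables (i : 'I_r) (N : nat) (w : seq nat).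
Hypothesis ww : w \in lattice_words N (ns i).

Lemma nth_word_tab j : nth [::] (word_tab i w) j = [seq entry i p | p <- word_row w j].
Proof.
have [lt_j|le_j] := ltnP j (height w).
  by rewrite (nth_map 0%N) ?size_iota // nth_iota.
rewrite nth_default ?size_map ?size_iota //.
have : content w j = 0%N by apply/eqP; rewrite eqn0Ngt -(height_lt _ ww) -leqNgt.
by rewrite -size_word_row => /size0nil->.
Qed.

Lemma size_word_tab_row j : size (nth [::] (word_tab i w) j) = content w j.
Proof. by rewrite nth_word_tab size_map size_word_row. Qed.

Lemma perm_word_tab : perm_eq (flatten (word_tab i w)) (enum (block ns i)).
Proof.
have -> : enum (block ns i) = [seq entry i p | p <- iota 0 (size w)].
  rewrite (size_lattice_word ww) -(card_block ns i) cardE.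
  by rewrite -[RHS]/(mkseq (entry i) _) mkseq_nth.
have -> : word_tab i w = [seq map (entry i) s |
    s <- [seq word_row w j | j <- iota 0 (height w)]].
  by rewrite -map_comp.
rewrite -map_flatten perm_map // perm_word_rows //.
apply/allP => j jw; rewrite (height_lt _ ww).
by rewrite -has_count; apply/hasP; exists j => /=.
Qed.

Lemma word_tab_partition : is_partition (ns i) (shape (word_tab i w)).
Proof.
apply/and3P; split.
- apply/(sortedP 0%N) => j; rewrite size_map => lt_j.
  rewrite !(nth_map [::]) ?(ltnW lt_j) // !size_word_tab_row.
  exact: part_lattice_word ww j.
- apply/mapP => -[row /(nthP [::])[j lt_j <-] /esym/eqP].
  rewrite size_word_tab_row eqn0Ngt -(height_lt _ ww).
  by move: lt_j; rewrite size_map size_iota => ->.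
by rewrite -size_flatten (perm_size perm_word_tab) -cardE card_block.
Qed.

Lemma word_tab_standard : standard i (shape (word_tab i w)) (word_tab i w).
Proof.
have lt_p j p : p \in word_row w j -> (p < ns i)%N.
  by move/word_row_lt; rewrite (size_lattice_word ww).
apply/(standardP _ word_tab_partition (Ordinal (first_entry_subproof i))); split => //.
- exact: perm_word_tab.
- move=> j; rewrite nth_word_tab sorted_map.
  apply: (sub_in_sorted (P := fun p => p \in word_row w j)) (word_row_sorted w j).
    by move=> p q pj qj /= lt_pq; rewrite !val_entry ?(lt_p j) // ltn_add2l.
  exact/allP.
move=> j b; rewrite !nth_word_tab size_map => lt_b.
have lt_b0 : (b < size (word_row w j))%N.
  by apply: leq_trans lt_b _; rewrite !size_word_row; apply: part_lattice_word ww j.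
have lt_j := lt_p j _ (mem_nth 0%N lt_b0); have lt_j1 := lt_p j.+1 _ (mem_nth 0%N lt_b).
rewrite !(nth_map 0%N) // (val_entry lt_j) (val_entry lt_j1) ltn_add2l.
exact: word_row_col ww lt_b.
Qed.

End OneWord.

Lemma word_tab_inj i N w w' : w \in lattice_words N (ns i) ->
  w' \in lattice_words N (ns i) -> word_tab i w = word_tab i w' -> w = w'.
Proof.
move=> ww ww' e; have sz := size_lattice_word ww; have sz' := size_lattice_word ww'.
apply: word_row_inj => [|j]; first by rewrite sz sz'.
have := congr1 (fun t => nth [::] t j) e; rewrite !(nth_word_tab (N := N)) //.
apply: (@inj_in_map _ _ _ (fun p => p < ns i)%N).
- by move=> p q; apply: entry_inj.
- by apply/allP => p /word_row_lt; rewrite sz.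
by apply/allP => p /word_row_lt; rewrite sz'.
Qed.

Definition rtab_index :=
  {a : rdiagram r * rtableau ns | is_rdiagram ns a.1 && NST a.1 a.2}.

Lemma rtab_index_valid (a : rtab_index) : valid (val a).1 (val a).2.
Proof. by case/andP: (valP a) => h1 h2; apply: validP. Qed.

Definition words_rtab (w : 'I_r -> seq nat) : rdiagram r * rtableau ns :=
  ([ffun i => shape (word_tab i (w i))], [ffun i => word_tab i (w i)]).

Lemma words_rtabP w : (forall i, w i \in lattice_words (ns i) (ns i)) ->
  is_rdiagram ns (words_rtab w).1 && NST (words_rtab w).1 (words_rtab w).2.
Proof.
move=> ww; apply/andP; split; apply/forallP => i; rewrite !ffunE.
  exact: word_tab_partition (ww i).
exact: word_tab_standard (ww i).
Qed.

Lemma similar_words (a b : rtab_index) w w' :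
  (forall i, w i \in lattice_words (ns i) (ns i)) ->
  (forall i, w' i \in lattice_words (ns i) (ns i)) ->
  (forall i, content (w' i) = content (w i)) ->
  val a = words_rtab w -> val b = words_rtab w' ->
  similar (young ns) (fun c : rtab_index => trow (val c).2) a b.
Proof.
move=> ww ww' e ea eb; apply/similarP.
case: (rtab_same_sizes (rtab_index_valid a) (rtab_index_valid b)) => [i j|h hG hk].
  by rewrite ea eb !ffunE !(size_word_tab_row (N := ns i)) // e.
by exists h => // k; case: (hk k).
Qed.

Let pairs i := shape_pairs (ns i) (ns i).
Let choice := {dffun forall i : 'I_r, 'I_((ns i)`!)}.

Let pair_of (q : choice) i := nth ([::], [::]) (pairs i) (q i).

Let pair_ofP q i : [/\ (pair_of q i).1 \in lattice_words (ns i) (ns i),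
   (pair_of q i).2 \in lattice_words (ns i) (ns i)
  & content (pair_of q i).2 = content (pair_of q i).1].
Proof.
have : pair_of q i \in pairs i by rewrite mem_nth // size_shape_pairs.
by case: (pair_of q i) => w w'; rewrite mem_shape_pairs => /and3P[? ? /eqP].
Qed.

Let fst_index q : rtab_index :=
  exist (fun a => is_rdiagram ns a.1 && NST a.1 a.2) _
    (words_rtabP (fun i => let: And3 h _ _ := pair_ofP q i in h)).
Let snd_index q : rtab_index :=
  exist (fun a => is_rdiagram ns a.1 && NST a.1 a.2) _
    (words_rtabP (fun i => let: And3 _ h _ := pair_ofP q i in h)).

(** A permutation in the Young group is determined by its restrictions to the blocks. *)
Lemma card_young : (#|young ns| <= \prod_i (ns i)`!)%N.
Proof.
have nB i s : s \in young ns -> s \in 'N(block ns i | 'P)%g.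
  move=> /fixgP sY; rewrite !inE /=; apply/fintype.subsetP => k.
  by rewrite mem_block => bk; rewrite inE /= apermE mem_block sY.
pose f s : {ffun 'I_r -> 'S_n} := [ffun i => restr_perm (block ns i) s].
have f_inj : {in young ns &, injective f}.
  move=> s u sY uY /ffunP e; apply/permP => k.
  have := congr1 (fun p : 'S_n => p k) (e (blk k)); rewrite !ffunE.
  by rewrite !restr_permE ?nB ?mem_blk.
rewrite -(card_in_imset f_inj).
apply: leq_trans (_ : #|family (fun i => perm_on (block ns i))| <= _)%N.
  apply: subset_leq_card; apply/fintype.subsetP => _ /imsetP[s sY ->].
  by apply/familyP => i; rewrite ffunE; apply: restr_perm_on.
rewrite card_family foldrE big_map big_enum /=.
by apply: leq_prod => i _; rewrite card_perm card_block.
Qed.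

(** An element of [choice] selects in each block one of the n_i! pairs of words of equal content.
    The resulting pairs of r-tableaux are distinct and similar, and there are as many as the product
    of the n_i!, which bounds |G|. *)
Lemma young_pairs : exists (X : seq rtab_index) (Q : seq (rtab_index * rtab_index)),
  [/\ uniq X, uniq Q, forall p, p \in Q -> [/\ p.1 \in X, p.2 \in X
    & similar (young ns) (fun c : rtab_index => trow (val c).2) p.1 p.2]
    & (#|young ns| <= size Q)%N].
Proof.
pose Q := [seq (fst_index q, snd_index q) | q <- enum (predT : pred choice)].
exists (undup ([seq p.1 | p <- Q] ++ [seq p.2 | p <- Q])), Q; split.
- exact: undup_uniq.
- rewrite map_inj_uniq ?enum_uniq // => q q' e.
  have /= e1 := congr1 (fun p : rtab_index * rtab_index => (val p.1).2) e.
  have /= e2 := congr1 (fun p : rtab_index * rtab_index => (val p.2).2) e.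
  apply/ffunP => i; apply: val_inj.
  have lt_q (q0 : choice) : (q0 i < size (pairs i))%N.
    by rewrite size_shape_pairs // ltn_ord.
  apply/eqP; rewrite -(nth_uniq ([::], [::]) (lt_q q) (lt_q q')) ?shape_pairs_uniq //.
  apply/eqP; rewrite -/(pair_of q i) -/(pair_of q' i).
  have [w1 w2 _] := pair_ofP q i; have [w1' w2' _] := pair_ofP q' i.
  have /ffunP/(_ i) := e1; rewrite !ffunE => /(word_tab_inj w1 w1') E1.
  have /ffunP/(_ i) := e2; rewrite !ffunE => /(word_tab_inj w2 w2') E2.
  by rewrite [LHS]surjective_pairing E1 E2 -surjective_pairing.
- move=> p pQ; rewrite !mem_undup !mem_cat !map_f ?orbT //; split=> //.
  case/mapP: pQ => q _ ->; apply: (@similar_words _ _ (fun i => (pair_of q i).1)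
     (fun i => (pair_of q i).2)) => // i; by have [] := pair_ofP q i.
rewrite size_map -cardE card_dep_ffun foldrE big_map big_enum /=.
apply: leq_trans card_young _; rewrite leq_eqVlt; apply/orP; left; apply/eqP.
by apply: eq_bigr => i _; rewrite card_ord.
Qed.

End WordTableaux.

(** * The submodules N_T *)

Section Rescaling.
Variables (C : numFieldType) (n : nat) (G : {group 'S_n}) (I : eqType).
Variables S F : I -> {mpoly C[n]}.
Hypothesis F_scale : forall a, exists2 c, c != 0 & F a = c *: S a.

Lemma scale_simple :
  (forall t a, act G a (S t) != 0 -> exists b, act G b (act G a (S t)) = S t) ->
  forall t a, act G a (F t) != 0 -> exists b, act G b (act G a (F t)) = F t.
Proof.
move=> hS t a; have [c c0 ->] := F_scale t; rewrite linearZ scaler_eq0 negb_or.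
by case/andP => _ /hS[b e]; exists b; rewrite linearZ /= e.
Qed.

Lemma scale_dual :
  (forall (X : seq I) t, uniq X -> exists2 a, act G a (S t) = S t &
    forall j, j \in X -> j != t -> act G a (S j) = 0) ->
  forall (X : seq I) t, uniq X -> exists2 a, act G a (F t) = F t &
    forall j, j \in X -> j != t -> act G a (F j) = 0.
Proof.
move=> hS X t /hS-/(_ t)[a at_ a0]; exists a => [|j jX jt].
  by have [c _ ->] := F_scale t; rewrite linearZ /= at_.
by have [c _ ->] := F_scale j; rewrite linearZ /= (a0 _ jX jt) scaler0.
Qed.

Lemma scale_faithful (X : seq I) :
  (forall a, (forall j, j \in X -> act G a (S j) = 0) ->
     forall g, g \in G -> a g = 0) ->
  forall a, (forall j, j \in X -> act G a (F j) = 0) ->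
    forall g, g \in G -> a g = 0.
Proof.
move=> hS a ha; apply: hS => j jX; have := ha j jX.
have [c c0 ->] := F_scale j; rewrite linearZ /= => /eqP.
by rewrite scaler_eq0 (negPf c0) => /eqP.
Qed.

End Rescaling.

Section Submodules.
Variables (R : realType) (r : nat) (ns : 'I_r -> nat).
Hypothesis ns_gt0 : forall i, (0 < ns i)%N.
Local Notation C := R[i].
Local Notation n := (nvars ns).
Local Notation OX := {mpoly C[n]}.
Local Notation OU := (OU R ns).
Local Notation I := (rtab_index ns).
Local Notation G := (young ns).

Let row (a : I) := trow (val a).2.
Let col (a : I) := young_col (@blk r ns) (tcol (val a).2).
Let S (a : I) : OX := specht C (row a) (col a).
Let F (a : I) : OX := F_ R (val a).1 (val a).2.

Let tabs a : is_tab G (row a) (col a).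
Proof. exact: rtab_tab (rtab_index_valid a). Qed.

Let std a (k l : 'I_n) : col a k = col a l -> (row a k < row a l)%N -> (k < l)%N.
Proof. exact: rtab_std (rtab_index_valid a) k l. Qed.

Let row_inj a b : row a =1 row b -> a = b.
Proof.
move=> e; apply: val_inj; rewrite [val a]surjective_pairing [val b]surjective_pairing.
exact: rtab_same_rows (rtab_index_valid a) (rtab_index_valid b) e.
Qed.

Let same_shape a b g : g \in G -> (forall k, row b (g k) = row a k) ->
  exists2 h, h \in G & forall k, row b (h k) = row a k /\ col b (h k) = col a k.
Proof. exact: rtab_same_shape (rtab_index_valid a) (rtab_index_valid b) g. Qed.

Let simple a (c : 'S_n -> C) : act G c (S a) != 0 ->
  exists b, act G b (act G c (S a)) = S a.
Proof. exact: specht_simple (tabs a). Qed.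

Let F_scale a : exists2 c, c != 0 & F a = c *: S a.
Proof. exact: F_specht (rtab_index_valid a). Qed.

Lemma F_simple a (c : 'S_n -> C) : act G c (F a) != 0 ->
  exists b, act G b (act G c (F a)) = F a.
Proof. exact: (scale_simple F_scale simple). Qed.

Lemma F_dual (X : seq I) t : uniq X -> exists2 a, act G a (F t) = F t &
  forall j, j \in X -> j != t -> act G a (F j) = 0.
Proof.
apply: (scale_dual F_scale) => {}X {}t uX.
exact: (specht_dual tabs std row_inj same_shape simple t uX).
Qed.

(** Enlarging a faithful list keeps it faithful; L serves to include the tableau whose module is
    studied. *)
Lemma F_faithful (L : seq I) : exists X : seq I,
  [/\ uniq X, {subset L <= X} & forall a, (forall j, j \in X -> act G a (F j) = 0) ->
     forall g, g \in G -> a g = 0].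
Proof.
have [X [Q [uX uQ XQ le_Q]]] := young_pairs ns_gt0.
exists (undup (L ++ X)); split; first exact: undup_uniq.
  by move=> a aL; rewrite mem_undup mem_cat aL.
apply: (scale_faithful F_scale) => a ha.
apply: (specht_faithful tabs std row_inj same_shape simple uX uQ XQ le_Q) => j jX.
by apply: ha; rewrite mem_undup mem_cat jX orbT.
Qed.

Lemma F_neq0 a : F a != 0.
Proof.
have [c c0 ->] := F_scale a; rewrite scaler_eq0 negb_or c0 /=.
exact: specht_neq0 (tabs a) C.
Qed.

Variables (y : n.-tuple OX) (d : 'I_n -> OU -> OU).
Variable T : {additive pi_plus y -> OU}.
Hypothesis y_gens : invariant_generators y.
Hypothesis d_ext : dy_extensions y d.
Hypothesis T_emb : direct_image_embedding d T.

Let io : {rmorphism OX -> OU} := @toOU R r ns.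
(** Odd permutations inside a block change the sign of Delta; its norm is a G-invariant denominator
    for O_U. *)
Let D : OX := gnorm G (Delta R ns).

Let dyE j k : d j (io (tnth y k)) = if j == k then 1 else 0.
Proof. by have [_ h] := d_ext j; apply: h. Qed.

Let D_denom (u : OU) : exists p k, io (D ^+ k) * u = io p.
Proof.
have [p [k e]] := OU_denom u; have [q qE] := gnorm_dvd G (Delta R ns).
exists (q ^+ k * p), k; rewrite /D qE exprMn !(rmorphM io) -mulrA.
exact: (congr1 (fun v => io (q ^+ k) * v) e).
Qed.

Let diffop_DY A : diffop io y d A -> DY y d A.
Proof.
elim=> [c|j|j|A1 A2 _ h1 _ h2|A1 A2 _ h1 _ h2].
- exact: DY_gen (Scal ns c).
- exact: DY_gen (Pos R j).
- exact: DY_gen (Der R j).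
- exact: DY_add.
- exact: DY_mul.
Qed.

Let DY_diffop A : DY y d A -> diffop io y d A.
Proof.
elim=> [[c|j|j]|A1 A2 _ h1 _ h2|A1 A2 _ h1 _ h2].
- exact: DiffScal.
- exact: DiffPos.
- exact: DiffDer.
- exact: DiffAdd.
- exact: DiffMul.
Qed.

Let io_reg p u : p != 0 -> io p * u = 0 -> u = 0.
Proof. exact: toOU_reg. Qed.

Let y_inv j g : g \in G -> msym g (tnth y j) = tnth y j.
Proof. exact: gen_invariant. Qed.

Let dA := d_add d_ext.
Let dM := d_mul d_ext.
Let dC j c : d j (io c%:MP) = 0.
Proof. exact: d_const. Qed.

Let chain i f : io f^`M(i) = \sum_(j < n) io (tnth y j)^`M(i) * d j (io f).
Proof. exact: (chain_rule d_ext T_emb). Qed.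

Let D_neq0 : D != 0.
Proof. exact: gnorm_neq0 (Delta_neq0 R ns). Qed.

Let D_inv g : g \in G -> msym g D = D.
Proof. exact: msym_gnorm. Qed.

Let inv_comp q : (forall g, g \in G -> msym g q = q) -> exists q', q = q' \mPo y.
Proof. exact: invariant_comp. Qed.

Let tauD f g : tau T (f + g) = tau T f + tau T g.
Proof. by rewrite /tau tensorDr raddfD. Qed.

Let tauM p f : tau T (p * f) = io p * tau T f.
Proof.
rewrite (tauE T_emb) (tauE T_emb f) mulrA.
exact: (congr1 (fun u => u * tau T 1) (rmorphM io p f)).
Qed.

Let tau_Delta f : io (Delta R ns) * tau T f = io f.
Proof. exact: (Delta_tau T_emb). Qed.

Let tau_mderiv i f :
  tau T f^`M(i) = \sum_(j < n) d j (tau T ((tnth y j)^`M(i) * f)).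
Proof. exact: (tau_der T_emb). Qed.

Let submodE N : DY_submodule y d N <-> submod io y d N.
Proof.
by split=> -[N0 NA ND]; split=> // A u hA; apply: ND;
  [apply: diffop_DY | apply: DY_diffop].
Qed.

Lemma N_submodule (a : I) : DY_submodule y d (N_ y d (val a).1 (val a).2).
Proof.
split=> [|_ _ [A hA ->] [B hB ->]|A _ hA [B hB ->]].
- by exists (fun=> 0); first exact: DY_zero.
- by exists (fun u => A u + B u); first exact: DY_add.
- by exists (fun u => A (B u)); first exact: DY_mul.
Qed.

Lemma N_range (a : I) : (N_ y d (val a).1 (val a).2 `<=` range T)%classic.
Proof.
move=> _ [A hA ->]; have [_ _ h] := range_submodule d_ext T_emb.
exact: h _ _ hA (toOU_range T_emb _).
Qed.

Lemma N_irreducible (a : I) : DY_irreducible y d (N_ y d (val a).1 (val a).2).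
Proof.
have Fa : N_ y d (val a).1 (val a).2 (io (F a)) by exists id; first exact: DY_id.
split; first exact: N_submodule.
  move=> e; move: Fa; rewrite e => /eqP.
  by rewrite toOU_eq0; apply/negP; exact: F_neq0.
move=> N' hN' subN; have [[v Nv v0]|nN] := pselect (exists2 v, N' v & v != 0).
  right; apply/seteqP; split=> // _ [A hA ->].
  have [_ _ ND] := hN'; apply: (ND _ _ hA).
  have [X [uX aX faith]] := F_faithful [:: a].
  apply: (cyclic_irreducible io_reg y_inv dA dM dC dyE chain D_neq0 D_inv D_denom
    inv_comp tauD tauM tau_Delta (Delta_neq0 R ns) tau_mderiv F_simple F_dual
    uX faith (aX a (mem_head _ _))) => [|w Nw|]; first exact/submodE.
    by have [B hB ->] := subN w Nw; exists B; first exact: DY_diffop.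
  by exists v.
left; apply/seteqP; split=> [v Nv|_ ->]; last by have [] := hN'.
by apply/eqP; apply: contraT => v0; case: nN; exists v.
Qed.

Lemma N_direct_sum : direct_sum
  (fun a : rdiagram r * rtableau ns => is_rdiagram ns a.1 && NST a.1 a.2)
  (fun a => N_ y d a.1 a.2) (range T).
Proof.
split=> [v|s u us sP hu sum0].
  split=> [Tv|[s [u [us sP hu] ->]]].
    have [X [uX _ faith]] := F_faithful [::].
    have [A hA ->] : cyclics io y d F X xpredT v.
      apply: (range_generated T_emb _ _ Tv).
        exact/submodE/cyclics_submod.
      exact: (cyclics_full io_reg y_inv dA dM dC dyE chain D_neq0 D_inv D_denom
        inv_comp tauD tauM tau_Delta (Delta_neq0 R ns)
        tau_mderiv uX faith).
    (* The summands are indexed by plain pairs: [insub] recovers the valid index, and the default 0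
       does not occur on [map val X]. *)
    exists (map val X), (fun b => if insub b is Some a then A a (io (F a)) else 0).
      split; first by rewrite (map_inj_uniq val_inj).
        by apply/allP => _ /mapP[a _ ->]; exact: (valP a).
      by move=> _ /mapP[a _ ->]; rewrite valK; exists (A a); first exact: diffop_DY.
    by rewrite big_map; apply: eq_bigr => a _; rewrite valK.
  have [R0 RA _] := range_submodule d_ext T_emb.
  rewrite big_seq; apply: (big_ind (range T)) => // a sa.
  have Pa := allP sP a sa.
  exact: (@N_range (exist _ a Pa) _ (hu a sa)).
(* All members of s are valid, so passing to the subtype loses none of them. *)
pose s' : seq I := pmap insub s.
have s'E : map val s' = s.
  rewrite (pmap_filter (insubK _)); apply/all_filterP/(sub_all _ sP) => a Pa.
  by rewrite insubT.
have us' : uniq s' by rewrite -(map_inj_uniq val_inj) s'E.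
have /choice[A hA] (a : I) : exists A,
    diffop io y d A /\ (a \in s' -> u (val a) = A (io (F a))).
  have [as'|] := boolP (a \in s'); last by exists id; split=> //; apply: diffop_id.
  have as_ : val a \in s by rewrite -s'E map_f.
  by have [A hA e] := hu _ as_; exists A; split=> //; apply: DY_diffop.
have sumA : \sum_(a <- s') A a (io (F a)) = 0.
  rewrite -[RHS]sum0 -s'E big_map; apply: eq_big_seq => a as'.
  by have [_ ->] := hA a.
have direct := cyclic_direct io_reg y_inv dA dM dC dyE chain D_neq0 D_inv D_denom
  F_dual us' (fun a _ => proj1 (hA a)) sumA.
move=> b; rewrite -s'E => /mapP[a as' ->].
by have [_ ->] := hA a; first exact: direct.
Qed.

End Submodules.

Theorem theorem3p8 (R : realType) (r : nat) (ns : 'I_r -> nat)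
    (ns_gt0 : forall i, (0 < ns i)%N)
    (y : (nvars ns).-tuple {mpoly R[i][nvars ns]})
    (y_gens : invariant_generators y)
    (d : 'I_(nvars ns) -> OU R ns -> OU R ns)
    (d_ext : dy_extensions y d)
    (T : {additive pi_plus y -> OU R ns})
    (T_emb : direct_image_embedding d T) :
  (forall (lam : rdiagram r) (t : rtableau ns),
     is_rdiagram ns lam -> NST lam t ->
     (N_ y d lam t `<=` range T)%classic /\ DY_irreducible y d (N_ y d lam t))
  /\ direct_sum
       (fun a : rdiagram r * rtableau ns => is_rdiagram ns a.1 && NST a.1 a.2)
       (fun a => N_ y d a.1 a.2)
       (range T).
Proof.
split=> [lam t hlam ht|]; last exact: N_direct_sum.
have P : is_rdiagram ns (lam, t).1 && NST (lam, t).1 (lam, t).2 by apply/andP.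
pose a : rtab_index ns := exist (fun a => is_rdiagram ns a.1 && NST a.1 a.2) (lam, t) P.
split; first exact: (N_range (a := a) d_ext T_emb).
exact: (N_irreducible ns_gt0 y_gens d_ext T_emb a).
Qed.
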